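(* Let $T>0$, let $(f,g)\in\mathcal{H}^{1/2}(\Omega)\times\mathcal{H}^{-1/2}(\Omega)$ and let $\varphi_0\in\mathcal{H}^{-1/2}(\Omega)$ be arbitrary. Suppose that the Cauchy problem $$(\partial_t^2-A^2)u=0\ \text{ in }(0,T)\times\Omega,\qquad u(0)=f,\quad \partial_tu(0)=g$$ is consistent for the data $(f,g)$, i.e. it has a solution $u\in V_e$. Define $\varphi_k:=T_e(\varphi_{k-1})$ for $k\ge1$, where $T_e:\mathcal{H}^{-1/2}(\Omega)\to\mathcal{H}^{-1/2}(\Omega)$ is the affine operator $$T_e(\varphi):=\tanh(AT)^2\varphi+\sinh(AT)\cosh(AT)^{-2}Af+\cosh(AT)^{-1}g .$$ Then the sequence $\varphi_k$ converges to $\partial_tu(T)$ in the norm of $\mathcal{H}^{-1/2}(\Omega)$.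
   Context: Let $\Omega\subset\mathbb{R}^n$ be an open, bounded set with smooth boundary and let $A$ be a positive ($\langle A\varphi,\varphi\rangle>0$ for $0\neq\varphi$ in the domain of $A$), self-adjoint, unbounded operator with discrete spectrum, densely defined on the Hilbert space $H:=L^2(\Omega)$. Let $E_\lambda$, $\lambda\in\mathbb{R}$, denote the resolution of the identity associated to $A$. For $s\ge 0$ set $\mathcal{H}^s(\Omega):=\{\varphi\in H : \|\varphi\|_s:=(\int_0^\infty(1+\lambda^2)^s\,d\langle E_\lambda\varphi,\varphi\rangle)^{1/2}<\infty\}$. For $s>0$, $\mathcal{H}^{-s}(\Omega)$ is the dual of $\mathcal{H}^s(\Omega)$ (with pivot space $H$); equivalently, it is the completion of $H$ in the norm $\|\varphi\|_{-s}:=(\int_0^\infty(1+\lambda^2)^{-s}\,d\langle E_\lambda\varphi,\varphi\rangle)^{1/2}$. Functions of $A$ are defined by the spectral calculus of $A$ (extended to the spaces $\mathcal{H}^{s}(\Omega)$). $V_e:=\{u\in L^2(0,T;\mathcal{H}^1(\Omega)) : (\partial_t^2-A^2)u=0\text{ in }(0,T)\times\Omega\}$, with norm $\|u\|_{V_e}:=(\int_0^T(\|u(t)\|_1^2+\|\partial_tu(t)\|_0^2)\,dt)^{1/2}$. For $u\in V_e$ one has $\partial_tu\in L^2(0,T;H)$, $u(0),u(T)\in\mathcal{H}^{1/2}(\Omega)$ and $\partial_tu(0),\partial_tu(T)\in\mathcal{H}^{-1/2}(\Omega)$ in the sense of traces. The operator $T_e$ arises as follows: given $\varphi$, solve for $v,w\in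 V_e$ the mixed boundary value problems $(\partial_t^2-A^2)v=0$, $v(0)=f$, $\partial_tv(T)=\varphi$, and $(\partial_t^2-A^2)w=0$, $\partial_tw(0)=g$, $w(T)=v(T)$; then $T_e(\varphi)=\partial_tw(T)$. *)

(* Defs.v *)
From HB Require Import structures.
From mathcomp Require Import all_boot all_order all_algebra.
From mathcomp Require Import all_classical all_reals all_analysis.
From mathcomp Require Import ring lra.
From mathcomp Require Import generic_quotient ring_quotient.

Set Implicit Arguments.
Unset Strict Implicit.
Unset Printing Implicit Defensive.

Import Order.TTheory GRing.Theory Num.Theory.
Import numFieldNormedType.Exports.

Local Open Scope classical_set_scope.
Local Open Scope ring_scope.

Section power_measure.
Context d (T : measurableType d) (R : realType).
Variable mu : {sigma_finite_measure set T -> \bar R}.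

Definition tcons n (x : T * n.-tuple T) : n.+1.-tuple T :=
  [tuple of x.1 :: x.2].

Lemma measurable_tcons n : measurable_fun setT (@tcons n).
Proof. exact: measurable_cons. Qed.

Section step.
Variables (n : nat) (m : {sigma_finite_measure set (n.-tuple T) -> \bar R}).

Definition pow_step : set (n.+1.-tuple T) -> \bar R :=
  pushforward (product_measure1 mu m) (@tcons n).

Let M : {measure set (n.+1.-tuple T) -> \bar R} :=
  measure_function_pushforward__canonical__measure_function_Measure
    (product_measure1 mu m) (@measurable_tcons n).

HB.instance Definition _ := Measure.copy pow_step M.

Let pow_step_sigma_finite : sigma_finite setT pow_step.
Proof.
have /sigma_finiteP[F [TF ndF Foo]] := sigma_finiteT mu.
have /sigma_finiteP[G [TG ndG Goo]] := sigma_finiteT m.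
pose u (t : n.+1.-tuple T) := (tnth t ord0, [tuple of behead t]).
have mu_ : measurable_fun setT u.
  apply: measurable_fun_pair; first exact: measurable_tnth.
  exact: measurable_behead.
exists (fun k => u @^-1` (F k `*` G k)).
  rewrite -preimage_bigcup -(_ : setT = \bigcup_k (F k `*` G k))//.
  rewrite -setXTT TF TG predeqE => -[x y]; split.
    move=> [/= [i _ Fx] [k _ Gy]]; exists (maxn i k) => //; split.
    - by move: x Fx; exact/subsetPset/ndF/leq_maxl.
    - by move: y Gy; exact/subsetPset/ndG/leq_maxr.
  by move=> [i _ []/= ? ?]; split; exists i.
move=> k; have [mF Fk] := Foo k; have [mG Gk] := Goo k; split.
  by rewrite -[X in measurable X]setTI; apply: mu_ => //; exact: measurableX.
rewrite /pow_step /pushforward -comp_preimage.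
rewrite (_ : u \o @tcons n = id); last first.
  by apply/funext => -[a t]; rewrite /u /tcons/=; congr pair; exact/val_inj.
by rewrite preimage_id product_measure1E// lte_mul_pinfty// ge0_fin_numE.
Qed.

HB.instance Definition _ :=
  @Measure_isSigmaFinite.Build _ _ _ pow_step pow_step_sigma_finite.

End step.

Fixpoint pow_measure n : {sigma_finite_measure set (n.-tuple T) -> \bar R} :=
  if n isn't m.+1 then \d_([tuple]) else pow_step (pow_measure m).

End power_measure.

Section Rn.
Variables (R : realType) (n : nat).

(* 'rV[R]_n with its Borel sigma-algebra. *)
Definition Rn := g_sigma_algebraType (@open 'rV[R]_n).

Definition row_of_tuple (t : n.-tuple (measurableTypeR R)) : Rn :=
  \row_i tnth t i.

Lemma measurable_row_of_tuple : measurable_fun setT row_of_tuple.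
Proof.
apply: (@measurability _ _ _ Rn _ _ (@open 'rV[R]_n)) => [//|_ [U oU <-]]; rewrite setTI.
pose S := [set p : n.-tuple rat * nat |
  ball (\row_i ratr (tnth p.1 i) : 'rV[R]_n) (p.2.+1%:R^-1) `<=` U].
pose F (p : n.-tuple rat * nat) : set (n.-tuple (measurableTypeR R)) :=
  if p \in S then [set t | forall i : 'I_n,
    ball (ratr (tnth p.1 i) : R) (p.2.+1%:R^-1) (tnth t i)] else set0.
rewrite (_ : _ @^-1` _ = \bigcup_p F p).
  apply: countable_bigcupT_measurable => // p; rewrite /F; case: ifPn => // _.
  rewrite (_ : [set _ | _] = \bigcap_(i in [set: 'I_n])
    ((fun t : n.-tuple (measurableTypeR R) => tnth t i) @^-1`
      (ball (ratr (tnth p.1 i) : R) p.2.+1%:R^-1))); last first.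
    by apply/seteqP; split => t /= H i; [move=> _|]; exact: H.
  apply: fin_bigcap_measurable => // i _.
  rewrite -[X in measurable X]setTI; apply: measurable_tnth => //.
  exact: measurable_realfun.measurable_ball.
apply/seteqP; split => [t /= Ut|t [p _]].
  have /nbhs_ballP[e /= e0 eU] := open_nbhs_nbhs (conj oU Ut).
  have [k ke] : exists k, k.+1%:R^-1 + k.+1%:R^-1 < e.
    have [k _ /(_ k (leqnn k))/= ke] :=
      near_infty_natSinv_lt (PosNum (divr_gt0 e0 (ltr0Sn R 1))).
    have {}ke : k.+1%:R^-1 < e / 2 := ke.
    by exists k; move: (_^-1) ke => z ke; lra.
  have k0 : 0 < k.+1%:R^-1 :> R by rewrite invr_gt0.
  have /choice[q qP] : forall i : 'I_n, exists q : rat,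
      ball (ratr q : R) (k.+1%:R^-1) (tnth t i).
    move=> i.
    have [|q] := @rat_in_itvoo R (tnth t i - k.+1%:R^-1) (tnth t i).
      by rewrite ltrBlDr ltrDl.
    rewrite in_itv/= => /andP[q1 q2]; exists q.
    by rewrite /ball/= ltr_norml; apply/andP; split; move: (_^-1) (ratr q : R) q1 q2 k0 => z w; lra.
  exists ([tuple q i | i < n], k) => //; rewrite /F ifT.
    by move=> i /=; rewrite tnth_mktuple; exact: qP.
  rewrite inE /S/= => y /= [_ qy]; apply: eU.
  split => // i j; rewrite ord1.
  have := qP j; have := qy ord0 j; rewrite !mxE tnth_mktuple /ball/=.
  move: (_^-1) ke (ratr _ : R) => z ke w; rewrite !ltr_norml.
  by move=> /andP[? ?] /andP[? ?]; apply/andP; split; lra.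
rewrite /F; case: ifPn => //; rewrite inE => pS /= tp; apply: pS; split => //.
by move=> i j; rewrite !mxE; exact: tp.
Qed.

(* The n-fold product of the Lebesgue measure, transported from tuples to row
   vectors. *)
Definition lebesgue_Rn : set Rn -> \bar R :=
  pushforward (pow_measure (@lebesgue_measure R) n) row_of_tuple.

Let M : {measure set Rn -> \bar R} :=
  measure_function_pushforward__canonical__measure_function_Measure
    (pow_measure (@lebesgue_measure R) n) measurable_row_of_tuple.

HB.instance Definition _ := Measure.copy lebesgue_Rn M.

End Rn.

HB.mixin Record Lmodule_isInnerProductSpace (R : realType) H
    & GRing.Lmodule R H := {
  ip : H -> H -> R ;
  ipC : forall x y, ip x y = ip y x ;
  ipDl : forall x y z, ip (x + y) z = ip x z + ip y z ;
  ipZl : forall a x y, ip (a *: x) y = a * ip x y ;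
  ip_ge0 : forall x, 0 <= ip x x ;
  ip_eq0 : forall x, ip x x = 0 -> x = 0
}.

#[short(type=innerProductType)]
HB.structure Definition InnerProductSpace (R : realType) :=
  {H of GRing.Lmodule R H & Lmodule_isInnerProductSpace R H}.

Section L2.
Context d (T : measurableType d) (R : realType).
Variable mu : {measure set T -> \bar R}.

Let sqLfun := LfunType mu (lee1n 2 : (1 <= 2%:R%:E :> \bar R)%E).

(* The almost everywhere null functions. *)
Definition ae0 : {pred sqLfun} := fun f => `[< f = (cst 0 : T -> R) %[ae mu] >].

Lemma ae0_zmod_closed : zmod_closed ae0.
Proof.
split; first by rewrite unfold_in; apply/asboolP; exact: ae_eq_refl.
move=> f g /asboolP f0 /asboolP g0; apply/asboolP.
apply: filterS2 f0 g0 => x fx gx Dx.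
rewrite -[LHS]/((f : T -> R) x - (g : T -> R) x).
by rewrite (fx Dx) (gx Dx) /= subr0.
Qed.

HB.instance Definition _ := GRing.isZmodClosed.Build sqLfun ae0 ae0_zmod_closed.

Definition L2 : Type := Quotient.quot ae0.
HB.instance Definition _ := GRing.Zmodule.on L2.
HB.instance Definition _ := EqQuotient.on L2.

Definition L2_scale (a : R) (x : L2) : L2 := \pi_L2%qT (a *: repr x).

Lemma L2_piP (f g : sqLfun) :
  \pi_L2%qT f = \pi_L2%qT g <-> (f : T -> R) = g %[ae mu].
Proof.
rewrite (rwP eqP) -Quotient.idealrBE; split.
  move=> /asboolP; apply: filterS => x fg Dx.
  by move/eqP: (fg Dx); rewrite -[X in X == _]/(f x - g x) subr_eq0 => /eqP.
move=> fg; apply/asboolP; move: fg; apply: filterS => x fg Dx.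
by rewrite -[LHS]/(f x - g x) (fg Dx) subrr.
Qed.

Lemma L2_reprE (f : sqLfun) : (repr (\pi_L2%qT f) : T -> R) = f %[ae mu].
Proof. by apply/L2_piP; rewrite reprK. Qed.

Lemma L2_pi_scale a (f : sqLfun) :
  \pi_L2%qT (a *: f) = L2_scale a (\pi_L2%qT f).
Proof.
apply/L2_piP; have := L2_reprE f; apply: filterS => x fx Dx.
by rewrite -[LHS]/(a * f x) -[RHS]/(a * repr (\pi_L2%qT f) x) (fx Dx).
Qed.

Lemma L2_piD (f g : sqLfun) : \pi_L2%qT (f + g) = \pi_L2%qT f + \pi_L2%qT g.
Proof. exact: Quotient.pi_add. Qed.

Let scaleA a b (x : L2) : L2_scale a (L2_scale b x) = L2_scale (a * b) x.
Proof. by rewrite -{1}[x]reprK -(L2_pi_scale b) -(L2_pi_scale a) scalerA. Qed.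

Let scale1 : left_id 1 L2_scale.
Proof. by move=> x; rewrite -[x]reprK -L2_pi_scale scale1r. Qed.

Let scaleDr : right_distributive L2_scale +%R.
Proof.
by move=> a x y; rewrite -[x]reprK -[y]reprK -L2_piD -!L2_pi_scale -L2_piD scalerDr.
Qed.

Let scaleDl (x : L2) : {morph L2_scale^~ x : a b / a + b}.
Proof. by move=> a b; rewrite -[x]reprK -!L2_pi_scale -L2_piD scalerDl. Qed.

HB.instance Definition _ := GRing.Zmodule_isLmodule.Build R L2
  scaleA scale1 scaleDr scaleDl.

Definition L2_ip (x y : L2) : R := \int[mu]_t (repr x t * repr y t).

Lemma sqLfun_integrableM (f g : sqLfun) :
  mu.-integrable setT (EFin \o (fun t => f t * g t)).
Proof. by apply/Lfun1_integrable/Lfun2_mul_Lfun1; exact: LfunP. Qed.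

Lemma L2_ip_pi (f g : sqLfun) :
  L2_ip (\pi_L2%qT f) (\pi_L2%qT g) = \int[mu]_t (f t * g t).
Proof.
congr fine; apply: ae_eq_integral => //.
- by case/integrableP: (sqLfun_integrableM (repr (\pi_L2%qT f)) (repr (\pi_L2%qT g))).
- by case/integrableP: (sqLfun_integrableM f g).
- apply: filterS2 (L2_reprE f) (L2_reprE g) => t ft gt Dt.
  by rewrite (ft Dt) (gt Dt).
Qed.

Let L2_ipC x y : L2_ip x y = L2_ip y x.
Proof. by apply: eq_Rintegral => t _; rewrite mulrC. Qed.

Let L2_ipDl x y z : L2_ip (x + y) z = L2_ip x z + L2_ip y z.
Proof.
rewrite -[x]reprK -[y]reprK -[z]reprK -L2_piD !L2_ip_pi.
move: (repr x) (repr y) (repr z) => {x y z} f g h.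
rewrite -RintegralD//; try exact: sqLfun_integrableM.
by apply: eq_Rintegral => t _; rewrite -mulrDl.
Qed.

Let L2_ipZl a x y : L2_ip (a *: x) y = a * L2_ip x y.
Proof.
rewrite -[x]reprK -[y]reprK -[_ *: _]L2_pi_scale !L2_ip_pi.
move: (repr x) (repr y) => {x y} f g.
rewrite -RintegralZl//; try exact: sqLfun_integrableM.
by apply: eq_Rintegral => t _; rewrite mulrA.
Qed.

Let L2_ip_ge0 x : 0 <= L2_ip x x.
Proof. by apply: Rintegral_ge0 => t _; rewrite -expr2 sqr_ge0. Qed.

Let L2_ip_eq0 x : L2_ip x x = 0 -> x = 0.
Proof.
rewrite -[x]reprK L2_ip_pi; move: (repr x) => {x} f f0.
have ff_ge0 t : 0 <= f t * f t by rewrite -expr2 sqr_ge0.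
have /integrableP[mff iff] := sqLfun_integrableM f f.
suff : (f : T -> R) = (0 : sqLfun) %[ae mu].
  by move=> /L2_piP ->; rewrite /GRing.zero/= /Quotient.zero; unlock.
have : ae_eq mu setT (EFin \o (fun t => f t * f t)) (cst 0%E).
  apply/ae_eq_integral_abs => //.
  have intE : (\int[mu]_t `|(EFin \o (fun t => f t * f t)%R) t| =
               \int[mu]_t (f t * f t)%R%:E)%E.
    by apply: eq_integral => t _; rewrite /= ger0_norm.
  rewrite intE in iff *; rewrite -[LHS]fineK; first by congr EFin.
  by rewrite ge0_fin_numE//; apply: integral_ge0 => t _; rewrite lee_fin.
apply: filterS => t /= h Dt; have [/eqP] := h Dt.
by rewrite mulf_eq0 orbb => /eqP.
Qed.

HB.instance Definition _ := Lmodule_isInnerProductSpace.Build R L2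
  L2_ipC L2_ipDl L2_ipZl L2_ip_ge0 L2_ip_eq0.
End L2.

Section domain.
Variables (R : realType) (n : nat).
Implicit Types (U Omega : set 'rV[R]_n) (f : 'rV[R]_n -> R).

Fixpoint continuously_derivable (k : nat) U f : Prop :=
  (forall x, U x -> {for x, continuous f}) /\
  if k isn't j.+1 then True else
    forall v, (forall x, U x -> derivable f x v) /\
      continuously_derivable j U (fun x => 'D_v f x).

Definition smooth_on U f := forall k, continuously_derivable k U f.

(* Near each boundary point, Omega is the sublevel set of a smooth function
   whose differential does not vanish there. *)
Definition smooth_boundary Omega :=
  forall x, (closure Omega `\` interior Omega) x ->
  exists (U : set 'rV[R]_n) (rho : 'rV[R]_n -> R),
    [/\ open U /\ U x, smooth_on U rho, (exists v, 'D_v rho x != 0) &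
        Omega `&` U = [set y | U y /\ rho y < 0]].

Lemma open_measurable_Rn Omega : open Omega -> measurable (Omega : set (Rn R n)).
Proof. by move=> oO; exact: sub_sigma_algebra. Qed.

Definition lebesgue_on Omega (oOmega : open Omega) :
    {measure set (Rn R n) -> \bar R} :=
  mrestr (@lebesgue_Rn R n) (open_measurable_Rn oOmega).

End domain.

Section operators.
Variables (R : realType) (H : innerProductType R).

Definition hnorm (x : H) : R := Num.sqrt (ip x x).

Record operator := Operator {
  dom : set H ;
  op :> H -> H ;
  dom0 : dom 0 ;
  dom_lin : forall a x y, dom x -> dom y -> dom (a *: x + y) ;
  op_lin : forall a x y, dom x -> dom y -> op (a *: x + y) = a *: op x + op y
}.

Variable A : operator.

Definition densely_defined :=
  forall x e, 0 < e -> exists2 y, dom A y & hnorm (x - y) < e.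

Definition adjoint_graph (phi eta : H) :=
  forall psi, dom A psi -> ip (A psi) phi = ip psi eta.

Definition self_adjoint := densely_defined /\
  forall phi eta, (dom A phi /\ A phi = eta) <-> adjoint_graph phi eta.

Definition positive_op :=
  forall phi, dom A phi -> phi <> 0 -> 0 < ip (A phi) phi.

Definition unbounded :=
  ~ exists C, forall phi, dom A phi -> hnorm (A phi) <= C * hnorm phi.

Definition resolvent_set (l : R) := exists (B : H -> H) (C : R),
  [/\ forall eta, dom A (B eta) /\ A (B eta) - l *: B eta = eta,
      forall phi, dom A phi -> B (A phi - l *: phi) = phi &
      forall eta, hnorm (B eta) <= C * hnorm eta].

(* Only real l are considered, the spectrum of a self-adjoint operator being
   real. *)
Definition spectrum : set R := ~` [set l | resolvent_set l].

Definition eigenvalue_op (l : R) :=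
  exists phi, [/\ dom A phi, phi <> 0 & A phi = l *: phi].

Definition finite_multiplicity (l : R) :=
  exists (m : nat) (e : 'I_m -> H), forall phi, dom A phi -> A phi = l *: phi ->
    exists c : 'I_m -> R, phi = \sum_i c i *: e i.

Definition discrete_spectrum := forall l, spectrum l ->
  [/\ (exists2 e, 0 < e & forall l', spectrum l' -> `|l' - l| < e -> l' = l),
      eigenvalue_op l & finite_multiplicity l].

End operators.

Section spectral_family.
Variables (R : realType) (H : innerProductType R).

(* Right-continuous resolutions of the identity. *)
Record resolution := Resolution {
  resE :> R -> H -> H ;
  res_lin : forall l a x y, resE l (a *: x + y) = a *: resE l x + resE l y ;
  res_sym : forall l x y, ip (resE l x) y = ip x (resE l y) ;
  res_mul : forall l m x, resE l (resE m x) = resE (Num.min l m) x ;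
  res_rc : forall l x, hnorm (resE m x - resE l x) @[m --> l^'+] --> 0 ;
  res_ninfty : forall x, hnorm (resE l x) @[l --> -oo] --> 0 ;
  res_pinfty : forall x, hnorm (resE l x - x) @[l --> +oo] --> 0
}.

Variable E : resolution.

Definition sp_distr (phi : H) (l : R) : R := ip (E l phi) phi.

Section cumulative.
Variable phi : H.

Lemma ipDr (x y z : H) : ip x (y + z) = ip x y + ip x z.
Proof. by rewrite ipC ipDl !(ipC x). Qed.

Lemma ipNl (x y : H) : ip (- x) y = - ip x y.
Proof. by rewrite -scaleN1r ipZl mulN1r. Qed.

Lemma sp_distrB l m : l <= m ->
  sp_distr phi m - sp_distr phi l = hnorm (E m phi - E l phi) ^+ 2.
Proof.
move=> lm; rewrite /hnorm sqr_sqrtr ?ip_ge0// /sp_distr.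
have EE k j : ip (E k phi) (E j phi) = ip (E (Num.min j k) phi) phi.
  by rewrite -res_sym res_mul.
rewrite ipDl ipNl !ipDr !(ipC _ (- _)) !ipNl !EE.
by rewrite !minxx (min_r lm); ring.
Qed.

Lemma sp_distr_nd : nondecreasing (sp_distr phi).
Proof. by move=> l m lm; rewrite -subr_ge0 sp_distrB// sqr_ge0. Qed.

Lemma sp_distr_rc : right_continuous (sp_distr phi).
Proof.
move=> l.
have h : hnorm (E m phi - E l phi) ^+ 2 + sp_distr phi l @[m --> l^'+]
    --> sp_distr phi l.
  rewrite -[X in _ --> X]add0r; apply: cvgD; last exact: cvg_cst.
  rewrite -[X in _ --> X](mulr0 0); apply: cvgM; exact: res_rc.
apply: cvg_trans h; apply: near_eq_cvg => /=.
near=> m; rewrite -sp_distrB ?subrK//.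
Unshelve. all: by end_near. Qed.

HB.instance Definition _ :=
  isCumulative.Build R _ R (sp_distr phi) sp_distr_nd sp_distr_rc.

End cumulative.

(* The measure d<E_l phi, phi>. *)
Definition sp_measure (phi : H) : {measure set (measurableTypeR R) -> \bar R} :=
  lebesgue_stieltjes_measure (sp_distr phi).

(* int h(l) d<E_l phi, psi>, by polarization; meaningful when h is integrable
   for the spectral measures of phi + psi and phi - psi. *)
Definition sp_int (h : R -> R) (phi psi : H) : R :=
  (\int[sp_measure (phi + psi)]_l h l - \int[sp_measure (phi - psi)]_l h l) / 4.

Definition dom_fun (h : R -> R) : set H :=
  [set phi | (\int[sp_measure phi]_l (h l ^+ 2)%:E < +oo)%E].

(* y = h(A) phi; testing against dom_fun h suffices as it is dense in H. *)
Definition fun_graph (h : R -> R) (phi y : H) := dom_fun h phi /\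
  forall psi, dom_fun h psi -> ip y psi = sp_int h phi psi.

(* h(A) phi, for phi in dom_fun h. *)
Definition fcalc (h : R -> R) (phi : H) : H := xget 0 [set y | fun_graph h phi y].

Definition resolution_of (A : operator H) := forall phi eta,
  (dom A phi /\ A phi = eta) <-> fun_graph id phi eta.

Definition sob_sqnorm (s : R) (phi : H) : \bar R :=
  \int[sp_measure phi]_(l in `[0, +oo[) ((1 + l ^+ 2) `^ s)%:E.

Definition Sob (s : R) : set H := [set phi | (sob_sqnorm s phi < +oo)%E].

Definition sob_norm (s : R) (phi : H) : R := Num.sqrt (fine (sob_sqnorm s phi)).

(* The dual of Sob s with pivot space H, i.e. the space of order - s. Its
   elements are functions on H of which only the restriction to Sob s is
   relevant; phi : H is identified with ip phi. *)
Definition Sob_dual (s : R) : set (H -> R) := [set l |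
  (forall a x y, Sob s x -> Sob s y -> l (a *: x + y) = a * l x + l y) /\
  exists C, forall x, Sob s x -> `|l x| <= C * sob_norm s x].

Definition dual_norm (s : R) (l : H -> R) : R :=
  sup [set `|l x| | x in [set x | Sob s x /\ sob_norm s x <= 1]].

Definition cvg_dual (s : R) (l_ : nat -> H -> R) (l : H -> R) :=
  [/\ forall k, Sob_dual s (l_ k), Sob_dual s l &
      dual_norm s (l_ k - l) @[k --> \oo] --> 0].

(* h(A) phi as a functional, for h of polynomial growth and phi in some Sob s;
   for instance id sends Sob (1/2) to its dual and l |-> l ^+ 2 sends Sob 1 to
   its dual. *)
Definition fext (h : R -> R) (phi : H) : H -> R := fun psi => sp_int h phi psi.

(* h(A) l for bounded Borel h and a functional l, by transposition. *)
Definition fdual (h : R -> R) (l : H -> R) : H -> R := fun psi => l (fcalc h psi).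

End spectral_family.

Definition cosh (R : realType) (x : R) : R := (expR x + expR (- x)) / 2.
Definition sinh (R : realType) (x : R) : R := (expR x - expR (- x)) / 2.
Definition tanh (R : realType) (x : R) : R := sinh x / cosh x.

Section elliptic.
Variables (R : realType) (H : innerProductType R) (E : resolution H) (T : R).
Implicit Types (u : R -> H) (P : R -> H -> R) (theta : R -> R).

Definition simple_fun (I : set (measurableTypeR R)) (v : R -> H) :=
  finite_set (v @` I) /\ forall y, measurable (I `&` v @^-1` [set y]).

(* Elements of L^2(0,T; Sob s) are represented by functions that are pointwise
   limits on ]0,T[ of simple functions. *)
Definition strongly_measurable (s : R) u := exists v_ : nat -> R -> H,
  (forall k, simple_fun `]0, T[ (v_ k) /\
             forall t, t \in `]0, T[ -> Sob E s (v_ k t)) /\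
  forall t, t \in `]0, T[ -> Sob E s (u t) /\
    sob_norm E s (v_ k t - u t) @[k --> \oo] --> 0.

Definition L2_Sob (s : R) u := strongly_measurable s u /\
  (\int[lebesgue_measure]_(t in `]0%R, T[) ((sob_norm E s (u t)) ^+ 2)%:E < +oo)%E.

Definition test_function theta :=
  (forall k t, derivable (derive1n k theta) t 1) /\
  exists a b, [/\ 0 < a, b < T & forall t, theta t != 0 -> a <= t <= b].

(* (d_t^2 - A^2) u = 0 as a distribution on ]0,T[ with values in the dual of
   Sob 1; ip (u t) psi and fext ... (u t) psi are the duality pairings. *)
Definition elliptic_eq u := forall theta psi, test_function theta -> Sob E 1 psi ->
  \int[lebesgue_measure]_(t in `]0, T[) (ip (u t) psi * derive1n 2 theta t) =
  \int[lebesgue_measure]_(t in `]0, T[)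
    (fext E (fun l => l ^+ 2) (u t) psi * theta t).

Definition Ve u := L2_Sob 1 u /\ elliptic_eq u.

Definition continuous_Sob (s : R) u := forall t, t \in `[0, T] ->
  Sob E s (u t) /\
  sob_norm E s (u r - u t) @[r --> within `[0, T] (nbhs t)] --> 0.

Definition continuous_dual (s : R) P := forall t, t \in `[0, T] ->
  Sob_dual E s (P t) /\
  dual_norm E s (P r - P t) @[r --> within `[0, T] (nbhs t)] --> 0.

(* u(tau) = f, through the representative of u that is continuous with values
   in Sob (1/2). *)
Definition trace u (tau : R) (f : H) := exists v : R -> H,
  [/\ continuous_Sob 2^-1 v,
      {ae lebesgue_measure, forall t, t \in `]0, T[ -> v t = u t} & v tau = f].

(* P = d_t u as a distribution on ]0,T[. *)
Definition is_dt u P := forall theta psi, test_function theta ->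
  Sob E 2^-1 psi ->
  \int[lebesgue_measure]_(t in `]0, T[) (P t psi * theta t) =
  - \int[lebesgue_measure]_(t in `]0, T[) (ip (u t) psi * derive1n 1 theta t).

(* d_t u(tau) = g, through the representative of d_t u that is continuous with
   values in the dual of Sob (1/2). *)
Definition trace_dt u (tau : R) (g : H -> R) := exists P : R -> H -> R,
  [/\ continuous_dual 2^-1 P, is_dt u P &
      forall psi, Sob E 2^-1 psi -> P tau psi = g psi].

Definition Te (f : H) (g phi : H -> R) : H -> R :=
  fdual E (fun l => tanh (l * T) ^+ 2) phi +
  fdual E (fun l => sinh (l * T) / cosh (l * T) ^+ 2) (fext E id f) +
  fdual E (fun l => (cosh (l * T))^-1) g.

End elliptic.

(* Main.v *)
Require Import Defs.
From HB Require Import structures.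
From mathcomp Require Import all_boot all_order all_algebra.
From mathcomp Require Import all_classical all_reals all_analysis.
From mathcomp Require Import measurable_realfun ring lra.
From mathcomp Require Import generic_quotient ring_quotient.

Set Implicit Arguments.
Unset Strict Implicit.
Unset Printing Implicit Defensive.

Import Order.TTheory GRing.Theory Num.Theory.
Import numFieldNormedType.Exports.

Local Open Scope classical_set_scope.
Local Open Scope ring_scope.

(** Everything is diagonal in a basis of eigenvectors of [A]. If [psi] is an
    eigenvector for [lam], the coefficient [c] of the solution [u] along [psi]
    satisfies [c'' = lam^2 c], so that the trace [p = P T] of the time derivative
    [P] of [u] is
      [p psi = g psi * cosh (lam T) + lam * ip f psi * sinh (lam T)].
    By [1 - tanh^2 = cosh^-2] this says [Te p psi = p psi]: the trace [p] is a
    fixed point of the affine map [Te] on eigenvectors, hence by density on the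
    whole Sobolev space of order [1/2]. Therefore [phi_k - p] is
    [phi_0 - p] composed with the [k]-th power of [M = tanh(AT)^2]. Here
    [0 <= tanh^2 < 1], with a bound [q < 1] on bounded parts of the spectrum, and
    a continuous functional is small beyond a large spectral parameter, uniformly
    on the unit ball ([Sob_dual_tail]). So the powers tend to [0] in the dual norm
    ([cvg_dual_iter_spfun]).

    The existence of the trace at [T] is immediate: the continuous representative
    of [P] which gives the trace at [0] is defined on all of [[0, T]].

    The analysis behind this sketch is the following.

    Spectral calculus. All identities between spectral integrals come from one
    principle: a linear relation between the distribution functions
    [ip (E l x) x] passes to the integrals ([sp_energy_comb], [sp_int_comb]). It
    makes [sp_int] bilinear, symmetric, compatible with the resolution and
    explicit on eigenvectors. The vector [h(A) x] for bounded [h] exists by the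
    Riesz representation theorem, which needs the completeness of [L2]
    ([L2_hilbert], the Riesz-Fischer theorem). Since [h(A)] commutes with the
    resolution, it does not increase spectral measures by more than the square of
    the bound of [h], and so acts on the Sobolev spaces and their duals.

    Eigenvectors. Vectors in the range of [E b - E a] lie in the domain of [A],
    which acts on them as a bounded function. Positivity then forces
    [E l = 0] for [l < 0] ([res_negative]), and a point of the resolvent set has a
    neighbourhood on which the resolution is constant. As the spectrum consists of
    isolated points, the resolution is a step function whose jumps are
    eigenvectors: each [E b x] is a finite sum of eigenvectors
    ([res_eigenvectors]), and these sums tend to [x] in the Sobolev norm
    ([cvg_res_sob]).

    The scalar equation. It holds in the sense of distributions only, for [c] and
    [p] continuous. With [C] and [S] the functions [cosh (lam (T - t))] and
    [sinh (lam (T - t))], the function [p C + lam c S] has derivative zero, so by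
    the lemma of du Bois-Reymond its values at [0] and [T] agree
    ([scalar_elliptic_ode]). The test functions for that lemma are differences
    of smooth steps built from [exp (- 1 / t)]. *)

(** * Inner product spaces and the Riesz representation *)

(** The discriminant criterion behind all Cauchy-Schwarz inequalities below. It
    only asks for the bound on [2 * (a * b)], so it applies to forms that are
    controlled by a quadratic form without being positive themselves. *)
Lemma sqr_le_of_quadratic (R : realType) (p q b : R) : 0 <= p ->
  (forall a, 2 * (a * b) <= a ^+ 2 * p + q) -> b ^+ 2 <= p * q.
Proof.
move=> p0 h.
have [p00|pn0] := eqVneq p 0.
  have [->|b0] := eqVneq b 0; first by rewrite p00 expr0n mul0r.
  have := h ((q + 1) / b); have := h 0.
  rewrite p00 divfK// !mulr0 mul0r; lra.
have pp : 0 < p by rewrite lt0r pn0.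
have := h (b / p).
have -> : b / p * b = b ^+ 2 / p by field.
have -> : (b / p) ^+ 2 * p = b ^+ 2 / p by field.
by move=> hb; rewrite mulrC -ler_pdivrMr//; lra.
Qed.

Section inner_product.
Context (R : realType) (H : innerProductType R).
Implicit Types x y z : H.

Lemma ip0l x : ip 0 x = 0 :> R.
Proof. by rewrite -(scale0r x) ipZl mul0r. Qed.

Lemma ip0r x : ip x 0 = 0 :> R.
Proof. by rewrite ipC ip0l. Qed.

Lemma ipBl x y z : ip (x - y) z = ip x z - ip y z :> R.
Proof. by rewrite ipDl ipNl. Qed.

Lemma ipZr (a : R) x y : ip x (a *: y) = a * ip x y.
Proof. by rewrite ipC ipZl ipC. Qed.

Lemma ipNr x y : ip x (- y) = - ip x y :> R.
Proof. by rewrite ipC ipNl ipC. Qed.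

Lemma ipBr x y z : ip x (y - z) = ip x y - ip x z :> R.
Proof. by rewrite ipDr ipNr. Qed.

Lemma ip_inj x y : (forall z, ip x z = ip y z :> R) -> x = y.
Proof.
move=> xy; apply/eqP; rewrite -subr_eq0; apply/eqP/(@ip_eq0 R).
by rewrite ipBl xy subrr.
Qed.

Lemma ip_sqr_le x y : ip x y ^+ 2 <= ip x x * ip y y :> R.
Proof.
apply: sqr_le_of_quadratic => [|a]; first exact: ip_ge0.
have := ip_ge0 (a *: x - y).
rewrite ipBl !ipBr !ipZl !ipZr (ipC y x) => h.
by rewrite -subr_ge0; apply: le_trans h _; rewrite le_eqVlt; apply/orP; left; apply/eqP; ring.
Qed.

Lemma hnorm_ge0 x : 0 <= hnorm x.
Proof. exact: sqrtr_ge0. Qed.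

Lemma sqr_hnorm x : hnorm x ^+ 2 = ip x x.
Proof. by rewrite sqr_sqrtr// ip_ge0. Qed.

Lemma ip_le_hnorm x y : `|ip x y| <= hnorm x * hnorm y :> R.
Proof.
rewrite -(ler_pXn2r (ltn0Sn 1)) ?nnegrE ?mulr_ge0 ?hnorm_ge0//.
by rewrite real_normK ?num_real// exprMn !sqr_hnorm ip_sqr_le.
Qed.

Lemma hnorm_eq0 x : hnorm x = 0 -> x = 0.
Proof. by move=> x0; apply: (@ip_eq0 R); rewrite -sqr_hnorm x0 expr0n. Qed.

Lemma hnorm_opp x : hnorm (- x) = hnorm x.
Proof. by rewrite /hnorm ipNl ipNr opprK. Qed.

Lemma hnorm_triangle x y : hnorm (x + y) <= hnorm x + hnorm y.
Proof.
rewrite -(ler_pXn2r (ltn0Sn 1)) ?nnegrE ?addr_ge0 ?hnorm_ge0//.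
rewrite sqr_hnorm sqrrD ipDl !ipDr (ipC y x) !sqr_hnorm.
have := ip_le_hnorm x y; have := ler_norm (ip x y : R).
rewrite -mulr_natr; move: (ip x y : R) (ip x x : R) (ip y y : R) (hnorm x * hnorm y).
move=> a b c d; lra.
Qed.

Lemma hnormB_le x y z : hnorm (x - z) <= hnorm (x - y) + hnorm (z - y).
Proof.
rewrite -(hnorm_opp (z - y)); apply: le_trans (hnorm_triangle _ _).
by rewrite opprB addrA subrK.
Qed.

Lemma ip_parallelogram x y :
  ip (x - y) (x - y) = 2 * ip x x + 2 * ip y y - ip (x + y) (x + y) :> R.
Proof. by rewrite ipBl !ipBr ipDl !ipDr; ring. Qed.

(** Completeness, stated with sequences because [hnorm] does not come with a
    topology on [H]. *)
Definition hilbert := forall x_ : nat -> H,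
  (forall e : R, 0 < e -> exists N, forall m n, (N <= m)%N -> (N <= n)%N ->
     hnorm (x_ m - x_ n) <= e) ->
  exists x, forall e : R, 0 < e -> exists N, forall n, (N <= n)%N ->
     hnorm (x_ n - x) <= e.

End inner_product.

Section riesz.
Context (R : realType) (H : innerProductType R) (Hc : hilbert H).
Variables (F : H -> R) (M : R).
Hypotheses (Flin : forall a x y, F (a *: x + y) = a * F x + F y).
Hypotheses (Fbnd : forall x, `|F x| <= M * hnorm x).

Let FD x y : F (x + y) = F x + F y.
Proof. by rewrite -[x]scale1r Flin mul1r scale1r. Qed.

Let F0 : F 0 = 0.
Proof. by have := FD 0 0; rewrite addr0; lra. Qed.

Let FZ a x : F (a *: x) = a * F x.
Proof. by rewrite -[_ *: _]addr0 Flin F0 addr0. Qed.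

Let FB x y : F (x - y) = F x - F y.
Proof. by rewrite FD -scaleN1r FZ mulN1r. Qed.

(** The Dirichlet principle: the representing vector minimizes
    [ip x x - 2 F x], and minimizing sequences are Cauchy by the parallelogram
    identity. *)
Lemma riesz_representation : exists y, forall x, ip y x = F x.
Proof.
pose J x : R := ip x x - 2 * F x.
have J_ge x : - M ^+ 2 <= J x.
  have h := Fbnd x; have h2 := ler_norm (F x).
  rewrite /J -sqr_hnorm.
  have := sqr_ge0 (hnorm x - M).
  by move: (hnorm x) (F x) `|F x| h h2 => a b c; rewrite !expr2; nra.
pose S := [set J x | x in setT].
have S0 : S !=set0 by exists (J 0), 0.
have Slb : has_lbound S by exists (- M ^+ 2) => _ [x _ <-].
pose m := inf S.
have mJ x : m <= J x by apply: ge_inf => //; exists x.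
have /choice[x_ x_P] : forall n, exists x, J x < m + n.+1%:R^-1.
  move=> n; have [|_ [x _ <-]] := @inf_adherent _ S n.+1%:R^-1 _ (conj S0 Slb).
    by rewrite invr_gt0.
  by exists x.
have mid x y : ip (x - y) (x - y) <= 2 * (J x - m) + 2 * (J y - m).
  have := mJ (2^-1 *: (x + y)); rewrite /J ipZl ipZr FZ FD.
  rewrite ip_parallelogram.
  move: (ip (x + y) (x + y) : R) (ip x x : R) (ip y y : R) (F x) (F y).
  move=> a b c d e; lra.
have cau e : 0 < e -> exists N, forall k, (N <= k)%N -> J (x_ k) - m <= e.
  move=> e0.
  have [N _ HN] := near_infty_natSinv_lt (PosNum e0).
  exists N => k /HN /= hk; have := x_P k; move: (k.+1%:R^-1) hk => z hz hk.
  rewrite lerBlDr addrC; apply: ltW; apply: lt_trans hk _.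
  by rewrite ltrD2l.
have [|y yP] := Hc (x_ := x_).
  move=> e e0.
  have [N HN] : exists N, forall k, (N <= k)%N -> J (x_ k) - m <= e ^+ 2 / 4.
    by apply: cau; rewrite divr_gt0// exprn_gt0.
  exists N => k l /HN hk /HN hl.
  rewrite -(ler_pXn2r (ltn0Sn 1)) ?nnegrE ?hnorm_ge0 ?(ltW e0)// sqr_hnorm.
  by apply: le_trans (mid _ _) _; move: hk hl; lra.
have Jy : forall e, 0 < e -> J y - m <= e.
  move=> e e0.
  have [N1 h1] : exists N, forall k, (N <= k)%N -> J (x_ k) - m <= e / 2.
    by apply: cau; rewrite divr_gt0.
  (* For [x = y + z], the value [J y] exceeds [J x] by at most [C * hnorm z]. *)
  pose C := 1 + 2 * hnorm y + 2 * `|M|.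
  have C0 : 0 < C.
    by rewrite /C -addrA ltr_wpDr// addr_ge0 ?mulr_ge0 ?hnorm_ge0.
  pose d := e / 2 / C; have d0 : 0 < d by rewrite !divr_gt0.
  have [N2 h2] := yP _ d0.
  have {}h1 := h1 _ (leq_maxl N1 N2); have {}h2 := h2 _ (leq_maxr N1 N2).
  set x := x_ _ in h1 h2.
  have JJ : J y <= J x + d * C.
    have xE : x = y + (x - y) by rewrite addrC subrK.
    move: (x - y) h2 xE => z h2 xE.
    have := ler_norm (F z); have := Fbnd z.
    have := ler_norm (- ip y z : R); rewrite normrN; have := ip_le_hnorm y z.
    have k1 : hnorm y * hnorm z <= hnorm y * d by rewrite ler_wpM2l// hnorm_ge0.
    have k2 : M * hnorm z <= `|M| * d.
      apply: le_trans (ler_wpM2r (hnorm_ge0 z) (ler_norm M)) _.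
      by rewrite ler_wpM2l.
    have := ip_ge0 z.
    rewrite /J xE !ipDl !ipDr (ipC z y) FD /C.
    have -> : d * (1 + 2 * hnorm y + 2 * `|M|) =
      d + 2 * (hnorm y * d) + 2 * (`|M| * d) by ring.
    move: (hnorm y * d) (`|M| * d) (M * hnorm z) (hnorm y * hnorm z) k1 k2.
    move: (ip y z : R) (ip z z : R) (ip y y : R) (F y) (F z) => r1 r2 r3 r4 r5.
    move=> r6 r7 r8 r9; lra.
  have dC : d * C <= e / 2.
    by rewrite divfK// gt_eqF.
  by move: JJ h1 dC; lra.
have Jmin x : J y <= J x.
  apply/ler_addgt0Pl => e e0; have := Jy _ e0; have := mJ x; lra.
exists y => x.
suff : (ip y x - F x) ^+ 2 <= ip x x * 0.
  by rewrite mulr0 => h; apply/eqP; rewrite -subr_eq0 -sqrf_eq0 eq_le h sqr_ge0.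
apply: sqr_le_of_quadratic => [|a]; first exact: ip_ge0.
have := Jmin (y - a *: x).
rewrite /J FB FZ ipBl !ipBr !ipZl !ipZr (ipC x y).
move: (ip y x : R) (ip x x : R) (ip y y : R) (F x) (F y) => b c d e f; lra.
Qed.

End riesz.

(** * Completeness of L2 *)

Section L2_complete.
Context d (T : measurableType d) (R : realType) (mu : {measure set T -> \bar R}).
Local Notation L2m := (L2 mu).
Local Notation sqLfun := (LfunType mu (lee1n 2 : (1 <= 2%:R%:E :> \bar R)%E)).

Lemma Lfun2_of_sqr_integrable (f : T -> R) : measurable_fun setT f ->
  (\int[mu]_t (f t ^+ 2)%:E < +oo)%E -> f \in Lfun mu 2%:E.
Proof.
move=> mf fi; rewrite inE; apply/andP; split; first by rewrite inE.
rewrite inE/= /finite_norm unlock poweR_lty//.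
apply: le_lt_trans fi; rewrite le_eqVlt; apply/orP; left; apply/eqP.
apply: eq_integral => t _ /=.
by rewrite powR_mulrn ?normr_ge0// real_normK ?num_real.
Qed.

Lemma L2_piB (f g : sqLfun) :
  \pi_L2m%qT (f - g) = \pi_L2m%qT f - \pi_L2m%qT g.
Proof. by rewrite L2_piD -scaleN1r L2_pi_scale -(scaleN1r (\pi_L2m%qT g)). Qed.

Lemma integral_sqr_L2 (f : sqLfun) :
  (\int[mu]_t (f t ^+ 2)%:E = (ip (\pi_L2m%qT f) (\pi_L2m%qT f))%:E)%E.
Proof.
rewrite -[ip _ _]/(L2_ip _ _) L2_ip_pi /Rintegral fineK.
  by apply: eq_integral => t _; rewrite expr2.
by apply: integrable_fin_num => //; exact: sqLfun_integrableM.
Qed.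

(** The increments [D_k] of a rapidly Cauchy subsequence satisfy
    [sum_k 4^k D_k^2 < oo] almost everywhere since the integrals of the terms
    are summable; hence the subsequence converges almost everywhere, and Fatou's
    lemma turns the Cauchy estimates into convergence in the mean. *)
Lemma L2_hilbert : hilbert L2m.
Proof.
move=> x_ xC.
pose a (k : nat) : R := 2^-1 ^+ k.
have a0 k : 0 < a k by rewrite exprn_gt0.
have ale1 k : a k <= 1 by rewrite exprn_ile1 ?invr_ge0// invf_le1 ?ler1n.
have /choice[N NP] : forall k, exists Nk, forall m n, (Nk <= m)%N -> (Nk <= n)%N ->
    hnorm (x_ m - x_ n) <= a k ^+ 2.
  by move=> k; apply: xC; rewrite exprn_gt0.
pose nk := fix nk k := if k isn't j.+1 then N 0 else maxn (nk j) (N j.+1).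
have nkN k : (N k <= nk k)%N by case: k => //= k; exact: leq_maxr.
have nkS k j : (nk k <= nk (k + j)%N)%N.
  elim: j => [|j ih]; first by rewrite addn0.
  by rewrite addnS/=; apply: leq_trans ih _; exact: leq_maxl.
pose f k : sqLfun := repr (x_ (nk k)).
have pif k : \pi_L2m%qT (f k) = x_ (nk k) by exact: reprK.
have f_close k j : (\int[mu]_t ((f (k + j)%N t - f k t) ^+ 2)%:E <= (a k ^+ 4)%:E)%E.
  rewrite (integral_sqr_L2 (f (k + j)%N - f k)) L2_piB !pif lee_fin -sqr_hnorm.
  rewrite -[4%N]/(2 * 2)%N exprM ler_pXn2r ?nnegrE ?hnorm_ge0 ?sqr_ge0//.
  by apply: NP => //; exact: leq_trans (nkS _ _).
have mf k : measurable_fun setT (f k) by exact: measurable_funP.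
pose D k t := f k.+1 t - f k t.
have mD k : measurable_fun setT (D k) by exact: measurable_funB.
pose V k t : \bar R := (a k ^- 2 * D k t ^+ 2)%:E.
have V0 k t : (0 <= V k t)%E.
  by rewrite lee_fin mulr_ge0 ?sqr_ge0// invr_ge0 sqr_ge0.
have mV k : measurable_fun setT (V k).
  apply/measurable_EFinP; apply: measurable_funM => //.
  exact: measurable_funX.
have intV k : (\int[mu]_t V k t <= (a k ^+ 2)%:E)%E.
  rewrite /V; under eq_integral do rewrite EFinM.
  rewrite ge0_integralZl//; last 3 first.
    by apply/measurable_EFinP; exact: measurable_funX.
    by move=> t _; rewrite lee_fin sqr_ge0.
    by rewrite lee_fin invr_ge0 sqr_ge0.
  have := f_close k 1%N; rewrite addn1 => h.
  apply: le_trans (lee_wpmul2l _ h) _; first by rewrite lee_fin invr_ge0 sqr_ge0.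
  by rewrite -EFinM lee_fin (exprD _ 2 2) mulrA mulVf ?mul1r// sqrf_eq0 gt_eqF.
pose W t := (\sum_(k <oo) V k t)%E.
have W0 t : (0 <= W t)%E by apply: nneseries_ge0 => *; exact: V0.
have mW : measurable_fun setT W by apply: ge0_emeasurable_sum => //.
have intW : (\int[mu]_t W t < +oo)%E.
  rewrite /W integral_nneseries//.
  apply: (@le_lt_trans _ _ (\sum_(k <oo) (a k)%:E)%E).
    apply: lee_nneseries => [k _ _|k _].
      by apply: integral_ge0 => t _; exact: V0.
    apply: le_trans (intV k) _; rewrite lee_fin expr2 ler_piMr ?(ltW (a0 _))//.
  apply: (@le_lt_trans _ _ 2%:E); last exact: ltry.
  apply: lime_le; first by apply: is_cvg_nneseries => k _ _; rewrite lee_fin ltW.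
  near=> n; rewrite sumEFin lee_fin.
  suff -> : \sum_(0 <= k < n) a k = 2 - 2 * a n by have := a0 n; lra.
  elim: (n) => [|k ih]; first by rewrite big_geq// /a expr0; lra.
  by rewrite big_nat_recr//= ih /a exprSr; lra.
have /integrable_ae : mu.-integrable setT W.
  apply/integrableP; split => //.
  by under eq_integral do rewrite gee0_abs//.
move=> /(_ measurableT) [Z [mZ Z0 ZP]].
have f_cvg t : ~ Z t -> cvgn (fun k => f k t).
  move=> nZt.
  have : W t \is a fin_num.
    by apply: contrapT => h; apply: nZt; apply: ZP => /= h2; exact: h (h2 I).
  move=> /fineK Wf.
  have Wf0 : 0 <= fine (W t) by rewrite -lee_fin Wf.
  have DW k : `|D k t| <= Num.sqrt (fine (W t)) * a k.
    rewrite -(ler_pXn2r (ltn0Sn 1)) ?nnegrE ?mulr_ge0 ?sqrtr_ge0 ?(ltW (a0 _))//.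
    rewrite real_normK ?num_real// exprMn sqr_sqrtr//.
    rewrite -ler_pdivrMr ?exprn_gt0// mulrC -lee_fin Wf.
    have := @nneseries_lim_ge _ (V ^~ t) xpredT 0%N k.+1 (fun n _ _ => V0 n t).
    apply: le_trans; rewrite big_nat_recr//= [leLHS](_ : _ = V k t)//.
    by rewrite leeDr// sume_ge0// => i _; exact: V0.
  have -> : (fun k => f k t) = (fun k => f 0 t + series (D ^~ t) k).
    apply/funext => k; rewrite /series/= /D telescope_sumr//.
    by rewrite addrC subrK.
  apply: is_cvgD; first exact: is_cvg_cst.
  apply: normed_cvg.
  apply: (@series_le_cvg _ _ (fun k => Num.sqrt (fine (W t)) * a k)) => //.
  - by move=> k /=.
  - by move=> k; rewrite mulr_ge0 ?sqrtr_ge0 ?(ltW (a0 _)).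
  apply: is_cvg_geometric_series; rewrite ger0_norm//; lra.
pose F0 t := limn (fun k => f k t * \1_(~` Z) t).
have F_cvg t : f k t * \1_(~` Z) t @[k --> \oo] --> F0 t.
  rewrite /F0 indicE; have [Zt|nZt] := pselect (Z t).
    have -> : (t \in ~` Z) = false by apply: memNset => nZt; exact: nZt Zt.
    by under eq_fun do rewrite mulr0; exact: is_cvg_cst.
  rewrite mem_set//=; under eq_fun do rewrite mulr1.
  exact: f_cvg.
have F_cvg' t : ~ Z t -> f k t @[k --> \oo] --> F0 t.
  move=> nZ; have := F_cvg t; rewrite indicE mem_set//=.
  by under eq_fun do rewrite mulr1.
have mF : measurable_fun setT F0.
  apply: (@measurable_fun_cvg _ _ _ _ (fun k t => f k t * \1_(~` Z) t)).
    move=> k; apply: measurable_funM => //.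
    by apply/measurable_indicP; exact: measurableC.
  by move=> t _; exact: F_cvg.
have F_close k : (\int[mu]_t ((F0 t - f k t) ^+ 2)%:E <= (a k ^+ 4)%:E)%E.
  have mFf : measurable_fun setT (fun t => ((F0 t - f k t) ^+ 2)%:E).
    by apply/measurable_EFinP/measurable_funX/measurable_funB.
  rewrite (@ge0_negligible_integral _ _ _ _ _ Z)//; last first.
    by move=> t _; rewrite lee_fin sqr_ge0.
  rewrite setTD.
  have -> : (\int[mu]_(t in ~` Z) ((F0 t - f k t) ^+ 2)%:E =
    \int[mu]_(t in ~` Z) limn_einf (fun j => ((f (k + j)%N t - f k t) ^+ 2)%:E))%E.
    apply: eq_integral => t; rewrite inE => nZ.
    suff h : ((f (k + j)%N t - f k t) ^+ 2)%:E @[j --> \oo] -->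
      ((F0 t - f k t) ^+ 2)%:E by rewrite (cvg_limn_einf_sup h).1.
    apply/cvg_EFin; first by near=> j.
    apply: (@continuous_cvg _ _ _ _ _ _ (fun z : R => z ^+ 2)).
      exact: exprn_continuous.
    apply: cvgB; last exact: cvg_cst.
    have := F_cvg' t nZ.
    by rewrite -(cvg_shiftn k); under eq_fun do rewrite addnC.
  apply: le_trans (fatou _ _ _ _) _.
  - exact: measurableC.
  - move=> j; apply: (measurable_funS measurableT) => //.
    by apply/measurable_EFinP/measurable_funX/measurable_funB.
  - by move=> j t _; rewrite lee_fin sqr_ge0.
  rewrite limn_einf_lim; apply: lime_le; first exact: is_cvg_einfs.
  near=> j.
  apply: (@le_trans _ _ (\int[mu]_(t in ~` Z) ((f (k + j)%N t - f k t) ^+ 2)%:E)%E).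
    by apply: ereal_inf_lbound; exists j => /=.
  apply: le_trans (f_close k j); apply: ge0_subset_integral => //.
  - exact: measurableC.
  - by apply/measurable_EFinP/measurable_funX/measurable_funB.
  - by move=> t _; rewrite lee_fin sqr_ge0.
have Ffin : F0 \- f 0 \in Lfun mu 2%:E.
  apply: Lfun2_of_sqr_integrable; first exact: measurable_funB.
  by apply: le_lt_trans (F_close 0) _; exact: ltry.
pose G : sqLfun := Lfun_Sub (lee1n 2) Ffin + f 0.
have GE t : G t = F0 t.
  by rewrite -[G t]/((F0 t - f 0 t) + f 0 t) subrK.
exists (\pi_L2m%qT G) => e e0.
have [K KP] : exists K, a K + a K <= e.
  have h : a k @[k --> \oo] --> (0 : R).
    by apply: cvg_expr; rewrite ger0_norm//; lra.
  have e2 : 0 < e / 2 by rewrite divr_gt0.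
  have /cvgrPdist_le /(_ _ e2)[K _ /(_ K (leqnn _))] := h.
  by rewrite /= sub0r normrN ger0_norm ?(ltW (a0 _))// => ?; exists K; lra.
have a1 : a K ^+ 2 <= a K.
  by rewrite expr2 ler_piMr ?(ltW (a0 _)).
exists (N K) => n Nn.
apply: le_trans (hnormB_le _ (x_ (nk K)) _) _.
have h1 := NP K _ _ Nn (nkN K).
suff h2 : hnorm (\pi_L2m%qT G - x_ (nk K)) <= a K ^+ 2.
  by apply: le_trans KP; apply: lerD; [exact: le_trans h1 a1|exact: le_trans h2 a1].
rewrite -(ler_pXn2r (ltn0Sn 1)) ?nnegrE ?hnorm_ge0 ?sqr_ge0//.
rewrite sqr_hnorm -pif -L2_piB -lee_fin -integral_sqr_L2 -exprM.
apply: le_trans (F_close K); rewrite le_eqVlt; apply/orP; left; apply/eqP.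
by apply: eq_integral => t _; rewrite -[(G - f K) t]/(G t - f K t) GE.
Unshelve. all: by end_near.
Qed.

End L2_complete.

(** * Spectral measures *)

Section spectral_measures.
Context (R : realType) (H : innerProductType R) (E : resolution H).
Implicit Types (x y z : H) (l a b : R).

Lemma res0 l : E l 0 = 0.
Proof. by have := res_lin E l (-1) 0 0; rewrite scaler0 addr0 scaleN1r addNr. Qed.

Lemma resD l x y : E l (x + y) = E l x + E l y.
Proof. by have := res_lin E l 1 x y; rewrite !scale1r. Qed.

Lemma resZ l (c : R) x : E l (c *: x) = c *: E l x.
Proof. by have := res_lin E l c x 0; rewrite res0 !addr0. Qed.

Lemma resN l x : E l (- x) = - E l x.
Proof. by rewrite -scaleN1r resZ scaleN1r. Qed.

Lemma resB l x y : E l (x - y) = E l x - E l y.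
Proof. by rewrite resD resN. Qed.

Lemma sp_distrE x l : sp_distr E x l = hnorm (E l x) ^+ 2.
Proof. by rewrite sqr_hnorm -res_sym res_mul minxx. Qed.

Lemma cvgr_sqr_hnorm_lim (I : Type) (F : set_system I) (FF : ProperFilter F)
    (u : I -> H) x :
  hnorm (u i - x) @[i --> F] --> 0 -> ip (u i) x @[i --> F] --> ip x x.
Proof.
move=> ux; apply/cvgrPdist_le => e e0.
have C0 : 0 < hnorm x + 1 by rewrite ltr_wpDl// hnorm_ge0.
have /cvgrPdist_le /(_ _ (divr_gt0 e0 C0)) := ux.
apply: filterS => i; rewrite sub0r normrN ger0_norm ?hnorm_ge0// => h.
rewrite -ipBl; apply: le_trans (ip_le_hnorm _ _) _.
rewrite -(hnorm_opp (x - u i)) opprB.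
apply: (@le_trans _ _ (e / (hnorm x + 1) * (hnorm x + 1))); last by rewrite divfK// gt_eqF.
by apply: ler_pM; rewrite ?hnorm_ge0// lerDl.
Qed.

Lemma sp_distr_pinfty x : sp_distr E x l @[l --> +oo] --> ip x x.
Proof. by apply: cvgr_sqr_hnorm_lim; exact: res_pinfty. Qed.

Lemma sp_distr_ninfty x : sp_distr E x l @[l --> -oo] --> 0.
Proof.
have h := @res_ninfty _ _ E x.
have -> : sp_distr E x = (fun l => hnorm (E l x) * hnorm (E l x)).
  by apply/funext => l; rewrite sp_distrE expr2.
by rewrite -[X in _ --> X](mulr0 0); apply: cvgM; exact: h.
Qed.

Lemma sp_measure_oc x a b : a <= b ->
  sp_measure E x `]a, b]%classic = (sp_distr E x b - sp_distr E x a)%:E.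
Proof.
move=> ab; rewrite /sp_measure/= /lebesgue_stieltjes_measure /measure_extension.
by rewrite measurable_mu_extE/=; [rewrite wlength_itv_bnd|exact: is_ocitv].
Qed.

(** The total mass is the difference of the limits of the distribution function,
    which exist since [E l] tends to [0] and to the identity. *)
Lemma sp_measure_setT x : sp_measure E x setT = (ip x x)%:E.
Proof.
rewrite -(bigcup_itvT false false).
pose I n : set R := `]- (n%:R), n%:R]%classic.
have : (sp_measure E x \o I) n @[n --> \oo] --> (ip x x)%:E.
  have -> : sp_measure E x \o I =
      (fun n => (sp_distr E x n%:R - sp_distr E x (- n%:R))%:E).
    by apply/funext => n; rewrite /= sp_measure_oc// ge0_cp.
  apply/cvg_EFin; first by near=> n.
  rewrite -[X in _ --> X]subr0; apply: cvgB.
    apply: (@cvg_comp _ _ _ (fun k : nat => k%:R : R) (sp_distr E x) _ _ _ (@cvgr_idn R)).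
    exact: sp_distr_pinfty.
  apply: (cvg_ninftyP _ _).1 => //; first exact: sp_distr_ninfty.
  by apply: (cvg_comp _ _ (@cvgr_idn R)); rewrite ninfty.
have : (sp_measure E x \o I) n @[n --> \oo] --> sp_measure E x (\bigcup_n I n).
  apply: nondecreasing_cvg_mu; rewrite /I//; first exact: bigcup_measurable.
  by move=> *; apply/subsetPset/subset_itv; rewrite leBSide/= ?lerN2 ler_nat.
exact: cvg_unique.
Unshelve. all: end_near. Qed.

Lemma ocitv_measure_unique (m1 m2 : {measure set (measurableTypeR R) -> \bar R}) :
  (forall a b, a <= b -> m1 `]a, b]%classic = m2 `]a, b]%classic) ->
  (forall a b, m1 `]a, b]%classic < +oo)%E ->
  forall A, measurable A -> m1 A = m2 A.
Proof.
move=> m12 m1oo A mA.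
apply: (@measure_unique _ R (measurableTypeR R) (@ocitv R) (fun n : nat => `](- n%:R), n%:R]%classic) erefl _ _ _ m1 m2 _ _ A mA).
- exact: ocitvI.
- by move=> n; exact: is_ocitv.
- exact: bigcup_itvT.
- move=> _ [[a b] _ <-] /=; have [ab|ba] := leP a b; first exact: m12.
  by rewrite set_itv_ge ?measure0// bnd_simp -leNgt ltW.
- by move=> k; exact: m1oo.
Qed.

Lemma nneg_max_subproof (c : R) : 0 <= Num.max c 0.
Proof. by rewrite le_max lexx orbT. Qed.

Definition pos_nneg (c : R) : {nonneg R} := NngNum (nneg_max_subproof c).

Lemma pos_nnegB (c : R) : (pos_nneg c)%:num - (pos_nneg (- c))%:num = c.
Proof.
rewrite /=; have [c0|c0] := leP c 0.
  by rewrite sub0r maxEle; case: ifPn; [|rewrite opprK]; lra.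
by rewrite maxEle; case: ifPn; lra.
Qed.

(** A linear relation between the distribution functions holds between the
    measures: separating the signs of the coefficients, the two sides are
    positive measures that agree on half-open intervals. *)
Lemma sp_integral_comb_ge0 (n : nat) (c : nat -> R) (x_ : nat -> H)
    (h : measurableTypeR R -> \bar R) :
  (forall l, \sum_(i < n) c i * sp_distr E (x_ i) l = 0) ->
  measurable_fun setT h -> (forall l, 0 <= h l)%E ->
  (forall i, (\int[sp_measure E (x_ i)]_l h l < +oo)%E) ->
  \sum_(i < n) c i * fine (\int[sp_measure E (x_ i)]_l h l) = 0.
Proof.
move=> c0 mh h0 hoo.
pose m (e : nat -> R) : {measure set (measurableTypeR R) -> \bar R} :=
  msum (fun i => mscale (pos_nneg (e i)) (sp_measure E (x_ i))) n.
have mE e a b : a <= b -> m e `]a, b]%classic =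
    (\sum_(i < n) (pos_nneg (e i))%:num *
      (sp_distr E (x_ i) b - sp_distr E (x_ i) a))%:E.
  move=> ab; rewrite -sumEFin [LHS](_ : _ = \sum_(i < n)
    (pos_nneg (e i))%:num%:E * sp_measure E (x_ i) `]a, b]%classic)%E//.
  by apply: eq_bigr => i _; rewrite sp_measure_oc.
have mI e : (\int[m e]_l h l = (\sum_(i < n) (pos_nneg (e i))%:num *
      fine (\int[sp_measure E (x_ i)]_l h l))%:E)%E.
  rewrite ge0_integral_measure_sum// -sumEFin; apply: eq_bigr => i _.
  rewrite ge0_integral_mscale// EFinM fineK// ge0_fin_numE//.
  by apply: integral_ge0 => l _; exact: h0.
have mm A : measurable A -> m c A = m (fun i => - c i) A.
  apply: ocitv_measure_unique => [a b ab|a b].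
    rewrite !mE//; congr EFin; apply/eqP; rewrite -subr_eq0 -sumrB; apply/eqP.
    under eq_bigr do rewrite -mulrBl pos_nnegB mulrBr.
    by rewrite sumrB !c0 subrr.
  have [ab|ba] := leP a b; first by rewrite mE// ltry.
  by rewrite set_itv_ge ?measure0// bnd_simp -leNgt ltW.
have : (\int[m c]_l h l = \int[m (fun i => (- c i)%R)]_l h l)%E.
  by apply: eq_measure_integral => A mA _; exact: mm.
rewrite !mI => -[] /eqP; rewrite -subr_eq0 -sumrB.
by under eq_bigr do rewrite -mulrBl pos_nnegB; move/eqP.
Qed.

Definition sp_integrable (h : measurableTypeR R -> R) x :=
  (sp_measure E x).-integrable setT (EFin \o h).

(** The signed version, for functions integrable with respect to every measure
    in the relation. All the algebra of spectral integrals used below is an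
    instance of it. *)
Lemma sp_integral_comb (s : seq (R * H)) (h : measurableTypeR R -> R) :
  (forall l, \sum_(p <- s) p.1 * sp_distr E p.2 l = 0) ->
  {in [seq p.2 | p <- s], forall x, sp_integrable h x} ->
  \sum_(p <- s) p.1 * \int[sp_measure E p.2]_l h l = 0.
Proof.
have [->|s0] := eqVneq s [::]; first by rewrite !big_nil.
have [p0 p0s] : exists p, p \in s by case: s s0 => // p s _; exists p; rewrite mem_head.
move=> c0 hi.
have si i : (nth p0 s i).2 \in [seq p.2 | p <- s].
  apply: map_f; have [/mem_nth->//|hs] := ltnP i (size s).
  by rewrite nth_default.
rewrite (big_nth p0) big_mkord.
have {}c0 l : \sum_(i < size s) (nth p0 s i).1 * sp_distr E (nth p0 s i).2 l = 0.
  by rewrite -[RHS](c0 l) (big_nth p0) big_mkord.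
have mh : measurable_fun setT h.
  have /integrableP[mh _] := hi _ (si 0%N).
  exact/measurable_EFinP.
have hfin (i : nat) (g : measurableTypeR R -> \bar R) :
    (forall l, 0 <= g l <= `|h l|%:E)%E -> measurable_fun setT g ->
  (\int[sp_measure E (nth p0 s i).2]_l g l < +oo)%E.
  move=> gh mg; have /integrableP[_] := hi _ (si i).
  apply: le_lt_trans; apply: ge0_le_integral => //.
  - by move=> l _; case/andP: (gh l).
  - by do 2 apply: measurableT_comp => //.
  - by move=> l _; case/andP: (gh l).
have mhE : measurable_fun setT (EFin \o h) by exact/measurable_EFinP.
have hp := @sp_integral_comb_ge0 (size s) (fun i => (nth p0 s i).1)
  (fun i => (nth p0 s i).2) (EFin \o h)^\+%E c0 (measurable_funepos mhE).
have hn := @sp_integral_comb_ge0 (size s) (fun i => (nth p0 s i).1)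
  (fun i => (nth p0 s i).2) (EFin \o h)^\-%E c0 (measurable_funeneg mhE).
have hp1 l : (0 <= (EFin \o h)^\+ l <= `|h l|%:E)%E.
  rewrite funepos_ge0/= funeposE/= ge_max lee_fin ler_norm/= lee_fin//.
have hn1 l : (0 <= (EFin \o h)^\- l <= `|h l|%:E)%E.
  by rewrite funeneg_ge0/= funenegE/= ge_max lee_fin -normrN ler_norm/= lee_fin.
rewrite -[RHS](subrr 0).
rewrite -[X in _ = X - _]hp; last 2 first.
  by move=> l; case/andP: (hp1 l).
  by move=> i; apply: hfin => //; exact: measurable_funepos.
rewrite -[X in _ = _ - X]hn; last 2 first.
  by move=> l; case/andP: (hn1 l).
  by move=> i; apply: hfin => //; exact: measurable_funeneg.
rewrite -sumrB; apply: eq_bigr => i _; rewrite -mulrBr; congr (_ * _).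
rewrite /Rintegral integralE fineB//.
- rewrite ge0_fin_numE; last by apply: integral_ge0.
  by apply: hfin => //; exact: measurable_funepos.
- rewrite ge0_fin_numE; last by apply: integral_ge0.
  by apply: hfin => //; exact: measurable_funeneg.
Qed.

End spectral_measures.

Section spectral_domination.
Context (R : realType) (H : innerProductType R) (E : resolution H).
Variables (C : {nonneg R}) (y x1 x2 : H).
Hypothesis incr_le : forall a b : R, a <= b ->
  sp_distr E y b - sp_distr E y a <=
  C%:num * ((sp_distr E x1 b - sp_distr E x1 a) + (sp_distr E x2 b - sp_distr E x2 a)).

Let gap l := C%:num * (sp_distr E x1 l + sp_distr E x2 l) - sp_distr E y l.

Let gap_nd : nondecreasing gap.
Proof. by move=> a b ab; rewrite /gap; have := incr_le ab; lra. Qed.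

Let gap_rc : right_continuous gap.
Proof.
move=> a; apply: cvgB; last exact: sp_distr_rc.
by apply: cvgM; [exact: cvg_cst|apply: cvgD; exact: sp_distr_rc].
Qed.

HB.instance Definition _ := isCumulative.Build R _ R gap gap_nd gap_rc.

Let lsm_oc (F : cumulative R R) a b : a <= b ->
  lebesgue_stieltjes_measure F `]a, b]%classic = (F b - F a)%:E.
Proof.
move=> ab; rewrite /lebesgue_stieltjes_measure /measure_extension.
by rewrite measurable_mu_extE/=; [rewrite wlength_itv_bnd|exact: is_ocitv].
Qed.

(** The gap between two distribution functions is again a distribution
    function, so the larger measure is the smaller one plus a positive
    measure. *)
Lemma sp_integral_le (h : measurableTypeR R -> \bar R) :
  measurable_fun setT h -> (forall l, 0 <= h l)%E ->
  (\int[sp_measure E y]_l h l <=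
   C%:num%:E * (\int[sp_measure E x1]_l h l + \int[sp_measure E x2]_l h l))%E.
Proof.
move=> mh h0.
pose g : {measure set (measurableTypeR R) -> \bar R} := lebesgue_stieltjes_measure gap.
pose m1 : {measure set (measurableTypeR R) -> \bar R} := measure_add (sp_measure E y) g.
pose m2 : {measure set (measurableTypeR R) -> \bar R} :=
  mscale C (measure_add (sp_measure E x1) (sp_measure E x2)).
have m1E A : (m1 A = sp_measure E y A + lebesgue_stieltjes_measure gap A)%E.
  exact: measure_addE.
have m12 A : measurable A -> m1 A = m2 A.
  apply: ocitv_measure_unique => [a b ab|a b].
    rewrite m1E [RHS](_ : _ = C%:num%:E *
      measure_add (sp_measure E x1) (sp_measure E x2) `]a, b]%classic)%E//.
    rewrite (measure_addE (sp_measure E x1)) (sp_measure_oc E y ab).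
    rewrite (sp_measure_oc E x1 ab) (sp_measure_oc E x2 ab) (lsm_oc gap ab).
    rewrite -!EFinD -EFinM.
    congr EFin; rewrite [LHS](_ : _ = sp_distr E y b - sp_distr E y a +
      ((C%:num * (sp_distr E x1 b + sp_distr E x2 b) - sp_distr E y b) -
       (C%:num * (sp_distr E x1 a + sp_distr E x2 a) - sp_distr E y a)))//.
    by ring.
  rewrite m1E; have [ab|ba] := leP a b.
    by rewrite (lsm_oc gap ab) (sp_measure_oc E y ab) -EFinD ltry.
  by rewrite set_itv_ge ?measure0 ?adde0 ?ltry// bnd_simp -leNgt ltW.
have : (\int[m1]_l h l = \int[m2]_l h l)%E.
  by apply: eq_measure_integral => A mA _; exact: m12.
rewrite ge0_integral_measure_add// ge0_integral_mscale//.
rewrite ge0_integral_measure_add// => <-.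
by rewrite leeDl// integral_ge0.
Qed.

End spectral_domination.

Section spectral_forms.
Context (R : realType) (H : innerProductType R) (E : resolution H).
Implicit Types (x y z : H) (l a b : R) (h g : measurableTypeR R -> R).
Local Notation incr x a b := (sp_distr E x b - sp_distr E x a).

Lemma sp_incrE x a b : a <= b -> incr x a b = ip (E b x - E a x) (E b x - E a x).
Proof. by move=> ab; rewrite sp_distrB// sqr_hnorm. Qed.

Lemma sp_integrable_incr_le (C : R) h y x1 x2 : 0 <= C ->
  (forall a b, a <= b -> incr y a b <= C * (incr x1 a b + incr x2 a b)) ->
  sp_integrable E h x1 -> sp_integrable E h x2 -> sp_integrable E h y.
Proof.
move=> C0 yx /integrableP[mh h1] /integrableP[_ h2].
apply/integrableP; split; first exact: mh.
apply: le_lt_trans (@sp_integral_le _ _ E (NngNum C0) y x1 x2 yx _ _ _) _ => //.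
  exact: measurableT_comp.
by apply: lte_mul_pinfty; [rewrite lee_fin| |exact: (lte_add_pinfty h1 h2)].
Qed.

Lemma sp_integrable0 h : measurable_fun setT h -> sp_integrable E h 0.
Proof.
move=> mh; apply/integrableP; split; first exact/measurable_EFinP.
have z0 : sp_measure E 0 setT = 0%E by rewrite sp_measure_setT ip0l.
rewrite (_ : (\int[_]_l _ = 0)%E) ?ltry//.
apply: null_set_integral => //.
  by apply: measurableT_comp => //; exact/measurable_EFinP.
Qed.

Lemma sp_integrable_measurable h x : sp_integrable E h x -> measurable_fun setT h.
Proof. by move=> /integrableP[mh _]; exact/measurable_EFinP. Qed.

Lemma sp_integrableD h x y : sp_integrable E h x -> sp_integrable E h y ->
  sp_integrable E h (x + y).
Proof.
apply: (@sp_integrable_incr_le 2) => // a b ab.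
rewrite !sp_incrE// !resD opprD addrACA.
set u := E b x - _; set v := E b y - _.
by have := ip_ge0 (u - v); rewrite ip_parallelogram; lra.
Qed.

Lemma sp_integrable_le (C : R) h y x : 0 <= C ->
  (forall a b, a <= b -> incr y a b <= C * incr x a b) ->
  sp_integrable E h x -> sp_integrable E h y.
Proof.
move=> C0 yx hx; have z l : sp_distr E 0 l = 0 by rewrite /sp_distr res0 ip0l.
apply: (sp_integrable_incr_le C0 _ hx (x2 := 0)).
  by move=> a b ab; apply: le_trans (yx a b ab) _; rewrite !z subr0 addr0.
exact: sp_integrable0 (sp_integrable_measurable hx).
Qed.

Lemma sp_integrableZ h (c : R) x : sp_integrable E h x -> sp_integrable E h (c *: x).
Proof.
apply: (@sp_integrable_le (c ^+ 2)); first exact: sqr_ge0.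
by move=> a b ab; rewrite /sp_distr !resZ !ipZl !ipZr; lra.
Qed.

Lemma sp_integrableB h x y : sp_integrable E h x -> sp_integrable E h y ->
  sp_integrable E h (x - y).
Proof.
by move=> hx hy; rewrite -scaleN1r; apply: sp_integrableD => //; exact: sp_integrableZ.
Qed.

Lemma sp_integrable_res h l x : sp_integrable E h x -> sp_integrable E h (E l x).
Proof.
apply: (@sp_integrable_le 1) => // a b ab; rewrite mul1r.
have Emono c d z : c <= d -> sp_distr E z c <= sp_distr E z d by exact: sp_distr_nd.
have key c : sp_distr E (E l x) c = sp_distr E x (Num.min c l).
  by rewrite /sp_distr -res_sym !res_mul minAC minxx minC.
rewrite !key; have [la|al] := leP a l; last first.
  by rewrite (min_r (ltW (lt_le_trans al ab))) subrr subr_ge0 Emono.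
have [lb|bl] := leP b l; first by [].
by rewrite lerB// Emono// ltW.
Qed.

Lemma sp_integrable_dominated h g x : measurable_fun setT h ->
  (forall l, `|h l| <= g l) -> sp_integrable E g x -> sp_integrable E h x.
Proof.
move=> mh hg gx; apply: le_integrable gx => //; first exact/measurable_EFinP.
by move=> l _ /=; rewrite lee_fin; apply: le_trans (hg l) (ler_norm _).
Qed.

Lemma sp_integrable_cst (c : R) x : sp_integrable E (cst c) x.
Proof.
apply/integrableP; split; first exact/measurable_EFinP.
under eq_integral do rewrite /=.
rewrite integral_cst//= -[lebesgue_stieltjes_measure _ _]/(sp_measure E x setT).
by rewrite sp_measure_setT -EFinM ltry.
Qed.

Lemma sp_integrable_bounded h (M : R) x : measurable_fun setT h ->
  (forall l, `|h l| <= M) -> sp_integrable E h x.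
Proof.
by move=> mh hM; exact: sp_integrable_dominated mh hM (sp_integrable_cst M x).
Qed.

Lemma sp_polarization x y l :
  4 * ip (E l x) y = sp_distr E (x + y) l - sp_distr E (x - y) l.
Proof.
rewrite /sp_distr resD resB ipBl !ipBr ipDl !ipDr (res_sym E l y x) (ipC y).
by ring.
Qed.

(** Polarization turns a relation between the entries of the resolution into one
    between distribution functions. Bilinearity, symmetry and the other rules for
    [sp_int] are read off from relations that hold for each [l]. *)
Lemma sp_int_comb (s : seq (R * (H * H))) h :
  (forall l, \sum_(p <- s) p.1 * ip (E l p.2.1) p.2.2 = 0) ->
  {in s, forall p, sp_integrable E h p.2.1 /\ sp_integrable E h p.2.2} ->
  \sum_(p <- s) p.1 * sp_int E h p.2.1 p.2.2 = 0.
Proof.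
move=> s0 hs.
pose t := [seq (p.1, p.2.1 + p.2.2) | p <- s] ++ [seq (- p.1, p.2.1 - p.2.2) | p <- s].
have := @sp_integral_comb _ _ E t h.
rewrite /t big_cat/= !big_map/= => /(_ _ _)/wrap[].
- move=> l; rewrite big_cat/= !big_map/= -big_split/=.
  have /(congr1 ( *%R 4)) := s0 l; rewrite mulr0 mulr_sumr; apply: etrans.
  apply: eq_bigr => p _.
  by rewrite mulrCA sp_polarization; ring.
- move=> x; rewrite map_cat mem_cat -!map_comp => /orP[] /mapP[p /hs[h1 h2] ->] /=.
    exact: sp_integrableD.
  exact: sp_integrableB.
rewrite -big_split/= => ts.
have /(congr1 ( *%R 4^-1)) := ts; rewrite mulr0 mulr_sumr; apply: etrans.
apply: eq_bigr => p _.
by rewrite /sp_int mulNr -mulrBr [RHS]mulrCA; congr (_ * _); exact: mulrC.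
Qed.

End spectral_forms.

(** * The forms [sp_int] *)

(** The integral [int h d<E_l x, x>], locked so that conversion does not compare
    the measures of different vectors. *)
HB.lock Definition sp_energy (R : realType) (H : innerProductType R)
    (E : resolution H) (h : measurableTypeR R -> R) (x : H) : R :=
  \int[sp_measure E x]_l h l.

Lemma measure_setC_eq0 d (T : measurableType d) (R : realType)
    (mu : {measure set T -> \bar R}) (A : set T) :
  measurable A -> (mu setT < +oo)%E -> mu A = mu setT -> mu (~` A) = 0%E.
Proof.
move=> mA Too AT; rewrite [LHS](_ : _ = mu setT - mu A)%E.
  by rewrite AT subee// ge0_fin_numE.
by rewrite -setTD measureD ?setTI//.
Qed.

Section spectral_form_identities.
Context (R : realType) (H : innerProductType R) (E : resolution H).
Implicit Types (x y z : H) (l a b : R) (h g : measurableTypeR R -> R).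

Lemma eq_sp_int h x y x' y' :
  (forall l, ip (E l x) y = ip (E l x') y') ->
  sp_integrable E h x -> sp_integrable E h y ->
  sp_integrable E h x' -> sp_integrable E h y' ->
  sp_int E h x y = sp_int E h x' y'.
Proof.
move=> xy hx hy hx' hy'.
have := @sp_int_comb _ _ E [:: (1, (x, y)); (-1, (x', y'))] h.
rewrite !big_cons !big_nil/= => /(_ _ _)/wrap[].
- by move=> l; rewrite !big_cons big_nil/= xy; ring.
- by move=> p; rewrite !inE => /orP[] /eqP ->.
by rewrite mul1r mulN1r addr0 => /eqP; rewrite subr_eq0 => /eqP.
Qed.

Lemma sp_intC h x y : sp_integrable E h x -> sp_integrable E h y ->
  sp_int E h x y = sp_int E h y x.
Proof. by move=> hx hy; apply: eq_sp_int => // l; rewrite res_sym ipC. Qed.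

Lemma sp_int_linr h x (c : R) y z : sp_integrable E h x -> sp_integrable E h y ->
  sp_integrable E h z ->
  sp_int E h x (c *: y + z) = c * sp_int E h x y + sp_int E h x z.
Proof.
move=> hx hy hz.
have := @sp_int_comb _ _ E [:: (1, (x, c *: y + z)); (- c, (x, y)); (-1, (x, z))] h.
rewrite !big_cons !big_nil/= => /(_ _ _)/wrap[].
- by move=> l; rewrite !big_cons big_nil/= ipDr ipZr; ring.
- move=> p; rewrite !inE => /or3P[] /eqP -> //=; split => //.
  by apply: sp_integrableD => //; exact: sp_integrableZ.
move: (sp_int E h x (c *: y + z)) (sp_int E h x y) (sp_int E h x z) => u v w.
by lra.
Qed.

Lemma sp_int0r h x : sp_int E h x 0 = 0.
Proof. by rewrite /sp_int addr0 subr0 subrr mul0r. Qed.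

Lemma sp_energyE h x : sp_energy E h x = \int[sp_measure E x]_l h l.
Proof. by rewrite unlock. Qed.

Lemma sp_intE h x y :
  sp_int E h x y = (sp_energy E h (x + y) - sp_energy E h (x - y)) / 4.
Proof. by rewrite !sp_energyE. Qed.

Lemma sp_energy_comb (s : seq (R * H)) h :
  (forall l, \sum_(p <- s) p.1 * sp_distr E p.2 l = 0) ->
  {in [seq p.2 | p <- s], forall x, sp_integrable E h x} ->
  \sum_(p <- s) p.1 * sp_energy E h p.2 = 0.
Proof.
move=> s0 hs; rewrite -[RHS](sp_integral_comb s0 hs).
by apply: eq_bigr => p _; rewrite sp_energyE.
Qed.

Lemma sp_int_diag h x : sp_integrable E h x -> sp_int E h x x = sp_energy E h x.
Proof.
move=> hx; rewrite sp_intE.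
have := @sp_energy_comb [:: (1, x + x); (-1, x - x); (-4, x)] h.
rewrite !big_cons !big_nil/= => /(_ _ _)/wrap[].
- move=> l; rewrite !big_cons big_nil/= /sp_distr resD resB ipBl ipBr ipDl !ipDr.
  by ring.
- move=> y; rewrite !inE => /or3P[] /eqP -> //=.
    exact: sp_integrableD.
  exact: sp_integrableB.
by lra.
Qed.

Lemma sp_energyZ h (c : R) x : sp_integrable E h x ->
  sp_energy E h (c *: x) = c ^+ 2 * sp_energy E h x.
Proof.
move=> hx.
have := @sp_energy_comb [:: (1, c *: x); (- (c ^+ 2), x)] h.
rewrite !big_cons !big_nil/= => /(_ _ _)/wrap[].
- by move=> l; rewrite !big_cons big_nil/= /sp_distr resZ ipZl ipZr; ring.
- by move=> y; rewrite !inE => /orP[] /eqP -> //=; exact: sp_integrableZ.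
by lra.
Qed.

Lemma sp_energy_parallelogram h x y : sp_integrable E h x -> sp_integrable E h y ->
  sp_energy E h (x + y) + sp_energy E h (x - y) =
  2 * sp_energy E h x + 2 * sp_energy E h y.
Proof.
move=> hx hy.
have := @sp_energy_comb [:: (1, x + y); (1, x - y); (-2, x); (-2, y)] h.
rewrite !big_cons !big_nil/= => /(_ _ _)/wrap[].
- move=> l; rewrite !big_cons big_nil/= /sp_distr resD resB ipBl !ipBr ipDl !ipDr.
  by ring.
- move=> z; rewrite !inE => /or4P[] /eqP -> //=.
    exact: sp_integrableD.
  exact: sp_integrableB.
by lra.
Qed.

Lemma sp_energy_ge0 h x : (forall l, 0 <= h l) -> 0 <= sp_energy E h x.
Proof.
by move=> h0; rewrite sp_energyE; apply: Rintegral_ge0 => l _; exact: h0.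
Qed.

Lemma sp_energy_normr h g x : measurable_fun setT h -> (forall l, `|h l| <= g l) ->
  sp_integrable E g x -> `|sp_energy E h x| <= sp_energy E g x.
Proof.
move=> mh hg gx; have hx := sp_integrable_dominated mh hg gx.
rewrite !sp_energyE; apply: le_trans (le_normr_Rintegral _ hx) _ => //.
apply: le_Rintegral => //.
apply: sp_integrable_dominated gx; first exact: measurableT_comp.
by move=> l; rewrite normr_id.
Qed.

(** Cauchy-Schwarz: by polarization and the parallelogram identity, [sp_int h] is
    dominated by the quadratic form of any [g] above [`|h|]. *)
Lemma sp_int_sqr_le h g x y : measurable_fun setT h -> (forall l, `|h l| <= g l) ->
  sp_integrable E g x -> sp_integrable E g y ->
  sp_int E h x y ^+ 2 <= sp_energy E g x * sp_energy E g y.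
Proof.
move=> mh hg gx gy.
have g0 l : 0 <= g l by apply: le_trans (hg l).
have hi z : sp_integrable E g z -> sp_integrable E h z by exact: sp_integrable_dominated.
apply: sqr_le_of_quadratic => [|c]; first exact: sp_energy_ge0.
have gcx := sp_integrableZ c gx.
have -> : c * sp_int E h x y = sp_int E h (c *: x) y.
  rewrite (sp_intC (hi _ gcx) (hi _ gy)) -[c *: x]addr0 sp_int_linr; try exact: hi.
    by rewrite (sp_intC (hi _ gx) (hi _ gy)) sp_int0r addr0.
  by apply: hi; apply: sp_integrable0; exact: sp_integrable_measurable gx.
rewrite -sp_energyZ// sp_intE.
have := sp_energy_parallelogram gcx gy.
have := sp_energy_normr mh hg (sp_integrableD gcx gy).
have := sp_energy_normr mh hg (sp_integrableB gcx gy).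
by rewrite !ler_norml => /andP[? ?] /andP[? ?]; lra.
Qed.

(** The range of the spectral projection [E b - E a]. *)
Definition bandlimited a b y := E a y = 0 /\ E b y = y.

Lemma bandlimited_resB a b x : a <= b -> bandlimited a b (E b x - E a x).
Proof.
move=> ab; split; rewrite resB !res_mul ?minxx.
  by rewrite (min_l ab) subrr.
by rewrite (min_r ab).
Qed.

Lemma bandlimitedD a b x y : bandlimited a b x -> bandlimited a b y ->
  bandlimited a b (x + y).
Proof. by move=> [x1 x2] [y1 y2]; split; rewrite resD ?x1 ?y1 ?addr0// x2 y2. Qed.

Lemma bandlimitedN a b x : bandlimited a b x -> bandlimited a b (- x).
Proof. by move=> [x1 x2]; split; rewrite resN ?x1 ?oppr0// x2. Qed.

Lemma bandlimited_negligible a b y : a <= b -> bandlimited a b y ->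
  sp_measure E y (~` `]a, b]%classic) = 0%E.
Proof.
move=> ab [ya yb]; apply: measure_setC_eq0.
- by apply: sub_sigma_algebra; exact: is_ocitv.
- by rewrite sp_measure_setT ltry.
- by rewrite sp_measure_setT sp_measure_oc// /sp_distr ya yb ip0l subr0.
Qed.

Lemma eq_sp_integral_band a b h g y : a <= b -> bandlimited a b y ->
  measurable_fun setT h -> measurable_fun setT g ->
  (forall l, a < l <= b -> h l = g l) ->
  (\int[sp_measure E y]_l (h l)%:E = \int[sp_measure E y]_l (g l)%:E)%E.
Proof.
move=> ab yab mh mg hg.
apply: ae_eq_integral => //; try exact/measurable_EFinP.
exists (~` `]a, b]%classic); split.
- by apply: measurableC; apply: sub_sigma_algebra; exact: is_ocitv.
- exact: bandlimited_negligible yab.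
- apply: subsetC => l; rewrite /= in_itv/= => /hg -> //.
Qed.

Lemma sp_integrable_band a b h g y : a <= b -> bandlimited a b y ->
  measurable_fun setT h -> (forall l, a < l <= b -> h l = g l) ->
  sp_integrable E g y -> sp_integrable E h y.
Proof.
move=> ab yab mh hg gy; have mg := sp_integrable_measurable gy.
case/integrableP: gy => _ gy; apply/integrableP; split; first exact/measurable_EFinP.
apply: le_lt_trans gy; rewrite le_eqVlt; apply/orP; left; apply/eqP.
apply: (@eq_sp_integral_band a b (fun l => `|h l|) (fun l => `|g l|)) => //.
- exact: measurableT_comp.
- exact: measurableT_comp.
- by move=> l /hg ->.
Qed.

Lemma eq_sp_energy_band a b h g y : a <= b -> bandlimited a b y ->
  measurable_fun setT h -> measurable_fun setT g ->
  (forall l, a < l <= b -> h l = g l) -> sp_energy E h y = sp_energy E g y.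
Proof.
move=> ab yab mh mg hg; rewrite !sp_energyE.
by congr fine; exact: (eq_sp_integral_band ab yab).
Qed.

(** If one argument of [sp_int] is bandlimited, then only the projection of the
    other one to the band matters. *)
Lemma eq_sp_int_band a b h g x y : a <= b -> bandlimited a b y ->
  (forall l, a < l <= b -> h l = g l) ->
  sp_integrable E h x -> sp_integrable E g x -> sp_integrable E h y ->
  sp_int E h x y = sp_int E g x y.
Proof.
move=> ab yab hg hx gx hy.
have mh := sp_integrable_measurable hx; have mg := sp_integrable_measurable gx.
have gy : sp_integrable E g y.
  by apply: sp_integrable_band ab yab mg _ hy => l /hg.
pose x' := E b x - E a x.
have x'ab := bandlimited_resB x ab.
have cut k : sp_integrable E k x -> sp_integrable E k y ->
    sp_int E k x y = sp_int E k x' y.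
  move=> kx ky; apply: eq_sp_int => //; last first.
    by apply: sp_integrableB; exact: sp_integrable_res.
  move=> l; have [ya yb] := yab; rewrite /x' resB ipBl.
  have move_res c : ip (E l (E c x)) y = ip (E l x) (E c y) :> R.
    by rewrite res_mul minC -res_mul res_sym.
  by rewrite !move_res ya yb ip0r subr0.
rewrite !cut// !sp_intE; congr ((_ - _) / _).
  by apply: eq_sp_energy_band ab _ mh mg hg; exact: bandlimitedD.
by apply: eq_sp_energy_band ab _ mh mg hg; exact/bandlimitedD/bandlimitedN.
Qed.

Lemma sp_energy_cst (c : R) x : sp_energy E (cst c) x = c * ip x x.
Proof.
rewrite sp_energyE /Rintegral; under eq_integral do rewrite /=.
rewrite integral_cst//= -[lebesgue_stieltjes_measure _ _]/(sp_measure E x setT).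
by rewrite sp_measure_setT.
Qed.

(** Vectors whose spectral measure is carried by the point [lam]: the kernel of
    [A - lam] when [E] is the resolution of [A]. *)
Definition sp_eigen (lam : R) y := forall l, E l y = if lam <= l then y else 0.

Lemma sp_eigen_negligible lam y : sp_eigen lam y ->
  sp_measure E y (~` [set lam]) = 0%E.
Proof.
move=> ylam; apply/eqP; rewrite eq_le measure_ge0 andbT.
have band k : bandlimited (lam - k.+1%:R^-1) lam y.
  split; rewrite ylam ?lexx//.
  by rewrite ifF//; apply/negbTE; rewrite -ltNge ltrBlDr ltrDl invr_gt0.
have le_lam k : lam - k.+1%:R^-1 <= lam by rewrite lerBlDr lerDl.
pose B (k : nat) : set (measurableTypeR R) := ~` `]lam - k.+1%:R^-1, lam]%classic.
have mB k : measurable (B k).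
  by apply: measurableC; apply: sub_sigma_algebra; exact: is_ocitv.
have -> : ~` [set lam] = \bigcup_k B k.
  rewrite -setC_bigcap; congr (~` _); apply/seteqP; split => [_ -> k _|l lB] /=.
    by rewrite in_itv/= lexx andbT ltrBlDr ltrDl invr_gt0.
  apply/eqP; rewrite eq_le; have := lB 0%N I; rewrite /= in_itv/= => /andP[_ ->]/=.
  apply/ler_addgt0Pl => e e0.
  have [k _ /(_ k (leqnn k))/= ke] := near_infty_natSinv_lt (PosNum e0).
  have := lB k I; rewrite /= in_itv/= => /andP[+ _].
  by move: (k.+1%:R^-1) ke => z ke; lra.
apply: (@le_trans _ _ (\sum_(k <oo) sp_measure E y (B k))%E).
  by apply: measure_sigma_subadditive => //; exact: bigcup_measurable.
rewrite eseries0// => k _ _.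
exact: bandlimited_negligible (le_lam k) (band k).
Qed.

Lemma sp_eigen_integrable lam y h : sp_eigen lam y -> measurable_fun setT h ->
  sp_integrable E h y.
Proof.
move=> ylam mh.
apply/integrableP; split; first exact/measurable_EFinP.
rewrite (_ : (\int[_]_l _ = \int[sp_measure E y]_l `|h lam|%:E)%E).
  by have /integrableP[_] := sp_integrable_cst E (h lam) y.
apply: ae_eq_integral => //; first by do 2 apply: measurableT_comp => //.
exists (~` [set lam]); split.
- exact: measurableC.
- exact: sp_eigen_negligible.
- by apply: subsetC => l /= ->.
Qed.

Lemma sp_energy_eigen lam y h : sp_eigen lam y -> measurable_fun setT h ->
  sp_energy E h y = h lam * ip y y.
Proof.
move=> ylam mh; rewrite -(sp_energy_cst (h lam)) !sp_energyE; congr fine.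
apply: ae_eq_integral => //; try exact/measurable_EFinP.
exists (~` [set lam]); split.
- exact: measurableC.
- exact: sp_eigen_negligible.
- by apply: subsetC => l /= ->.
Qed.

(** The entries [ip (E l x) y] and [ip (E l y) y] are proportional as functions
    of [l], so the form reduces to the spectral measure of [y], a point mass. *)
Lemma sp_int_eigen lam h x y : sp_eigen lam y -> sp_integrable E h x ->
  sp_int E h x y = h lam * ip x y.
Proof.
move=> ylam hx; have mh := sp_integrable_measurable hx.
have hy := sp_eigen_integrable ylam mh.
have [->|y0] := eqVneq y 0; first by rewrite sp_int0r ip0r mulr0.
have yy0 : ip y y != 0 :> R.
  by apply: contra_neq y0; exact: ip_eq0.
have := @sp_int_comb _ _ E [:: (1, (x, y)); (- (ip x y / ip y y), (y, y))] h.
rewrite !big_cons !big_nil/= => /(_ _ _)/wrap[].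
- move=> l; rewrite !big_cons big_nil/= res_sym ylam.
  by case: ifP => _; [field|rewrite ip0r ip0l; ring].
- by move=> p; rewrite !inE => /orP[] /eqP ->.
rewrite sp_int_diag// (sp_energy_eigen ylam mh) => /eqP.
rewrite mul1r addr0 mulNr subr_eq0 => /eqP ->.
by field.
Qed.

End spectral_form_identities.

(** * Bounded functions of the operator *)

(** [fcalc], locked so that conversion does not unfold the choice operator and the
    spectral integrals behind it. *)
HB.lock Definition spfun (R : realType) (H : innerProductType R)
    (E : resolution H) (h : R -> R) (x : H) : H := fcalc E h x.

Lemma fine_le_scale (R : realDomainType) (c : R) (a b : \bar R) :
  a \is a fin_num -> b \is a fin_num -> (a <= c%:E * b)%E -> fine a <= c * fine b.
Proof. by move=> /fineK <- /fineK <-; rewrite -EFinM lee_fin. Qed.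

Section bounded_calculus.
Context (R : realType) (H : innerProductType R) (E : resolution H).
Implicit Types (x y z : H) (l a b : R) (h g : measurableTypeR R -> R).
Local Notation incr x a b := (sp_distr E x b - sp_distr E x a).

Lemma sp_energy_incr_le (C : R) g y x : 0 <= C ->
  (forall a b, a <= b -> incr y a b <= C * incr x a b) ->
  (forall l, 0 <= g l) -> sp_integrable E g x ->
  sp_energy E g y <= C * sp_energy E g x.
Proof.
move=> C0 yx g0 gx; have mg := sp_integrable_measurable gx.
have z l : sp_distr E 0 l = 0 by rewrite /sp_distr res0 ip0l.
have := @sp_integral_le _ _ E (NngNum C0) y x 0 _ (EFin \o g).
move=> /(_ _ _ _)/wrap[].
- by move=> a b ab; rewrite !z subr0 addr0; exact: yx.
- exact/measurable_EFinP.
- by move=> l; rewrite lee_fin.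
have e0 : (\int[sp_measure E (0 : H)%R]_l (EFin \o g) l = 0)%E.
  rewrite -[LHS]fineK; last first.
    apply: integrable_fin_num => //; exact: sp_integrable0.
  rewrite -[fine _]/(\int[sp_measure E 0]_l g l) -sp_energyE.
  by rewrite -(scale0r x) sp_energyZ// expr0n mul0r.
rewrite e0 adde0 !sp_energyE => h.
apply: fine_le_scale h.
  by apply: integrable_fin_num => //; exact: sp_integrable_le C0 yx gx.
exact: integrable_fin_num.
Qed.

Hypothesis Hc : hilbert H.

Section one_function.
Variables (h : measurableTypeR R -> R) (M : R).
Hypotheses (mh : measurable_fun setT h) (hM : forall l, `|h l| <= M).

Let hint x : sp_integrable E h x.
Proof. exact: sp_integrable_bounded mh hM. Qed.

Lemma sp_int_bounded x y : `|sp_int E h x y| <= M * hnorm x * hnorm y.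
Proof.
have M0 : 0 <= M by apply: le_trans (hM 0).
rewrite -(ler_pXn2r (ltn0Sn 1)) ?nnegrE ?mulr_ge0 ?hnorm_ge0//.
rewrite real_normK ?num_real//.
apply: le_trans (sp_int_sqr_le mh hM _ _) _; try exact: sp_integrable_cst.
by rewrite !sp_energy_cst !exprMn !sqr_hnorm; lra.
Qed.

(** For bounded [h] the vector [h(A) x] exists by the Riesz representation of the
    functional [sp_int h x]; this is where completeness enters. *)
Lemma fun_graph_fcalc x : fun_graph E h x (fcalc E h x).
Proof.
apply: xgetPex.
have [y yP] : exists y, forall z, ip y z = sp_int E h x z.
  apply: (riesz_representation Hc (M := M * hnorm x)).
    by move=> a y z; exact: sp_int_linr.
  exact: sp_int_bounded.
exists y; split; last by move=> z _; exact: yP.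
rewrite /dom_fun /=.
have : sp_integrable E (fun l => h l ^+ 2) x.
  apply: (@sp_integrable_bounded _ _ E _ (M ^+ 2)); first exact: measurable_funX.
  by move=> l; rewrite normrX ler_pXn2r ?nnegrE//; apply: le_trans (hM l).
move=> /integrableP[_]; apply: le_lt_trans.
rewrite le_eqVlt; apply/orP; left; apply/eqP; apply: eq_integral => l _ /=.
by rewrite ger0_norm// sqr_ge0.
Qed.

Lemma ip_spfun x y : ip (spfun E h x) y = sp_int E h x y.
Proof. rewrite unlock; by apply: (fun_graph_fcalc x).2; exact: (fun_graph_fcalc y).1. Qed.

Lemma spfun_lin (c : R) x y : spfun E h (c *: x + y) = c *: spfun E h x + spfun E h y.
Proof.
apply: (@ip_inj R) => z.
rewrite ipDl ipZl !ip_spfun.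
rewrite (sp_intC (hint (c *: x + y)) (hint z)).
rewrite (sp_intC (hint x) (hint z)) (sp_intC (hint y) (hint z)).
exact: sp_int_linr.
Qed.

Lemma res_spfun l x : E l (spfun E h x) = spfun E h (E l x).
Proof.
apply: (@ip_inj R) => z; rewrite res_sym !ip_spfun.
by apply: eq_sp_int => // m; rewrite -res_sym !res_mul minC.
Qed.

Lemma spfunB x y : spfun E h (x - y) = spfun E h x - spfun E h y.
Proof. by rewrite addrC -scaleN1r spfun_lin scaleN1r addrC. Qed.

Lemma spfun0 : spfun E h 0 = 0.
Proof. by have := spfunB 0 0; rewrite !subrr. Qed.

Lemma spfun_sp_eigen lam x : sp_eigen E lam x -> spfun E h x = h lam *: x.
Proof.
move=> xlam; apply: (@ip_inj R) => z; rewrite ip_spfun ipZl.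
by rewrite sp_intC// (sp_int_eigen xlam)// ipC.
Qed.

Lemma hnorm_spfun_le x : hnorm (spfun E h x) <= M * hnorm x.
Proof.
have M0 : 0 <= M by apply: le_trans (hM 0).
set y := spfun E h x; have [y0|y0] := eqVneq (hnorm y) 0.
  by rewrite y0 mulr_ge0 ?hnorm_ge0.
have yp : 0 < hnorm y by rewrite lt0r y0 hnorm_ge0.
rewrite -(ler_pM2r yp) -expr2 sqr_hnorm {1}/y ip_spfun.
by apply: le_trans (ler_norm _) _; exact: sp_int_bounded.
Qed.

(** [h(A)] commutes with the resolution, so a bound of [h(A)] on the spectral
    pieces of [x] bounds the spectral measure of [h(A) x]. *)
Lemma spfun_energy_le (C : R) g x : 0 <= C ->
  (forall a b, a <= b ->
     hnorm (spfun E h (E b x - E a x)) <= C * hnorm (E b x - E a x)) ->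
  (forall l, 0 <= g l) -> sp_integrable E g x ->
  sp_integrable E g (spfun E h x) /\
  sp_energy E g (spfun E h x) <= C ^+ 2 * sp_energy E g x.
Proof.
move=> C0 hC g0 gx.
have incr_le a b : a <= b -> incr (spfun E h x) a b <= C ^+ 2 * incr x a b.
  move=> ab; rewrite !sp_incrE// !res_spfun -spfunB -!sqr_hnorm -exprMn.
  by rewrite ler_pXn2r ?nnegrE ?mulr_ge0 ?hnorm_ge0//; exact: hC.
split; first exact: sp_integrable_le (sqr_ge0 C) incr_le gx.
exact: sp_energy_incr_le (sqr_ge0 C) incr_le g0 gx.
Qed.

Lemma spfun_bounded_energy g x : (forall l, 0 <= g l) -> sp_integrable E g x ->
  sp_integrable E g (spfun E h x) /\
  sp_energy E g (spfun E h x) <= M ^+ 2 * sp_energy E g x.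
Proof.
apply: spfun_energy_le; first by apply: le_trans (hM 0).
by move=> a b _; exact: hnorm_spfun_le.
Qed.

Lemma bandlimited_spfun a b x : bandlimited E a b x -> bandlimited E a b (spfun E h x).
Proof.
move=> [xa xb]; split; rewrite res_spfun ?xb// xa.
exact: spfun0.
Qed.

End one_function.

Lemma bandlimited_res a b l x : bandlimited E a b x -> bandlimited E a b (E l x).
Proof.
move=> [xa xb]; split; rewrite res_mul minC -res_mul; first by rewrite xa res0.
by rewrite xb.
Qed.

(** On a band, [h] may be replaced by its product with the indicator function of
    the band, for which the bound [C] holds everywhere. *)
Lemma hnorm_spfun_band_le h (M C a b : R) x : a <= b ->
  measurable_fun setT h -> (forall l, `|h l| <= M) -> 0 <= C ->
  (forall l, a < l <= b -> `|h l| <= C) -> bandlimited E a b x ->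
  hnorm (spfun E h x) <= C * hnorm x.
Proof.
move=> ab mh hM C0 hC xab.
pose k (l : measurableTypeR R) := h l * \1_`]a, b] l.
have mk : measurable_fun setT k.
  by apply: measurable_funM => //; apply: measurable_indic.
have kC l : `|k l| <= C.
  rewrite /k indicE; have [lab|lab] := boolP (l \in `]a, b]%classic).
    by rewrite mulr1 hC//; move: lab; rewrite inE/= in_itv.
  by rewrite mulr0 normr0.
have kh l : a < l <= b -> h l = k l.
  by move=> lab; rewrite /k indicE mem_set ?mulr1//= in_itv.
suff -> : spfun E h x = spfun E k x by exact: hnorm_spfun_le.
have hi z := @sp_integrable_bounded _ _ E h M z mh hM.
have ki z := @sp_integrable_bounded _ _ E k C z mk kC.
apply: (@ip_inj R) => z; rewrite (ip_spfun mh hM) (ip_spfun mk kC).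
by rewrite !(sp_intC _ (_ : sp_integrable E _ z))//; exact: eq_sp_int_band ab xab kh _ _ _.
Qed.

Lemma spfun_band_energy h (M C a b : R) g x : a <= b ->
  measurable_fun setT h -> (forall l, `|h l| <= M) -> 0 <= C ->
  (forall l, a < l <= b -> `|h l| <= C) -> bandlimited E a b x ->
  (forall l, 0 <= g l) -> sp_integrable E g x ->
  sp_energy E g (spfun E h x) <= C ^+ 2 * sp_energy E g x.
Proof.
move=> ab mh hM C0 hC xab g0 gx.
apply: (spfun_energy_le mh hM C0 _ g0 gx).2 => c d _.
apply: hnorm_spfun_band_le ab mh hM C0 hC _.
by apply: bandlimitedD; [|apply: bandlimitedN]; exact: bandlimited_res.
Qed.

End bounded_calculus.

(** * Positivity and discreteness of the spectrum *)

(** Connectedness of intervals, for an equivalence relation with open classes. *)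
Lemma locally_related_interval (R : realType) (P : R -> R -> Prop) (a b : R) :
  (forall t, P t t) -> (forall s t, P s t -> P t s) ->
  (forall s t u, P s t -> P t u -> P s u) ->
  (forall c, a < c < b -> exists2 e, 0 < e &
     forall s t, `|s - c| < e -> `|t - c| < e -> P s t) ->
  forall s t, a < s < b -> a < t < b -> P s t.
Proof.
move=> Prefl Psym Ptrans Ploc.
suff main s t : a < s < b -> a < t < b -> s <= t -> P s t.
  move=> s t sab tab; have [st|ts] := leP s t; first exact: main.
  by apply/Psym/main => //; exact: ltW.
move=> /andP[sa sb] /andP[ta tb] st.
pose S := [set r | s <= r <= t /\ P s r].
have Ss : S s by split; rewrite ?lexx ?st.
have Sub : has_ubound S by exists t => r [/andP[]].
have Ssup : has_sup S by split => //; exists s.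
pose c := sup S.
have sc : s <= c by exact: ub_le_sup.
have ct : c <= t by apply: ge_sup; [exists s|move=> r [/andP[]]].
have [|e e0 he] := Ploc c.
  by rewrite (lt_le_trans sa sc) (le_lt_trans ct tb).
have [r [/andP[sr rt] Psr] cr] := sup_adherent e0 Ssup.
have rc : r <= c by apply: ub_le_sup => //; split; rewrite ?sr.
have Pnear q : `|q - c| < e -> P s q.
  move=> qc; apply: Ptrans Psr _; apply: he => //.
  by rewrite ler0_norm ?subr_le0// opprB ltrBlDl -ltrBlDr.
have [tc|tc] := leP t (c + e / 2).
  by apply: Pnear; rewrite ger0_norm ?subr_ge0//; lra.
suff : c + e / 2 <= c by lra.
apply: ub_le_sup => //; split; first by apply/andP; split; lra.
by apply: Pnear; rewrite addrC addKr ger0_norm; lra.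
Qed.

Section operator_spectrum.
Context (R : realType) (H : innerProductType R) (Hc : hilbert H).
Variables (E : resolution H) (A : operator H).
Hypotheses (EA : resolution_of E A) (A_pos : positive_op A).
Implicit Types (x y z : H) (l a b : R).

(** A bounded function that is the identity for [a < l <= b]: on the range of
    [E b - E a] it represents the unbounded operator [A]. *)
Definition clamp (a b l : R) : R := Num.max a (Num.min l b).

Lemma clamp_ge a b l : a <= clamp a b l.
Proof. by rewrite /clamp le_max lexx. Qed.

Lemma clamp_le a b l : a <= b -> clamp a b l <= b.
Proof. by move=> ab; rewrite /clamp ge_max ab ge_min lexx orbT. Qed.

Lemma clamp_id a b l : a < l <= b -> clamp a b l = l.
Proof. by move=> /andP[al lb]; rewrite /clamp (min_l lb) max_r// ltW. Qed.

Lemma measurable_clamp a b : measurable_fun setT (clamp a b : measurableTypeR R -> R).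
Proof.
apply: (@measurable_maxr _ _ R setT (cst a)) => //.
by apply: (@measurable_minr _ _ R setT id (cst b)).
Qed.

Lemma normr_clamp a b l : a <= b -> `|clamp a b l| <= `|a| + `|b|.
Proof.
move=> ab; have := clamp_ge a b l; have := clamp_le l ab.
have := ler_norm b; have := ler_norm (- a); rewrite normrN.
by have := normr_ge0 a; have := normr_ge0 b; rewrite ler_norml; lra.
Qed.

(** The identity is dominated by [1 + l ^+ 2]. *)
Lemma sp_integrable_id x : dom_fun E id x -> sp_integrable E id x.
Proof.
move=> xd; have mid : measurable_fun setT (id : measurableTypeR R -> R) by [].
have h2 : sp_integrable E (fun l => l ^+ 2) x.
  apply/integrableP; split; first by apply/measurable_EFinP; exact: measurable_funX.
  apply: le_lt_trans xd; rewrite le_eqVlt; apply/orP; left; apply/eqP.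
  by apply: eq_integral => l _ /=; rewrite ger0_norm// sqr_ge0.
have h1 := sp_integrable_cst E 1 x.
have := integrableD measurableT h1 h2.
apply: sp_integrable_dominated => // l /=.
by rewrite ler_norml; nra.
Qed.

Lemma bandlimited_dom a b x : a <= b -> bandlimited E a b x ->
  dom A x /\ A x = spfun E (clamp a b) x.
Proof.
move=> ab xab; apply/EA; split.
  have mc := measurable_clamp a b.
  have : sp_integrable E (fun l => l ^+ 2) x.
    apply: (sp_integrable_band ab xab (g := fun l => clamp a b l ^+ 2)).
    - exact: measurable_funX.
    - by move=> l /clamp_id ->.
    apply: (@sp_integrable_bounded _ _ E _ ((`|a| + `|b|) ^+ 2)).
      exact: measurable_funX.
    move=> l; rewrite normrX ler_pXn2r ?nnegrE ?addr_ge0//.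
    exact: normr_clamp.
  move=> /integrableP[_]; apply: le_lt_trans.
  rewrite le_eqVlt; apply/orP; left; apply/eqP; apply: eq_integral => l _ /=.
  by rewrite ger0_norm// sqr_ge0.
move=> psi psid; have idpsi := sp_integrable_id psid.
have cb l := normr_clamp l ab.
have ci z := @sp_integrable_bounded _ _ E _ _ z (measurable_clamp a b) cb.
have idx : sp_integrable E id x.
  apply: (sp_integrable_band ab xab _ _ (ci x)) => //.
  by move=> l /clamp_id.
rewrite (ip_spfun E Hc (measurable_clamp a b) cb) (sp_intC (ci x) (ci psi)) (sp_intC idx idpsi).
by apply: eq_sp_int_band ab xab _ _ _ _ => // l /clamp_id.
Qed.

Lemma sp_int_clamp_le a b x : a <= b -> sp_int E (clamp a b) x x <= b * ip x x.
Proof.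
move=> ab; have ci := sp_integrable_bounded E x (measurable_clamp a b)
  (fun l => normr_clamp l ab).
rewrite sp_int_diag// -(sp_energy_cst E) !sp_energyE; apply: le_Rintegral => //.
  exact: sp_integrable_cst.
by move=> l _; exact: clamp_le.
Qed.

(** Positivity: on the range of [E l - E a] with [l < 0], the form of [A] is at
    most [l] times the squared norm. *)
Lemma res_negative l x : l < 0 -> E l x = 0.
Proof.
move=> l0.
have const a : a <= l -> E a x = E l x.
  move=> al; pose y := E l x - E a x.
  have yal : bandlimited E a l y by exact: bandlimited_resB.
  suff : y = 0 by move=> /eqP; rewrite subr_eq0 => /eqP ->.
  apply: contrapT => y0.
  have [yd Ay] := bandlimited_dom al yal.
  have := A_pos yd y0.
  rewrite Ay (ip_spfun E Hc (measurable_clamp a l) (fun m => normr_clamp m al)).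
  have := sp_int_clamp_le y al; have := ip_ge0 y.
  by move: (sp_int _ _ _ _) (ip y y : R) => r s; nra.
apply: hnorm_eq0; apply: (norm_cvg_unique _ (res_ninfty E x)).
apply: cvg_near_cst; near=> m; rewrite const//; near: m.
Unshelve. all: by end_near.
Qed.

(** If [s] and [t] are close to [l], then [A - l] is small on the range of
    [E t - E s], while the resolvent at [l] bounds it from below; hence this
    range is trivial. *)
Lemma resolvent_locally_constant l : resolvent_set A l -> exists2 e, 0 < e &
  forall s t, `|s - l| < e -> `|t - l| < e -> forall x, E s x = E t x.
Proof.
move=> [B [C [_ BA BC]]].
(* Then [`|C| * e <= 1 / 2], so the two estimates leave no nonzero vector. *)
pose e := (2 * (`|C| + 1))^-1; have C1 : 0 < `|C| + 1 by rewrite ltr_wpDl.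
have e0 : 0 < e by rewrite invr_gt0 mulr_gt0.
exists e => //.
suff main s t : `|s - l| < e -> `|t - l| < e -> s <= t -> forall x, E s x = E t x.
  move=> s t sl tl; have [st|ts] := leP s t; first exact: main.
  by move=> x; rewrite -(main t s)// ltW.
move=> sl tl st x; pose y := E t x - E s x.
have yst : bandlimited E s t y by exact: bandlimited_resB.
suff : y = 0 by move=> /eqP; rewrite subr_eq0 => /eqP ->.
clearbody y; have [yd Ay] := bandlimited_dom st yst.
pose k := fun m : measurableTypeR R => clamp s t m - l.
have mk : measurable_fun setT k by apply: measurable_funB => //; exact: measurable_clamp.
have ke m : `|k m| <= e.
  rewrite /k ler_norml; have := clamp_ge s t m; have := clamp_le m st.
  by move: sl tl; rewrite !ltr_norml => /andP[? ?] /andP[? ?] ? ?; apply/andP; split; lra.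
have ci z := sp_integrable_bounded E z (measurable_clamp s t)
  (fun l => normr_clamp l st).
have eta : A y - l *: y = spfun E k y.
  apply: (@ip_inj R) => z; rewrite ipBl ipZl (ip_spfun E Hc mk ke).
  rewrite Ay (ip_spfun E Hc (measurable_clamp s t) (fun m => normr_clamp m st)).
  have kE z' : sp_energy E k z' = sp_energy E (clamp s t) z' - l * ip z' z'.
    rewrite -(sp_energy_cst E) !sp_energyE -RintegralB//.
      exact: ci.
    exact: sp_integrable_cst.
  rewrite !sp_intE !kE ip_parallelogram ipDl !ipDr (ipC z y).
  by field.
have := BC (A y - l *: y); rewrite BA// eta => yC.
have y_le := hnorm_spfun_le E Hc mk ke y.
have Ce : `|C| * e <= 2^-1.
  rewrite /e invfM mulrCA ler_piMr ?invr_ge0//.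
  by rewrite ler_pdivrMr// mul1r lerDl.
apply: hnorm_eq0; apply/eqP; rewrite eq_le hnorm_ge0 andbT.
have h1 : hnorm y <= `|C| * (e * hnorm y).
  apply: le_trans yC _; apply: le_trans (ler_wpM2r (hnorm_ge0 _) (ler_norm C)) _.
  by rewrite ler_wpM2l.
have := hnorm_ge0 y; move: h1; rewrite mulrA.
move: (hnorm y) (`|C| * e) Ce => r q; nra.
Qed.

Hypothesis A_discrete : discrete_spectrum A.

(** Around an isolated point [l] of the spectrum all other points are in the
    resolvent set, so the resolution is locally constant, hence constant, on both
    sides of [l]; right continuity includes [l] in the right-hand side. *)
Lemma res_step l : exists2 e, 0 < e &
  (forall s x, l <= s < l + e -> E s x = E l x) /\
  (forall s t x, l - e < s < l -> l - e < t < l -> E s x = E t x).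
Proof.
have [lr|ls] := pselect (resolvent_set A l).
  have [e e0 he] := resolvent_locally_constant lr; exists e => //; split.
    move=> s x /andP[s1 s2]; apply: he; last by rewrite subrr normr0.
    by rewrite ltr_norml; apply/andP; split; lra.
  move=> s t x /andP[s1 s2] /andP[t1 t2].
  by apply: he; rewrite ltr_norml; apply/andP; split; lra.
have [[e e0 iso] _ _] := A_discrete ls.
have loc c : `|c - l| < e -> c != l -> resolvent_set A c.
  by move=> ce cl; apply: contrapT => cs; move/eqP: cl; apply; exact: iso.
exists e => //; split; last first.
  move=> s t x sl tl.
  apply: (@locally_related_interval R (fun s t => E s x = E t x) (l - e) l) sl tl => //.
    by move=> r1 r2 r3 -> ->.
  move=> c /andP[c1 c2]; have [|d d0 hd] := @resolvent_locally_constant c.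
    apply: loc; last by rewrite lt_eqF.
    by rewrite ltr_norml; apply/andP; split; lra.
  by exists d => // r1 r2 *; exact: hd.
move=> s x /andP[]; rewrite le_eqVlt => /predU1P[<-//|ls'] sl.
have const t : l < t < l + e -> E t x = E s x.
  move=> tl.
  apply: (@locally_related_interval R (fun s t => E s x = E t x) l (l + e)) tl _ => //.
  - by move=> r1 r2 r3 -> ->.
  - move=> c /andP[c1 c2]; have [|d d0 hd] := @resolvent_locally_constant c.
      apply: loc; last by rewrite gt_eqF.
      by rewrite ltr_norml; apply/andP; split; lra.
    by exists d => // r1 r2 *; exact: hd.
  - by rewrite ls'.
apply/eqP; rewrite -subr_eq0; apply/eqP/hnorm_eq0.
apply: (norm_cvg_unique _ (res_rc E l x)).
apply: cvg_near_cst; near=> m; rewrite const//; apply/andP; split; near: m.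
  exact: nbhs_right_gt.
by apply: nbhs_right_lt; lra.
Unshelve. all: by end_near.
Qed.

(** The resolution of an operator with discrete spectrum only changes by jumps,
    and a jump is an eigenvector. *)
Lemma res_eigenvectors b x : exists s : seq (R * H),
  (forall p, p \in s -> sp_eigen E p.1 p.2) /\ E b x = \sum_(p <- s) p.2.
Proof.
have [b0|b0] := ltP b 0.
  by exists [::]; rewrite big_nil res_negative.
pose P s t := exists u : seq (R * H),
  (forall p, p \in u -> sp_eigen E p.1 p.2) /\ E s x - E t x = \sum_(p <- u) p.2.
have Psym s t : P s t -> P t s.
  move=> [u [ue uE]]; exists [seq (p.1, - p.2) | p <- u]; split.
    move=> _ /mapP[p /ue pe ->] l /=; rewrite resN pe.
    by case: ifP; rewrite ?oppr0.
  by rewrite big_map /= sumrN -uE opprB.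
have Pjump c e s t : 0 < e -> (forall s x, c <= s < c + e -> E s x = E c x) ->
    (forall s t x, c - e < s < c -> c - e < t < c -> E s x = E t x) ->
    c <= s < c + e -> c - e < t < c -> P s t.
  move=> e0 h1 h2 sc tc; exists [:: (c, E c x - E t x)]; split.
    move=> _ /[1!inE] /eqP -> l /=; rewrite resB !res_mul.
    move/andP: tc => [t1 t2]; case: ifPn => [cl|].
      by rewrite !min_r//; apply: ltW; apply: lt_le_trans cl.
    rewrite -ltNge => lc; rewrite (min_l (ltW lc)).
    have [lt|tl] := leP l t; first by rewrite subrr.
    rewrite (h2 l t) ?subrr//; first by rewrite lc andbT (lt_trans t1).
    by rewrite t1.
  by rewrite big_seq1 /= (h1 s).
have : P b (-1).
  apply: (@locally_related_interval R P (-2) (b + 1)) => //.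
  - by move=> t; exists [::]; rewrite big_nil subrr.
  - move=> s t r [u [ue uE]] [v [ve vE]]; exists (u ++ v); split.
      by move=> p; rewrite mem_cat => /orP[/ue|/ve].
    by rewrite big_cat /= -uE -vE addrA subrK.
  - move=> c _; have [e e0 [h1 h2]] := res_step c; exists e => // s t.
    rewrite !ltr_norml => /andP[s1 s2] /andP[t1 t2].
    have [cs|sc] := leP c s; have [ct|tc] := leP c t.
    + exists [::]; rewrite big_nil; split => //.
      by rewrite (h1 s) ?(h1 t) ?subrr//; apply/andP; split; lra.
    + by apply: Pjump e0 h1 h2 _ _; apply/andP; split; lra.
    + by apply: Psym; apply: Pjump e0 h1 h2 _ _; apply/andP; split; lra.
    + exists [::]; rewrite big_nil; split => //.
      by rewrite (h2 s t) ?subrr//; apply/andP; split; lra.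
  - by apply/andP; split; lra.
  - by apply/andP; split; lra.
by rewrite /P (res_negative x (_ : -1 < 0)) ?subr0//; lra.
Qed.

End operator_spectrum.

(** * The spaces [Sob] *)

(** [sob_norm], locked so that conversion does not unfold the spectral
    integrals of different vectors. *)
HB.lock Definition sobn (R : realType) (H : innerProductType R)
    (E : resolution H) (s : R) (x : H) : R := sob_norm E s x.

Section sobolev.
Context (R : realType) (H : innerProductType R) (E : resolution H).
Hypothesis Eneg : forall l x, l < 0 -> E l x = 0.
Implicit Types (x y z : H) (l s : R) (h g : measurableTypeR R -> R).

Lemma sp_measure_le_eq0 x l : E l x = 0 -> sp_measure E x `]-oo, l]%classic = 0%E.
Proof.
move=> lx; apply/eqP; rewrite eq_le measure_ge0 andbT.
pose B (k : nat) : set (measurableTypeR R) := `]l - k%:R, l]%classic.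
have mB k : measurable (B k) by apply: sub_sigma_algebra; exact: is_ocitv.
have -> : `]-oo, l]%classic = \bigcup_k B k.
  apply/seteqP; split => [r /=|r [k _]]; rewrite /B /= !in_itv/=; last by case/andP.
  move=> rl; exists (Num.bound (l - r)) => //=; rewrite in_itv/= rl andbT.
  have := @archi_boundP _ (l - r); rewrite subr_ge0 => /(_ rl); lra.
apply: (@le_trans _ _ (\sum_(k <oo) sp_measure E x (B k))%E).
  by apply: measure_sigma_subadditive => //; exact: bigcup_measurable.
rewrite eseries0// => k _ _; rewrite sp_measure_oc ?lerBlDr ?lerDl//.
rewrite /sp_distr lx ip0l (_ : E (l - k%:R) x = 0) ?ip0l ?subrr//.
have kl : l - k%:R <= l by rewrite lerBlDr lerDl.
by have := res_mul E (l - k%:R) l x; rewrite (min_l kl) lx res0.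
Qed.

Lemma sp_measure_negative x : sp_measure E x `]-oo, 0[%classic = 0%E.
Proof.
apply/eqP; rewrite eq_le measure_ge0 andbT.
pose B (k : nat) : set (measurableTypeR R) := `]-oo, - k.+1%:R^-1]%classic.
have mB k : measurable (B k) by exact: measurable_itv.
have -> : `]-oo, 0[%classic = \bigcup_k B k.
  apply/seteqP; split => [r /=|r [k _]]; rewrite /B /= !in_itv/=; last first.
    by move=> rk; apply: le_lt_trans rk _; rewrite oppr_lt0 invr_gt0.
  move=> r0; have r0' : 0 < - r by rewrite oppr_gt0.
  have [k _ /(_ k (leqnn k))/= ke] := near_infty_natSinv_lt (PosNum r0').
  by exists k => //=; rewrite in_itv/= lerNr ltW.
apply: (@le_trans _ _ (\sum_(k <oo) sp_measure E x (B k))%E).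
  by apply: measure_sigma_subadditive => //; exact: bigcup_measurable.
rewrite eseries0// => k _ _; apply: sp_measure_le_eq0.
by apply: Eneg; rewrite oppr_lt0 invr_gt0.
Qed.

(** When the resolution vanishes on the negative half-line, that half-line is
    negligible for the spectral measures and the Sobolev norms are integrals of
    this weight over the whole line. *)
Definition sob_weight s : measurableTypeR R -> R := fun l => (1 + l ^+ 2) `^ s.

Lemma sob_weight_ge0 s l : 0 <= sob_weight s l.
Proof. exact: powR_ge0. Qed.

Lemma sob_weight_ge1 s l : 0 <= s -> 1 <= sob_weight s l.
Proof.
move=> s0; rewrite /sob_weight -[leLHS](powRr0 (1 + l ^+ 2)); apply: ler_powR => //.
by rewrite lerDl sqr_ge0.
Qed.

Lemma measurable_sob_weight s : measurable_fun setT (sob_weight s).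
Proof.
apply: (measurableT_comp (measurable_powR _)).
by apply: measurable_funD => //; exact: measurable_funX.
Qed.

Lemma normr_le_sob_weight l : `|l| <= sob_weight 2^-1 l.
Proof.
rewrite /sob_weight powR12_sqrt; last by rewrite addr_ge0 ?sqr_ge0.
rewrite -sqrtr_sqr ler_wsqrtr//; lra.
Qed.

Lemma sob_sqnormE s x :
  sob_sqnorm E s x = (\int[sp_measure E x]_l (sob_weight s l)%:E)%E.
Proof.
have mw : measurable_fun setT (EFin \o sob_weight s).
  by apply/measurable_EFinP; exact: measurable_sob_weight.
rewrite (@ge0_negligible_integral _ (measurableTypeR R) _ (sp_measure E x) setT
  `]-oo, 0[%classic)//.
- by congr (integral _ _ _); rewrite setTD setCitvl.
- by move=> l _; rewrite lee_fin sob_weight_ge0.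
- exact: sp_measure_negative.
Qed.

Lemma SobE s x : Sob E s x <-> sp_integrable E (sob_weight s) x.
Proof.
rewrite /Sob /= sob_sqnormE; split => [xs|/integrableP[_]].
  apply/integrableP; split.
    by apply/measurable_EFinP; exact: measurable_sob_weight.
  apply: le_lt_trans xs; rewrite le_eqVlt; apply/orP; left; apply/eqP.
  by apply: eq_integral => l _ /=; rewrite ger0_norm// sob_weight_ge0.
apply: le_lt_trans; rewrite le_eqVlt; apply/orP; left; apply/eqP.
by apply: eq_integral => l _ /=; rewrite ger0_norm// sob_weight_ge0.
Qed.

Lemma sobnE s x : sobn E s x = sob_norm E s x.
Proof. by rewrite unlock. Qed.

Lemma sobn_ge0 s x : 0 <= sobn E s x.
Proof. by rewrite unlock sqrtr_ge0. Qed.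

Lemma sqr_sobn s x : sobn E s x ^+ 2 = sp_energy E (sob_weight s) x.
Proof.
rewrite sobnE /sob_norm sqr_sqrtr sob_sqnormE; last first.
  by apply/fine_ge0/integral_ge0 => l _; rewrite lee_fin sob_weight_ge0.
by rewrite sp_energyE.
Qed.

Lemma sobn_le s x (C : R) y : 0 <= C ->
  sp_energy E (sob_weight s) x <= C ^+ 2 * sp_energy E (sob_weight s) y ->
  sobn E s x <= C * sobn E s y.
Proof.
move=> C0 h; rewrite -(ler_pXn2r (ltn0Sn 1)) ?nnegrE ?mulr_ge0 ?sobn_ge0//.
by rewrite exprMn !sqr_sobn.
Qed.

Lemma SobD s x y : Sob E s x -> Sob E s y -> Sob E s (x + y).
Proof. by move=> /SobE xs /SobE ys; apply/SobE; exact: sp_integrableD. Qed.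

Lemma SobZ s (c : R) x : Sob E s x -> Sob E s (c *: x).
Proof. by move=> /SobE xs; apply/SobE; exact: sp_integrableZ. Qed.

Lemma SobB s x y : Sob E s x -> Sob E s y -> Sob E s (x - y).
Proof. by move=> /SobE xs /SobE ys; apply/SobE; exact: sp_integrableB. Qed.

Lemma Sob0 s : Sob E s 0.
Proof. by apply/SobE; apply: sp_integrable0; exact: measurable_sob_weight. Qed.

Lemma Sob_res s l x : Sob E s x -> Sob E s (E l x).
Proof. by move=> /SobE xs; apply/SobE; exact: sp_integrable_res. Qed.

Lemma Sob_eigen s lam x : sp_eigen E lam x -> Sob E s x.
Proof.
by move=> xlam; apply/SobE; apply: sp_eigen_integrable xlam _; exact: measurable_sob_weight.
Qed.

Lemma sobnZ s (c : R) x : Sob E s x -> sobn E s (c *: x) = `|c| * sobn E s x.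
Proof.
move=> /SobE xs; apply/eqP.
rewrite -(@eqrXn2 _ 2) ?sobn_ge0 ?mulr_ge0 ?sobn_ge0//.
by rewrite exprMn real_normK ?num_real// !sqr_sobn sp_energyZ.
Qed.

Lemma hnorm_le_sobn s x : 0 <= s -> Sob E s x -> hnorm x <= sobn E s x.
Proof.
move=> s0 /SobE xs; rewrite -(ler_pXn2r (ltn0Sn 1)) ?nnegrE ?hnorm_ge0 ?sobn_ge0//.
rewrite sqr_hnorm sqr_sobn -[leLHS]mul1r -(sp_energy_cst E) !sp_energyE.
apply: le_Rintegral => //; first exact: sp_integrable_cst.
by move=> l _; exact: sob_weight_ge1.
Qed.

(** [1 - E l] is an orthogonal projection that commutes with the resolution, so
    it decreases spectral measures. *)
Lemma incr_resC_le l x (a b : R) : a <= b ->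
  sp_distr E (x - E l x) b - sp_distr E (x - E l x) a <=
  1 * (sp_distr E x b - sp_distr E x a).
Proof.
move=> ab; rewrite mul1r !sp_incrE//.
set d := E b x - E a x.
have -> : E b (x - E l x) - E a (x - E l x) = d - E l d.
  have comm c : E l (E c x) = E c (E l x) by rewrite !res_mul minC.
  rewrite /d !resB !comm.
  move: (E b x) (E a x) (E b (E l x)) (E a (E l x)) => p q r t.
  by rewrite !opprB addrACA [RHS]addrACA (addrC (- r)).
clearbody d.
have h : ip (E l d) d = ip (E l d) (E l d) :> R by rewrite -res_sym res_mul minxx.
rewrite ipBl !ipBr (ipC d) h.
by have := ip_ge0 (E l d); lra.
Qed.

(** The spectral measure of [x - E k x] is carried by the half-line beyond [k],
    so the squared Sobolev norm is the tail of a convergent integral. *)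
Lemma cvg_res_sob s x : Sob E s x ->
  sobn E s (x - E k%:R x) @[k --> \oo] --> 0.
Proof.
move=> /SobE xs; have mw := measurable_sob_weight s.
pose t (k : nat) : measurableTypeR R -> R := fun l => sob_weight s l * \1_`]k%:R, +oo[ l.
have mt k : measurable_fun setT (t k).
  by apply: measurable_funM => //; exact: measurable_indic.
have t0 k l : 0 <= t k l by rewrite mulr_ge0 ?sob_weight_ge0.
have tw k l : `|t k l| <= sob_weight s l.
  by rewrite ger0_norm// /t ler_piMr ?sob_weight_ge0// indicE lern1 leq_b1.
have tx k : sp_integrable E (t k) x by exact: sp_integrable_dominated (tw k) xs.
have tail k : sobn E s (x - E k%:R x) ^+ 2 <= sp_energy E (t k) x.
  have xk0 : E k%:R (x - E k%:R x) = 0 by rewrite resB res_mul minxx subrr.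
  rewrite -[leRHS]mul1r sqr_sobn.
  apply: le_trans (sp_energy_incr_le _ (@incr_resC_le k%:R x) (t0 k) (tx k)) => //.
  rewrite le_eqVlt; apply/orP; left; apply/eqP; rewrite !sp_energyE; congr fine.
  apply: ae_eq_integral => //; try exact/measurable_EFinP.
  exists `]-oo, k%:R]%classic; split; first exact: measurable_itv.
    exact: sp_measure_le_eq0.
  move=> l /=; apply: contra_notP; rewrite in_itv/= => /negP; rewrite -ltNge => kl _.
  by rewrite /t indicE mem_set ?mulr1//= in_itv/= andbT.
have cvgt : sp_energy E (t k) x @[k --> \oo] --> 0.
  have : (\int[sp_measure E x]_l (t k l)%:E)%E @[k --> \oo] -->
      (\int[sp_measure E x]_l (cst 0%E l))%E.
    apply: (@dominated_cvg _ _ _ (sp_measure E x) setT measurableT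
      (fun k l => (t k l)%:E) (cst 0%E) (fun l => (sob_weight s l)%:E)) => //.
    - by move=> k; exact/measurable_EFinP.
    - move=> l _; apply/cvg_EFin; first by near=> k.
      apply: cvg_near_cst; near=> k.
      rewrite /= /t indicE memNset ?mulr0//= in_itv/= andbT => kl.
      suff : l < k%:R by lra.
      by near: k; exact: nbhs_infty_gtr.
    - by move=> k l _; rewrite lee_fin.
  rewrite integral0_eq// => /fine_cvgP[_].
  by apply: cvg_trans; apply: near_eq_cvg; near=> k; rewrite /= sp_energyE.
apply/cvgrPdist_le => e e0; have e20 : 0 < e ^+ 2 by rewrite exprn_gt0.
have /cvgrPdist_le /(_ _ e20) := cvgt; apply: filterS => k.
rewrite !sub0r !normrN ger0_norm ?sp_energy_ge0// => h.
rewrite ger0_norm ?sobn_ge0//.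
rewrite -(ler_pXn2r (ltn0Sn 1)) ?nnegrE ?sobn_ge0 ?(ltW e0)//.
exact: le_trans (tail k) h.
Unshelve. all: by end_near.
Qed.

End sobolev.

(** * Functionals on [Sob] *)

Section sobolev_dual.
Context (R : realType) (H : innerProductType R) (E : resolution H).
Hypothesis Eneg : forall l x, l < 0 -> E l x = 0.
Variable s : R.
Implicit Types (x y z : H) (l : H -> R).
Local Notation "`[ x ]" := (sobn E s x).
Local Notation SobD_ := (SobD Eneg).
Local Notation SobB_ := (SobB Eneg).

Lemma Sob_dual0 l : Sob_dual E s l -> l 0 = 0.
Proof.
by move=> [llin _]; have := llin 1 0 0 (Sob0 Eneg s) (Sob0 Eneg s); rewrite scaler0 addr0; lra.
Qed.

Lemma Sob_dualZ l (c : R) x : Sob_dual E s l -> Sob E s x -> l (c *: x) = c * l x.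
Proof.
move=> ld xs; have [llin _] := ld.
by have := llin c x 0 xs (Sob0 Eneg s); rewrite addr0 (Sob_dual0 ld) addr0.
Qed.

Lemma Sob_dual_addr l x y : Sob_dual E s l -> Sob E s x -> Sob E s y ->
  l (x + y) = l x + l y.
Proof. by move=> [llin _] xs ys; have := llin 1 x y xs ys; rewrite scale1r mul1r. Qed.

Lemma Sob_dual_subr l x y : Sob_dual E s l -> Sob E s x -> Sob E s y ->
  l (x - y) = l x - l y.
Proof.
move=> ld xs ys; rewrite -scaleN1r.
by rewrite (Sob_dual_addr ld xs (SobZ Eneg (-1) ys)) (Sob_dualZ (-1) ld ys) mulN1r.
Qed.

Lemma Sob_dualB l1 l2 : Sob_dual E s l1 -> Sob_dual E s l2 -> Sob_dual E s (l1 - l2).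
Proof.
move=> [lin1 [C1 h1]] [lin2 [C2 h2]]; split.
  move=> a x y xs ys; rewrite -[LHS]/(l1 (a *: x + y) - l2 (a *: x + y)).
  rewrite -[(l1 - l2) x]/(l1 x - l2 x) -[(l1 - l2) y]/(l1 y - l2 y).
  by rewrite lin1// lin2//; ring.
exists (C1 + C2) => x xs; rewrite -[(l1 - l2) x]/(l1 x - l2 x) mulrDl.
apply: le_trans (ler_normB _ _) _.
by apply: lerD; [exact: h1|exact: h2].
Qed.

Lemma dual_norm_has_sup l : Sob_dual E s l ->
  has_sup [set `|l x| | x in [set x | Sob E s x /\ sob_norm E s x <= 1]].
Proof.
move=> ld; have [_ [C lC]] := ld; split.
  exists `|l 0|, 0 => //; split; first exact: Sob0.
  by rewrite -sobnE -(scale0r (0 : H)) sobnZ// ?normr0 ?mul0r//; exact: Sob0.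
exists `|C| => _ [x [xs x1] <-]; apply: le_trans (lC x xs) _.
rewrite -!sobnE in x1 *.
apply: le_trans (ler_wpM2r (sobn_ge0 _ _ _) (ler_norm C)) _.
by rewrite ler_piMr.
Qed.

Lemma dual_norm_ge0 l : Sob_dual E s l -> 0 <= dual_norm E s l.
Proof.
move=> ld; have [[r rP] ub] := dual_norm_has_sup ld.
apply: (@le_trans _ _ r); last exact: ub_le_sup.
by have [x _ <-] := rP.
Qed.

Lemma le_dual_norm l x : Sob_dual E s l -> Sob E s x -> `|l x| <= dual_norm E s l * `[x].
Proof.
move=> ld xs; have [x0|x0] := eqVneq `[x] 0.
  by have [_ [C /(_ _ xs)]] := ld; rewrite -sobnE x0 !mulr0.
have xp : 0 < `[x] by rewrite lt0r x0 sobn_ge0.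
rewrite -ler_pdivrMr//; have [_ ub] := dual_norm_has_sup ld.
have -> : `|l x| / `[x] = `|l (`[x]^-1 *: x)|.
  by rewrite Sob_dualZ// normrM (ger0_norm (ltW _)) ?invr_gt0// mulrC.
apply: (ub_le_sup ub); exists (`[x]^-1 *: x); last by [].
split; first exact: (SobZ Eneg _ xs).
by rewrite -sobnE sobnZ// ger0_norm ?invr_ge0 ?sobn_ge0// mulVf.
Qed.

Lemma dual_norm_le l (c : R) : 0 <= c -> (forall x, Sob E s x -> `|l x| <= c * `[x]) ->
  dual_norm E s l <= c.
Proof.
move=> c0 lc; apply: ge_sup.
  exists `|l 0|, 0 => //; split; first exact: Sob0.
  by rewrite -sobnE -(scale0r (0 : H)) sobnZ// ?normr0 ?mul0r//; exact: Sob0.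
move=> _ [x [xs x1] <-]; apply: le_trans (lc x xs) _.
by rewrite -sobnE in x1; rewrite ler_piMr.
Qed.

Lemma eq_Sob_dual l1 l2 : (forall x, Sob E s x -> l1 x = l2 x) ->
  Sob_dual E s l1 -> Sob_dual E s l2.
Proof.
move=> l12 [lin [C lC]]; split.
  move=> a x y xs ys.
  have axys : Sob E s (a *: x + y) by exact: (SobD_ (SobZ Eneg _ xs) ys).
  apply: etrans (esym (l12 _ axys)) (etrans (lin a x y xs ys) _).
  by congr (a * _ + _); exact: l12.
by exists C => x xs; rewrite -(l12 x)//; exact: lC.
Qed.

Lemma sobn_res_le (t : R) x : Sob E s x -> `[E t x] <= `[x].
Proof.
move=> xs; rewrite -[leRHS]mul1r; apply: sobn_le => //; rewrite expr1n.
apply: sp_energy_incr_le => //; last exact/SobE.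
  move=> a b ab; rewrite mul1r !sp_incrE//.
  set d := E b x - E a x.
  have -> : E b (E t x) - E a (E t x) = E t d.
    by rewrite /d resB !res_mul (minC t) (minC t).
  clearbody d; have h : ip (E t d) d = ip (E t d) (E t d) :> R by rewrite -res_sym res_mul minxx.
  have := ip_ge0 (d - E t d); rewrite ipBl !ipBr (ipC d) h; lra.
exact: sob_weight_ge0.
Qed.

Lemma sobn_resC_le (t : R) x : Sob E s x -> `[x - E t x] <= `[x].
Proof.
move=> xs; rewrite -[leRHS]mul1r; apply: sobn_le => //; rewrite expr1n.
apply: sp_energy_incr_le => //; last exact/SobE.
  by move=> a b; exact: incr_resC_le.
exact: sob_weight_ge0.
Qed.

Lemma sobn_pythagoras (t c : R) x y : Sob E s x -> Sob E s y ->
  `[E t x + c *: (y - E t y)] ^+ 2 = `[E t x] ^+ 2 + c ^+ 2 * `[y - E t y] ^+ 2.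
Proof.
move=> xs ys; rewrite !(sqr_sobn Eneg).
set z := y - E t y.
have tz : E t z = 0 by rewrite /z resB res_mul minxx subrr.
have zs : Sob E s z by exact: (SobB_ ys (Sob_res Eneg _ ys)).
clearbody z.
have := @sp_energy_comb _ _ E [:: (1, E t x + c *: z); (-1, E t x); (- c ^+ 2, z)] (sob_weight s).
rewrite !big_cons !big_nil/= => /(_ _ _)/wrap[].
- move=> r; rewrite !big_cons big_nil/= /sp_distr resD resZ.
  have o1 : ip (E r (E t x)) z = 0 :> R.
    by rewrite res_mul minC -res_mul res_sym tz ip0r.
  have o2 : ip (E r z) (E t x) = 0 :> R by rewrite res_sym ipC.
  by rewrite ipDl !ipDr !ipZl !ipZr o1 o2; ring.
- move=> x'; rewrite !inE => /or3P[] /eqP ->; apply/(SobE Eneg).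
  + exact: (SobD_ (Sob_res Eneg _ xs) (SobZ Eneg _ zs)).
  + exact: (Sob_res Eneg _ xs).
  + exact: zs.
by lra.
Qed.

(** A functional [l] is small on the range of [1 - E N]: otherwise a vector
    [x] almost attaining the norm of [l], cut off to the range of [E N], could
    be improved to first order by adding a small multiple of some [z] in the
    range of [1 - E N], while by orthogonality its norm only changes to second
    order. *)
Lemma Sob_dual_tail l (e : R) : Sob_dual E s l -> 0 < e ->
  exists N : nat, forall y, Sob E s y -> `|l (y - E N%:R y)| <= e * `[y].
Proof.
move=> ld e0; pose D := dual_norm E s l; have D0 : 0 <= D by exact: dual_norm_ge0.
(* [t] is the size of the perturbation of the almost maximal vector, and [d] the
   defect of maximality: for [`|c| = t / `[y]] the gain [c * l z] is at most
   [D * (t ^+ 2 / 2) + 2 * d], that is [(D / 2 + 1) * t ^+ 2]. *)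
pose t := e / (D / 2 + 1); have D1 : 0 < D / 2 + 1 by lra.
have t0 : 0 < t by rewrite divr_gt0.
pose d := t ^+ 2 / 2; have d0 : 0 < d by rewrite divr_gt0// exprn_gt0.
have [x [xs x1 lx]] : exists x, [/\ Sob E s x, `[x] <= 1 & D - d < l x].
  have [_ [x [xs x1] <-] lx] := sup_adherent d0 (dual_norm_has_sup ld).
  rewrite -sobnE in x1.
  have [l0|l0] := leP 0 (l x); first by exists x; rewrite ger0_norm in lx.
  rewrite ltr0_norm// in lx.
  exists (-1 *: x); split; first exact: (SobZ Eneg _ xs).
    by rewrite (sobnZ Eneg (-1) xs) normrN normr1 mul1r.
  by rewrite (Sob_dualZ (-1) ld xs) mulN1r.
have dD : 0 < d / (D + 1) by rewrite divr_gt0// ltr_wpDl.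
have /cvgrPdist_le /(_ _ dD)[N _ /(_ N (leqnn N))/=] := cvg_res_sob Eneg xs.
rewrite sub0r normrN ger0_norm ?sobn_ge0// => xN.
exists N => y ys; set z := y - E N%:R y.
have zs : Sob E s z by exact: (SobB_ ys (Sob_res Eneg _ ys)).
have zy : `[z] <= `[y] by exact: sobn_resC_le.
pose x' := E N%:R x; have x's : Sob E s x' by exact: Sob_res.
have lx' : D - 2 * d <= l x'.
  have := le_dual_norm ld (SobB_ xs x's); rewrite Sob_dual_subr// -/D => h.
  have h2 : D * `[x - x'] <= d.
    apply: le_trans (ler_wpM2l D0 xN) _; rewrite mulrCA ler_piMr ?(ltW d0)//.
    by rewrite ler_pdivrMr; lra.
  have := ler_norm (l x - l x'); lra.
have [y0|y0] := eqVneq `[y] 0.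
  have z0 : `[z] = 0 by apply/eqP; rewrite eq_le sobn_ge0 andbT -y0.
  by have := le_dual_norm ld zs; rewrite z0 y0 !mulr0.
have yp : 0 < `[y] by rewrite lt0r y0 sobn_ge0.
suff main c : `|c| = t / `[y] -> c * l z <= (D / 2 + 1) * t ^+ 2.
  pose c := t / `[y]; have c0 : 0 < c by rewrite divr_gt0.
  have cn : `|c| = t / `[y] by rewrite gtr0_norm.
  have h1 := main _ cn; have h2 := main (- c); rewrite normrN in h2.
  have {}h2 := h2 cn.
  rewrite -(ler_pM2l c0) -{1}(gtr0_norm c0) -normrM.
  have -> : c * (e * `[y]) = (D / 2 + 1) * t ^+ 2.
    have te : t * (D / 2 + 1) = e by rewrite divfK// gt_eqF.
    by rewrite /c mulrCA divfK// -te mulrC mulrA expr2 mulrC mulrA.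
  by rewrite ler_norml; lra.
move=> cE.
have h1 : l x' + c * l z <= D * `[x' + c *: z].
  have czs := SobZ Eneg c zs.
  rewrite -(Sob_dualZ c ld zs) -(Sob_dual_addr ld x's czs).
  by apply: le_trans (ler_norm _) _; exact: (le_dual_norm ld (SobD_ x's czs)).
have h2 : `[x' + c *: z] <= 1 + t ^+ 2 / 2.
  have t2 : 0 <= t ^+ 2 by exact: sqr_ge0.
  have p1 : 0 <= 1 + t ^+ 2 / 2 by lra.
  rewrite -(ler_pXn2r (ltn0Sn 1)) ?nnegrE ?sobn_ge0//.
  rewrite sobn_pythagoras// -/x' -/z.
  have -> : c ^+ 2 = (t / `[y]) ^+ 2 by rewrite -cE real_normK ?num_real.
  have hx : `[x'] ^+ 2 <= 1.
    by rewrite expr_le1 ?sobn_ge0//; apply: le_trans (sobn_res_le _ xs) x1.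
  have hz : (t / `[y]) ^+ 2 * `[z] ^+ 2 <= t ^+ 2.
    have tz : t / `[y] * `[z] <= t.
      by rewrite -mulrA ler_piMr ?(ltW t0)// mulrC ler_pdivrMr// mul1r.
    have tz0 : 0 <= t / `[y] * `[z] by apply: mulr_ge0 (sobn_ge0 _ _ _); apply: ltW; exact: divr_gt0.
    by rewrite -exprMn ler_pXn2r// nnegrE ltW.
  by move: hx hz; rewrite sqrrD expr1n mul1r -mulr_natr; nra.
have h3 : D * `[x' + c *: z] <= D * (1 + t ^+ 2 / 2) by rewrite ler_wpM2l.
by move: lx' h1 h3; rewrite /d; lra.
Qed.

End sobolev_dual.

(** * Smooth functions of compact support *)

Section smooth_functions.
Context {R : realType}.
Implicit Types (f g : R -> R) (a b c t : R).

(** Derivatives are carried as explicit functions, which makes the closure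
    properties provable by induction on the order. *)
Fixpoint diffn k f : Prop := if k isn't j.+1 then True else
  exists2 f', forall t, is_derive t 1 f (f' t) & diffn j f'.

Definition smooth f := forall k, diffn k f.

Lemma diffnS k f : diffn k.+1 f -> diffn k f.
Proof.
elim: k f => [//|k ih] f [f' ff' f'k]; exists f' => //; exact: ih.
Qed.

Lemma eq_diffn k f g : f =1 g -> diffn k f -> diffn k g.
Proof. by move=> /funext ->. Qed.

Lemma diffn_cst k c : diffn k (fun=> c).
Proof. by elim: k c => [//|k ih] c; exists (fun=> 0) => // t; exact: is_derive_cst. Qed.

Lemma diffnD k f g : diffn k f -> diffn k g -> diffn k (fun t => f t + g t).
Proof.
elim: k f g => [//|k ih] f g [f' ff' f'k] [g' gg' g'k].
exists (fun t => f' t + g' t); last exact: ih.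
by move=> t; exact: is_deriveD.
Qed.

Lemma diffnM k f g : diffn k f -> diffn k g -> diffn k (fun t => f t * g t).
Proof.
elim: k f g => [//|k ih] f g fk gk.
have [f' ff' f'k] := fk; have [g' gg' g'k] := gk.
exists (fun t => f t * g' t + g t * f' t).
  by move=> t; exact: is_deriveM.
by apply: diffnD; apply: ih => //; exact: diffnS.
Qed.

Lemma diffnZ k c f : diffn k f -> diffn k (fun t => c * f t).
Proof. by move=> fk; apply: diffnM => //; exact: diffn_cst. Qed.

Lemma diffnB k f g : diffn k f -> diffn k g -> diffn k (fun t => f t - g t).
Proof.
move=> fk gk; apply: (@eq_diffn k (fun t => f t + (-1) * g t)).
  by move=> t; rewrite mulN1r.
by apply: diffnD => //; exact: diffnZ.
Qed.

Lemma diffnV k f : (forall t, f t != 0) -> diffn k f -> diffn k (fun t => (f t)^-1).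
Proof.
move=> f0; elim: k => [//|k ih] fk; have [f' ff' f'k] := fk.
exists (fun t => -1 * ((f t)^-1 * (f t)^-1) * f' t).
  move=> t; apply: (is_derive_eq (is_deriveV (f0 t) (ff' t))).
  by rewrite mulN1r -invfM -expr2.
have fVk := ih (diffnS fk).
by apply: diffnM => //; apply: diffnZ; exact: diffnM.
Qed.

Lemma is_derive_affine (a b t : R) : is_derive t 1 (fun r => a * r + b) a.
Proof.
have h : is_derive t 1 ((cst a) * (@id R) + cst b) (a *: 1 + t *: 0 + 0) by exact: is_deriveD.
apply: (is_derive_eq h).
by rewrite scaler0 !addr0 /GRing.scale /= mulr1.
Qed.

Lemma diffn_affine k f a b : diffn k f -> diffn k (fun t => f (a * t + b)).
Proof.
elim: k f => [//|k ih] f [f' ff' f'k].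
exists (fun t => a * f' (a * t + b)); last by apply: diffnZ; exact: ih.
move=> t; have h := @is_derive1_comp _ f (fun r => a * r + b) t _ _ (ff' (a * t + b)) (is_derive_affine a b t).
by apply: (is_derive_eq h); rewrite mulrC.
Qed.

Lemma diffn_expR k : diffn k (@expR R).
Proof. by elim: k => [//|k ih]; exists expR => // t; exact: is_derive_expR. Qed.

Lemma derive1_of_is_derive f f' : (forall t, is_derive t 1 f (f' t)) -> f^`()%classic = f'.
Proof. by move=> ff'; apply/funext => t; rewrite derive1E; exact: derive_val. Qed.

Lemma smooth_derivable f : smooth f -> forall k t, derivable (derive1n k f) t 1.
Proof.
move=> fs k; move: (fs k.+1); elim: k f {fs} => [|k ih] f [f' ff' f'k] t.
  exact: ex_derive.
by rewrite derive1Sn (derive1_of_is_derive ff'); exact: ih.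
Qed.

Lemma derive1nE1 f f' : (forall t, is_derive t 1 f (f' t)) -> derive1n 1 f = f'.
Proof. by move=> ff'; rewrite derive1n1; exact: derive1_of_is_derive ff'. Qed.

(** The functions [t ^- n * expR (- t^-1)] on the positive half-line, extended by
    [0], are flat at [0], and the derivative of one of them is a combination of
    two others; hence they are smooth. *)
Definition flat (n : nat) (t : R) : R := if 0 < t then t ^- n * expR (- t^-1) else 0.

Lemma flat_ge0 n t : 0 <= flat n t.
Proof.
by rewrite /flat; case: ifP => // t0; rewrite mulr_ge0 ?expR_ge0// invr_ge0 exprn_ge0// ltW.
Qed.

Lemma flat_gt0 n t : 0 < t -> 0 < flat n t.
Proof. by move=> t0; rewrite /flat t0 mulr_gt0 ?expR_gt0// invr_gt0 exprn_gt0. Qed.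

Lemma flat_eq0 n t : t <= 0 -> flat n t = 0.
Proof. by rewrite /flat ltNge => ->. Qed.

(** The exponential series gives [expR (t^-1) >= t^-1 ^+ (n + 2) / (n + 2)!]. *)
Lemma flat_le_sqr n t : flat n t <= n.+2`!%:R * t ^+ 2.
Proof.
have [t0|t0] := leP t 0; first by rewrite flat_eq0// mulr_ge0 ?sqr_ge0.
have Vt0 : 0 <= t^-1 by rewrite invr_ge0 ltW.
have := @expR_ge1Dxn R t^-1 n.+1 Vt0.
have : 0 < n.+2`!%:R :> R by rewrite ltr0n fact_gt0.
move: (n.+2`!%:R : R) => C C0 h.
have {}h : t^-1 ^+ n.+2 / C <= expR t^-1 by apply: le_trans h; rewrite lerDr.
rewrite /flat t0 expRN.
rewrite ler_pdivrMr ?expR_gt0//.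
apply: le_trans (ler_wpM2l _ h); last by rewrite mulr_ge0 ?sqr_ge0// ltW.
rewrite le_eqVlt; apply/orP; left; apply/eqP.
rewrite exprVn !exprS expr0; field.
by rewrite !gt_eqF ?exprn_gt0.
Qed.

Lemma is_derive_flat n t : is_derive t 1 (flat n) (flat n.+2 t - n%:R * flat n.+1 t).
Proof.
have [t0|t0|t0] := ltgtP t 0.
- rewrite !flat_eq0 ?ltW// mulr0 subrr.
  apply: near_eq_is_derive (is_derive_cst (0 : R) t 1); near=> r.
  rewrite flat_eq0//; apply: ltW; near: r; exact: lt_nbhsl.
- pose F r : R := r ^- n * expR (- r^-1).
  suff : is_derive t 1 F (flat n.+2 t - n%:R * flat n.+1 t).
    by apply: near_eq_is_derive; near=> r; rewrite /flat ifT//; near: r; exact: lt_nbhsr.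
  have tn0 : t != 0 by rewrite gt_eqF.
  have d1 : is_derive t 1 (fun r : R => r^-1) (- t ^- 2).
    by apply: (is_derive_eq (is_deriveV tn0 (is_derive_id t 1))); rewrite /GRing.scale /= mulr1.
  have d2 : is_derive t 1 (fun r : R => (r ^+ n)^-1) (- (t ^+ n) ^- 2 * (n%:R * t ^+ n.-1)).
    have h : is_derive t 1 (fun r : R => r ^+ n) (n%:R * t ^+ n.-1).
      rewrite (_ : (fun r => r ^+ n) = (id : R -> R) ^+ n); last first.
        by apply/funext => r; rewrite exprfctE.
      by apply: (is_derive_eq (is_deriveX n (is_derive_id t 1))); rewrite /GRing.scale /= mulr1.
    by apply: (is_derive_eq (is_deriveV (f := fun r : R => r ^+ n) _ h)); rewrite ?expf_neq0.
  have d3 : is_derive t 1 (fun r : R => expR (- r^-1)) (expR (- t^-1) * t ^- 2).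
    have h : is_derive t 1 (fun r : R => - r^-1) (- - t ^- 2) by exact: is_deriveN.
    have := @is_derive1_comp _ expR (fun r : R => - r^-1) t _ _ (is_derive_expR _) h.
    by rewrite opprK.
  apply: (is_derive_eq (is_deriveM d2 d3)).
  rewrite /flat t0 /GRing.scale /=.
  case: n {F d2} => [|n]; first by rewrite !expr0 invr1; field.
  rewrite /= !exprS; field.
  by rewrite !tn0 expf_neq0.
rewrite t0 !flat_eq0// mulr0 subrr.
have C0 : 0 < n.+2`!%:R :> R by rewrite ltr0n fact_gt0.
set C := n.+2`!%:R in C0.
have cvg0 : h^-1 *: ((flat n \o shift 0) (h *: 1) - flat n 0) @[h --> 0^'] --> (0 : R).
  apply/cvgrPdist_le => e e0; near=> h.
  have h0 : h != 0 by near: h; exact: nbhs_dnbhs_neq.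
  rewrite sub0r normrN /= addr0 (flat_eq0 _ (lexx 0)) subr0 /GRing.scale /= mulr1.
  rewrite normrM normfV (ger0_norm (flat_ge0 _ _)).
  rewrite mulrC ler_pdivrMr ?normr_gt0//.
  apply: le_trans (flat_le_sqr n h) _; rewrite -/C -(real_normK (num_real h)) expr2 mulrA.
  rewrite ler_wpM2r// mulrC -ler_pdivlMr//.
  near: h; apply: dnbhs0_le; exact: divr_gt0.
split; first by apply/cvg_ex; exists 0.
exact/cvg_lim.
Unshelve. all: by end_near.
Qed.

Lemma diffn_flat k n : diffn k (flat n).
Proof.
elim: k n => [//|k ih] n; exists (fun t => flat n.+2 t - n%:R * flat n.+1 t).
  by move=> t; exact: is_derive_flat.
by apply: diffnB => //; exact: diffnZ.
Qed.

Definition smooth_step t : R := flat 0 t / (flat 0 t + flat 0 (1 - t)).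

Lemma smooth_step_den_gt0 t : 0 < flat 0 t + flat 0 (1 - t).
Proof.
have [t0|t0] := leP t 0.
  by rewrite ltr_wpDl ?flat_ge0// flat_gt0; lra.
by rewrite ltr_wpDr ?flat_ge0// flat_gt0.
Qed.

Lemma smooth_step0 t : t <= 0 -> smooth_step t = 0.
Proof. by move=> t0; rewrite /smooth_step flat_eq0// mul0r. Qed.

Lemma smooth_step1 t : 1 <= t -> smooth_step t = 1.
Proof.
move=> t1; have := smooth_step_den_gt0 t; rewrite /smooth_step.
rewrite (@flat_eq0 _ (1 - t)) ?addr0; last by lra.
by move=> ?; rewrite divff// gt_eqF.
Qed.

Lemma smooth_smooth_step : smooth smooth_step.
Proof.
move=> k; apply: diffnM; first exact: diffn_flat.
apply: diffnV; first by move=> t; rewrite gt_eqF// smooth_step_den_gt0.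
apply: diffnD; first exact: diffn_flat.
apply: (@eq_diffn k (fun t => flat 0 (-1 * t + 1))); last exact/diffn_affine/diffn_flat.
by move=> t; rewrite mulN1r addrC.
Qed.

Definition smooth_step' t : R :=
  (flat 2 t * flat 0 (1 - t) + flat 0 t * flat 2 (1 - t)) /
  (flat 0 t + flat 0 (1 - t)) ^+ 2.

Lemma smooth_step'_ge0 t : 0 <= smooth_step' t.
Proof. by rewrite divr_ge0 ?sqr_ge0// addr_ge0// mulr_ge0 ?flat_ge0. Qed.

Lemma smooth_step'_eq0 t : ~~ (0 <= t <= 1) -> smooth_step' t = 0.
Proof.
rewrite negb_and -!ltNge /smooth_step' => /orP[t0|t1].
  by rewrite !(@flat_eq0 _ t) ?ltW// !mul0r addr0 mul0r.
by rewrite !(@flat_eq0 _ (1 - t)) ?mulr0 ?addr0 ?mul0r//; lra.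
Qed.

Lemma is_derive_smooth_step t : is_derive t 1 smooth_step (smooth_step' t).
Proof.
have d1 := is_derive_flat 0 t.
have d2 : is_derive t 1 (fun r => flat 0 (1 - r)) (- flat 2 (1 - t)).
  have := @is_derive1_comp _ (flat 0) (fun r => -1 * r + 1) t _ _
    (is_derive_flat 0 (-1 * t + 1)) (is_derive_affine (-1) 1 t).
  rewrite mul0r subr0 mulrN1 mulN1r (addrC _ 1) => h.
  apply: near_eq_is_derive h; near=> r.
  by rewrite /= mulN1r addrC.
have d0 := smooth_step_den_gt0 t.
have d3 := is_deriveV (f := fun r => flat 0 r + flat 0 (1 - r))
  (lt0r_neq0 d0) (is_deriveD d1 d2).
apply: (is_derive_eq (is_deriveM d1 d3)).
rewrite /GRing.scale /= mul0r subr0 /smooth_step'.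
by field; rewrite gt_eqF.
Unshelve. all: by end_near.
Qed.

End smooth_functions.

(** * The scalar equation *)

Section test_functions.
Context {R : realType} (T : R).
Hypothesis T0 : 0 < T.
Implicit Types (f g theta : R -> R) (a b c t : R).
Local Notation cont f := {within `[0, T]%classic, continuous f}.

Lemma contM f g : cont f -> cont g -> cont (fun t => f t * g t).
Proof. by move=> cf cg x; apply: continuousM; [exact: cf|exact: cg]. Qed.

Lemma contD f g : cont f -> cont g -> cont (fun t => f t + g t).
Proof. by move=> cf cg x; apply: continuousD; [exact: cf|exact: cg]. Qed.

Lemma contZ c f : cont f -> cont (fun t => c * f t).
Proof.
by move=> cf; apply: contM => // x; exact: cst_continuous.
Qed.

Lemma contB f g : cont f -> cont g -> cont (fun t => f t - g t).
Proof. by move=> cf cg x; apply: continuousB; [exact: cf|exact: cg]. Qed.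

Lemma cont_derivable f : (forall t, derivable f t 1) -> cont f.
Proof. by move=> df; apply: derivable_within_continuous => t _; exact: df. Qed.

Lemma cont_diffn f : diffn 1 f -> cont f.
Proof. by move=> [f' ff' _]; apply: cont_derivable => t; exact: ex_derive. Qed.

Lemma cont_integrable f : cont f ->
  lebesgue_measure.-integrable `[0, T]%classic (EFin \o f).
Proof. by move=> cf; apply: continuous_compact_integrable => //; exact: segment_compact. Qed.

(** The integral of a continuous function over [[0, T]], locked to keep
    arithmetic tactics from comparing integrands. *)
Definition cint : (R -> R) -> R :=
  locked (fun f => \int[lebesgue_measure]_(t in `[0, T]) f t).

Lemma cintE f : cint f = \int[lebesgue_measure]_(t in `[0, T]) f t.
Proof. by rewrite /cint -lock. Qed.

Lemma cint_oo f : cont f -> \int[lebesgue_measure]_(t in `]0, T[) f t = cint f.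
Proof.
move=> cf; have fi := cont_integrable cf.
rewrite Rintegral_itv_obnd_cbnd ?Rintegral_itv_bndo_bndc ?cintE//.
  by apply: integrableS fi => //; apply: subset_itvl; rewrite bnd_simp.
by apply: integrableS fi => //; exact: subset_itv_oo_cc.
Qed.

Lemma cintD f g : cont f -> cont g -> cint (fun t => f t + g t) = cint f + cint g.
Proof. by move=> cf cg; rewrite !cintE RintegralD//; exact: cont_integrable. Qed.

Lemma cintB f g : cont f -> cont g -> cint (fun t => f t - g t) = cint f - cint g.
Proof. by move=> cf cg; rewrite !cintE RintegralB//; exact: cont_integrable. Qed.

Lemma cintZ c f : cont f -> cint (fun t => c * f t) = c * cint f.
Proof. by move=> cf; rewrite !cintE RintegralZl//; exact: cont_integrable. Qed.

Lemma eq_cint f g : f =1 g -> cint f = cint g.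
Proof. by move=> /funext ->. Qed.

Lemma le_cint f g : cont f -> cont g -> (forall t, 0 <= t <= T -> f t <= g t) ->
  cint f <= cint g.
Proof.
by move=> cf cg fg; rewrite !cintE; apply: le_Rintegral => //; exact: cont_integrable.
Qed.

Lemma cint_derive f f' : (forall t, is_derive t 1 f (f' t)) -> cont f' ->
  cint f' = f T - f 0.
Proof.
move=> ff' cf'; rewrite cintE /Rintegral (continuous_FTC2 (F := f) T0 cf') ?EFinN//.
  have df t : derivable f t 1 by exact: ex_derive.
  have cf : continuous f.
    by move=> t; apply: differentiable_continuous; exact/derivable1_diffP.
  split=> [t _|//|].
  - exact: df.
  - by apply: cvg_at_right_filter; exact: cf.
  - by apply: cvg_at_left_filter; exact: cf.
by move=> t _; rewrite (derive1_of_is_derive ff').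
Qed.

Lemma smooth_of_derivable f : (forall k t, derivable (derive1n k f) t 1) -> smooth f.
Proof.
move=> df k; elim: k f df => [//|k ih] f df.
exists f^`()%classic; last by apply: ih => j t; rewrite -derive1Sn; exact: df.
move=> t; rewrite derive1E; apply: derivableP; exact: (df 0%N).
Qed.

Lemma test_function_derive theta theta' : (forall t, is_derive t 1 theta (theta' t)) ->
  test_function T theta -> test_function T theta'.
Proof.
move=> dtheta [sth [a [b [a0 bT tab]]]].
have theta'E := derive1_of_is_derive dtheta.
split; first by move=> k t; rewrite -theta'E -derive1Sn; exact: sth.
exists a, b; split => // t; apply: contra_neqT.
rewrite negb_and -!ltNge => t_out.
have : is_derive t 1 theta 0.
  apply: near_eq_is_derive (is_derive_cst (0 : R) t 1).
  case/orP: t_out => [ta|bt]; near=> r.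
    have ra : r < a by near: r; exact: lt_nbhsl.
    by apply/esym/eqP/negPn/negP => /tab /andP[ar _]; lra.
  have br : b < r by near: r; exact: lt_nbhsr.
  by apply/esym/eqP/negPn/negP => /tab /andP[_ rb]; lra.
by move=> h; rewrite -theta'E derive1E; exact: derive_val.
Unshelve. all: by end_near.
Qed.

Lemma test_functionM f theta : smooth f -> test_function T theta ->
  test_function T (fun t => f t * theta t).
Proof.
move=> sf [sth [a [b [a0 bT tab]]]]; split.
  apply: smooth_derivable => k; apply: diffnM; first exact: sf.
  exact: smooth_of_derivable.
exists a, b; split => // t; rewrite mulf_eq0 negb_or => /andP[_]; exact: tab.
Qed.

Definition step_at a e t : R := smooth_step (e^-1 * t + - a / e).
Definition step_at' a e t : R := e^-1 * smooth_step' (e^-1 * t + - a / e).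

Lemma is_derive_step_at a e t : is_derive t 1 (step_at a e) (step_at' a e t).
Proof.
have h := @is_derive1_comp _ smooth_step (fun r => e^-1 * r + - a / e) t _ _
  (is_derive_smooth_step _) (is_derive_affine _ _ t).
by apply: (is_derive_eq h); rewrite mulrC.
Qed.

Lemma smooth_step_at a e : smooth (step_at a e).
Proof. by move=> k; apply: diffn_affine; exact: smooth_smooth_step. Qed.

Lemma cont_step_at' a e : cont (step_at' a e).
Proof.
apply: cont_diffn; have [g dg gd] := smooth_step_at a e 2.
rewrite -(derive1_of_is_derive (is_derive_step_at a e)).
by rewrite (derive1_of_is_derive dg).
Qed.

Lemma step_atE a e t : 0 < e -> e^-1 * t + - a / e = (t - a) / e.
Proof. by move=> e0; rewrite mulrC -mulrDl. Qed.

Lemma step_at_eq0 a e t : 0 < e -> t <= a -> step_at a e t = 0.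
Proof.
move=> e0 ta; rewrite /step_at step_atE//; apply: smooth_step0.
by rewrite pmulr_lle0 ?invr_gt0// subr_le0.
Qed.

Lemma step_at_eq1 a e t : 0 < e -> a + e <= t -> step_at a e t = 1.
Proof.
move=> e0 ta; rewrite /step_at step_atE//; apply: smooth_step1.
by rewrite ler_pdivlMr//; lra.
Qed.

Lemma step_at'_ge0 a e t : 0 < e -> 0 <= step_at' a e t.
Proof. by move=> e0; rewrite mulr_ge0 ?invr_ge0 ?(ltW e0)// smooth_step'_ge0. Qed.

Lemma step_at'_eq0 a e t : 0 < e -> ~~ (a <= t <= a + e) -> step_at' a e t = 0.
Proof.
move=> e0 h; rewrite /step_at' step_atE// smooth_step'_eq0 ?mulr0//.
apply: contra h => /andP[]; rewrite pmulr_lge0 ?invr_gt0// ler_pdivrMr// mul1r.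
by move=> ? ?; apply/andP; split; lra.
Qed.

Lemma cint_step_at' a e : 0 < e -> 0 <= a -> a + e <= T -> cint (step_at' a e) = 1.
Proof.
move=> e0 a0 aT; rewrite (cint_derive (is_derive_step_at a e) (@cont_step_at' a e)).
by rewrite step_at_eq1// step_at_eq0// subr0.
Qed.

(** Averages against the derivative of a smooth step from [a] to [a + e], which
    is nonnegative of integral [1]. *)
Lemma bump_mean f a e (c d : R) : cont f -> 0 < e -> 0 <= a -> a + e <= T ->
  (forall t, a <= t <= a + e -> `|f t - c| <= d) ->
  `|cint (fun t => f t * step_at' a e t) - c| <= d.
Proof.
move=> cf e0 a0 aT fc.
have cB := @cont_step_at' a e; have B1 := cint_step_at' e0 a0 aT.
have hz r : cint (fun t => r * step_at' a e t) = r by rewrite cintZ// B1 mulr1.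
have bound t : (c - d) * step_at' a e t <= f t * step_at' a e t <= (c + d) * step_at' a e t.
  have [h|h] := boolP (a <= t <= a + e); last by rewrite step_at'_eq0// !mulr0 lexx.
  have := fc t h; rewrite ler_norml => /andP[h1 h2].
  by rewrite !ler_wpM2r ?step_at'_ge0//; lra.
have cfB := contM cf cB.
rewrite ler_norml; apply/andP; split.
  rewrite lerBrDr addrC -[leLHS]hz; apply: le_cint => //; first exact: contZ.
  by move=> t _; case/andP: (bound t).
rewrite lerBlDr addrC -[leRHS]hz; apply: le_cint => //; first exact: contZ.
by move=> t _; case/andP: (bound t).
Qed.

(** The lemma of du Bois-Reymond: testing against the difference of two smooth
    steps, located near [0] and near [T], compares the mean values of [f] there. *)
Lemma du_bois_reymond f : cont f ->
  (forall theta theta', test_function T theta ->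
     (forall t, is_derive t 1 theta (theta' t)) -> cint (fun t => f t * theta' t) = 0) ->
  f 0 = f T.
Proof.
move=> cf f0.
suff main d : 0 < d -> `|f 0 - f T| <= d + d.
  apply/eqP; rewrite -subr_eq0 -normr_le0; apply/ler_addgt0Pl => e e0.
  have e2 : 0 < e / 2 by rewrite divr_gt0.
  by have := main _ e2; lra.
move=> d0.
have near_pt p : 0 <= p <= T -> exists2 e, 0 < e &
    forall t, 0 <= t <= T -> `|t - p| < e -> `|f t - f p| <= d.
  move=> pT; have /subspace_continuousP /(_ p) := cf.
  rewrite /= in_itv/= => /(_ pT) /cvgrPdist_le /(_ _ d0).
  rewrite near_withinE => /nbhs_ballP[e /= e0 he]; exists e => // t tT tp.
  by rewrite distrC; apply: he; rewrite /ball/= ?in_itv// distrC.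
have [e1 e10 h1] := near_pt 0 ltac:(rewrite lexx ltW//).
have [e2 e20 h2] := near_pt T ltac:(rewrite lexx ltW//).
(* Room for two steps of width [e], on [[e, 2 * e]] and [[T - 2 * e, T - e]]. *)
pose e := Num.min T (Num.min e1 e2) / 4.
have e0 : 0 < e by rewrite divr_gt0// !lt_min T0 e10.
have eT : 4 * e <= T by rewrite mulrC divfK// ge_min lexx.
have ee1 : 4 * e <= e1 by rewrite mulrC divfK// !ge_min lexx orbT.
have ee2 : 4 * e <= e2 by rewrite mulrC divfK// !ge_min lexx !orbT.
clearbody e.
have m1 : `|cint (fun t => f t * step_at' e e t) - f 0| <= d.
  apply: bump_mean => //; [lra|lra|move=> t /andP[t1 t2]].
  by apply: h1; [apply/andP; split; lra|rewrite subr0 ger0_norm; lra].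
have m2 : `|cint (fun t => f t * step_at' (T - 2 * e) e t) - f T| <= d.
  apply: bump_mean => //; [lra|lra|move=> t /andP[t1 t2]].
  by apply: h2; [apply/andP; split; lra|rewrite ler0_norm; lra].
pose theta t := step_at e e t - step_at (T - 2 * e) e t.
pose theta' t := step_at' e e t - step_at' (T - 2 * e) e t.
have dtheta t : is_derive t 1 theta (theta' t).
  by apply: is_deriveB; exact: is_derive_step_at.
have tth : test_function T theta.
  split; first by apply: smooth_derivable => k; apply: diffnB; exact: smooth_step_at.
  exists e, (T - e); split; [by []|lra|move=> t].
  apply: contra_neqT; rewrite negb_and -!ltNge /theta => /orP[te|Tt].
    by rewrite !step_at_eq0 ?subrr//; lra.
  by rewrite !step_at_eq1 ?subrr//; lra.
have := f0 _ _ tth dtheta.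
rewrite (eq_cint (g := fun t => f t * step_at' e e t - f t * step_at' (T - 2 * e) e t)).
  rewrite cintB; try by apply: contM => //; exact: cont_step_at'.
  move: m1 m2; rewrite !ler_norml.
  move: (cint _) (cint _) => r1 r2 /andP[? ?] /andP[? ?] ?.
  by apply/andP; split; lra.
by move=> t; rewrite mulrBr.
Qed.

Lemma smooth_cosh_affine (lam : R) : smooth (fun t => cosh (lam * (T - t))).
Proof.
move=> k; apply: (@eq_diffn _ k (fun t => 2^-1 * (expR (- lam * t + lam * T) + expR (lam * t + - lam * T)))).
  by move=> t; rewrite /cosh mulrC; congr ((expR _ + expR _) / 2); ring.
by apply/diffnZ/diffnD; apply: diffn_affine; exact: diffn_expR.
Qed.

Lemma is_derive_expR_affine (a b t : R) :
  is_derive t 1 (fun r => expR (a * r + b)) (expR (a * t + b) * a).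
Proof.
exact: (@is_derive1_comp _ expR (fun r => a * r + b) t _ _ (is_derive_expR _) (is_derive_affine a b t)).
Qed.

Lemma is_derive_cosh_affine (lam t : R) :
  is_derive t 1 (fun t => cosh (lam * (T - t))) (- lam * sinh (lam * (T - t))).
Proof.
have h1 := is_derive_expR_affine (- lam) (lam * T) t.
have h2 := is_derive_expR_affine lam (- lam * T) t.
have h : is_derive t 1 (fun r => 2^-1 * (expR (- lam * r + lam * T) + expR (lam * r + - lam * T)))
    (2^-1 * (expR (- lam * t + lam * T) * - lam + expR (lam * t + - lam * T) * lam)).
  have := is_deriveM (is_derive_cst (2^-1 : R) t 1) (is_deriveD h1 h2).
  by move=> h; apply: (is_derive_eq h); rewrite scaler0 addr0.
rewrite (_ : (fun t => cosh _) = (fun r => 2^-1 * (expR (- lam * r + lam * T) + expR (lam * r + - lam * T)))).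
  apply: (is_derive_eq h); rewrite /sinh.
  rewrite (_ : - lam * t + lam * T = lam * (T - t)); last by ring.
  rewrite (_ : lam * t + - lam * T = - (lam * (T - t))); last by ring.
  by field.
apply/funext => r; rewrite /cosh [RHS]mulrC; congr ((expR _ + expR _) * _); ring.
Qed.

Lemma is_derive_sinh_affine (lam t : R) :
  is_derive t 1 (fun t => sinh (lam * (T - t))) (- lam * cosh (lam * (T - t))).
Proof.
have h1 := is_derive_expR_affine (- lam) (lam * T) t.
have h2 := is_derive_expR_affine lam (- lam * T) t.
have h : is_derive t 1 (fun r => 2^-1 * (expR (- lam * r + lam * T) - expR (lam * r + - lam * T)))
    (2^-1 * (expR (- lam * t + lam * T) * - lam - expR (lam * t + - lam * T) * lam)).
  have := is_deriveM (is_derive_cst (2^-1 : R) t 1) (is_deriveB h1 h2).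
  by move=> h; apply: (is_derive_eq h); rewrite scaler0 addr0.
rewrite (_ : (fun t => sinh _) = (fun r => 2^-1 * (expR (- lam * r + lam * T) - expR (lam * r + - lam * T)))).
  apply: (is_derive_eq h); rewrite /cosh.
  rewrite (_ : - lam * t + lam * T = lam * (T - t)); last by ring.
  rewrite (_ : lam * t + - lam * T = - (lam * (T - t))); last by ring.
  by field.
apply/funext => r; rewrite /sinh [RHS]mulrC; congr ((expR _ - expR _) * _); ring.
Qed.

Lemma is_deriveM_val f g (f' g' : R) t : is_derive t 1 f f' -> is_derive t 1 g g' ->
  is_derive t 1 (fun r => f r * g r) (f' * g t + f t * g').
Proof.
move=> df dg; have h := is_deriveM df dg; apply: (is_derive_eq h).
by rewrite /GRing.scale /= addrC (mulrC f').
Qed.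

(** The scalar equation [c'' = lam^2 c], with [p = c'], both in the sense of
    distributions. The function [p C + lam c S], where [C] and [S] are
    [cosh (lam (T - t))] and [sinh (lam (T - t))], has derivative zero: its
    pairing with [theta'] is computed by testing the first equation with
    [C theta'] and the second one with [C theta]. *)
Lemma scalar_elliptic_ode (c p : R -> R) (lam : R) : cont c -> cont p ->
  (forall theta theta', test_function T theta ->
     (forall t, is_derive t 1 theta (theta' t)) ->
     cint (fun t => p t * theta t) = - cint (fun t => c t * theta' t)) ->
  (forall theta theta' theta'', test_function T theta ->
     (forall t, is_derive t 1 theta (theta' t)) ->
     (forall t, is_derive t 1 theta' (theta'' t)) ->
     cint (fun t => c t * theta'' t) = lam ^+ 2 * cint (fun t => c t * theta t)) ->
  p T = p 0 * cosh (lam * T) + lam * c 0 * sinh (lam * T).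
Proof.
move=> cc cp eqp eqc.
pose C t := cosh (lam * (T - t)); pose S t := sinh (lam * (T - t)).
have dC t : is_derive t 1 C (- lam * S t) by exact: is_derive_cosh_affine.
have dS t : is_derive t 1 S (- lam * C t) by exact: is_derive_sinh_affine.
have contC : cont C by apply: cont_derivable => t; exact: ex_derive.
have contS : cont S by apply: cont_derivable => t; exact: ex_derive.
have : p 0 * C 0 + lam * (c 0 * S 0) = p T * C T + lam * (c T * S T).
  apply: (@du_bois_reymond (fun t => p t * C t + lam * (c t * S t))).
    by apply: contD; [exact: contM|apply/contZ/contM].
  move=> theta theta' tth dth.
  have tth' := test_function_derive dth tth.
  have sth' := smooth_of_derivable tth'.1.
  have [theta'' dth' th''1] := sth' 2.
  have cth : cont theta by apply: cont_derivable => t; exact: ex_derive.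
  have cth' : cont theta' by apply: cont_derivable => t; exact: ex_derive.
  have cth'' : cont theta'' by exact: cont_diffn.
  have tC := test_functionM (smooth_cosh_affine lam) tth.
  have tC' := test_functionM (smooth_cosh_affine lam) tth'.
  have d1 t : is_derive t 1 (fun r => C r * theta' r) (- lam * S t * theta' t + C t * theta'' t).
    exact: is_deriveM_val.
  have d2 t : is_derive t 1 (fun r => C r * theta r) (- lam * S t * theta t + C t * theta' t).
    exact: is_deriveM_val.
  have d3 t : is_derive t 1 (fun r => - lam * S r * theta r + C r * theta' r)
     (lam ^+ 2 * (C t * theta t) - 2 * lam * (S t * theta' t) + C t * theta'' t).
    have h1 : is_derive t 1 (fun r => - lam * S r) (lam ^+ 2 * C t).
      have h := is_deriveM_val (is_derive_cst (- lam) t 1) (dS t).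
      by apply: (is_derive_eq h); rewrite /=; ring.
    have h := is_deriveD (is_deriveM_val h1 (dth t)) (d1 t).
    by apply: (is_derive_eq h); ring.
  have e1 := eqp _ _ tC' d1; have e2 := eqc _ _ _ tC d2 d3.
  have k1 : cont (fun t => c t * (S t * theta' t)) by apply/contM/contM.
  have k2 : cont (fun t => c t * (C t * theta'' t)) by apply/contM/contM.
  have k3 : cont (fun t => c t * (C t * theta t)) by apply/contM/contM.
  have k4 : cont (fun t => p t * (C t * theta' t)) by apply/contM/contM.
  rewrite (eq_cint (g := fun t => p t * (C t * theta' t) + lam * (c t * (S t * theta' t)))); last first.
    by move=> t; ring.
  rewrite cintD//; last exact: contZ.
  rewrite cintZ// e1.
  rewrite (eq_cint (g := fun t => - lam * (c t * (S t * theta' t)) + c t * (C t * theta'' t))); last first.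
    by move=> t; ring.
  rewrite cintD//; last exact: contZ.
  rewrite cintZ//.
  move: e2; rewrite (eq_cint (g := fun t => lam ^+ 2 * (c t * (C t * theta t))
     - 2 * lam * (c t * (S t * theta' t)) + c t * (C t * theta'' t))); last first.
    by move=> t; ring.
  rewrite cintD//; last by apply: contB; exact: contZ.
  rewrite cintB; [|exact: contZ|exact: contZ].
  rewrite !cintZ// /C.
  move: (cint _) (cint _) (cint _) => r1 r2 r3; lra.
rewrite /C /S subrr subr0 mulr0.
have -> : cosh 0 = 1 :> R by rewrite /cosh oppr0 expR0 -mulr2n divff.
have -> : sinh 0 = 0 :> R by rewrite /sinh oppr0 subrr mul0r.
by rewrite !mulr0 addr0 mulr1 mulrA => ->.
Qed.

End test_functions.

(** * Hyperbolic functions and traces *)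

Section hyperbolic_functions.
Context {R : realType}.
Implicit Types (t l : R).

Lemma cosh_gt0 t : 0 < cosh t :> R.
Proof. by rewrite divr_gt0// addr_gt0// expR_gt0. Qed.

Lemma cosh_sqr t : cosh t ^+ 2 = 1 + sinh t ^+ 2.
Proof.
rewrite /cosh /sinh; have h := expRxMexpNx_1 t.
move: (expR t) (expR (- t)) h => a b ab.
have -> : ((a + b) / 2) ^+ 2 = a * b + ((a - b) / 2) ^+ 2 by field.
by rewrite ab.
Qed.

Lemma cosh_ge1 t : 1 <= cosh t.
Proof.
rewrite -(ler_pXn2r (ltn0Sn 1)) ?nnegrE ?(ltW (cosh_gt0 t))//.
by rewrite expr1n cosh_sqr lerDl sqr_ge0.
Qed.

Lemma cosh_le_expR t l : `|t| <= l -> cosh t <= expR l.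
Proof.
rewrite ler_norml => /andP[t1 t2]; rewrite /cosh ler_pdivrMr//.
have h1 : expR t <= expR l by rewrite ler_expR.
have h2 : expR (- t) <= expR l by rewrite ler_expR; lra.
lra.
Qed.

Lemma tanh_sqr t : tanh t ^+ 2 = 1 - (cosh t ^+ 2)^-1.
Proof.
have c0 := lt0r_neq0 (cosh_gt0 t).
rewrite /tanh expr_div_n (_ : sinh t ^+ 2 = cosh t ^+ 2 - 1); last first.
  by rewrite cosh_sqr addrC addKr.
by rewrite mulrBl mul1r divff// sqrf_eq0.
Qed.

Lemma normr_tanh_sqr_le1 t : `|tanh t ^+ 2| <= 1.
Proof.
by rewrite ger0_norm ?sqr_ge0// tanh_sqr lerBlDr lerDl invr_ge0 sqr_ge0.
Qed.

Lemma normr_sech_le1 t : `|(cosh t)^-1| <= 1.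
Proof.
have := cosh_gt0 t => c0; rewrite ger0_norm ?invr_ge0 ?(ltW c0)//.
by rewrite invf_le1// cosh_ge1.
Qed.

Lemma normr_sinh_sech_sqr_le1 t : `|sinh t / cosh t ^+ 2| <= 1.
Proof.
have c0 := cosh_gt0 t; have c20 : 0 < cosh t ^+ 2 by rewrite exprn_gt0.
rewrite normrM (ger0_norm (_ : 0 <= (cosh t ^+ 2)^-1)) ?invr_ge0 ?(ltW c20)//.
rewrite ler_pdivrMr// mul1r cosh_sqr.
have := sqr_ge0 (`|sinh t| - 1); rewrite sqrrB1 real_normK ?num_real//.
by have := sqr_ge0 (sinh t); have := normr_ge0 (sinh t); lra.
Qed.

Lemma diffn_measurable f : diffn 1 f -> measurable_fun setT (f : measurableTypeR R -> R).
Proof.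
move=> [f' ff' _]; apply: continuous_measurable_fun => t.
apply: differentiable_continuous; apply/derivable1_diffP; exact: ex_derive.
Qed.

Lemma diffn_cosh k T : diffn k (fun l : R => cosh (l * T)).
Proof.
apply: (@eq_diffn _ k (fun l => 2^-1 * (expR (T * l + 0) + expR (- T * l + 0)))).
  by move=> l; rewrite /cosh mulrC !addr0 mulNr (mulrC T).
by apply/diffnZ/diffnD; apply: diffn_affine; exact: diffn_expR.
Qed.

Lemma diffn_sinh k T : diffn k (fun l : R => sinh (l * T)).
Proof.
apply: (@eq_diffn _ k (fun l => 2^-1 * (expR (T * l + 0) - expR (- T * l + 0)))).
  by move=> l; rewrite /sinh mulrC !addr0 mulNr (mulrC T).
by apply/diffnZ/diffnB; apply: diffn_affine; exact: diffn_expR.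
Qed.

Lemma diffn_sech k T : diffn k (fun l : R => (cosh (l * T))^-1).
Proof.
by apply: diffnV; [move=> l; rewrite gt_eqF// cosh_gt0|exact: diffn_cosh].
Qed.

Lemma measurable_tanh_sqr T :
  measurable_fun setT (fun l : measurableTypeR R => tanh (l * T) ^+ 2).
Proof.
apply: diffn_measurable.
apply: (@eq_diffn _ _ (fun l => (sinh (l * T) * (cosh (l * T))^-1) * (sinh (l * T) * (cosh (l * T))^-1))) => //.
by apply: diffnM; apply: diffnM; [exact: diffn_sinh|exact: diffn_sech|exact: diffn_sinh|exact: diffn_sech].
Qed.

Lemma measurable_sech T :
  measurable_fun setT (fun l : measurableTypeR R => (cosh (l * T))^-1).
Proof. exact: diffn_measurable (diffn_sech 1 T). Qed.

Lemma measurable_sinh_sech_sqr T :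
  measurable_fun setT (fun l : measurableTypeR R => sinh (l * T) / cosh (l * T) ^+ 2).
Proof.
apply: diffn_measurable.
apply: (@eq_diffn _ _ (fun l => (sinh (l * T) * (cosh (l * T))^-1) * (cosh (l * T))^-1)).
  by move=> l; rewrite -mulrA -invfM -expr2.
by apply: diffnM (diffn_sech _ _); apply: diffnM; [exact: diffn_sinh|exact: diffn_sech].
Qed.

End hyperbolic_functions.

Section traces.
Context (R : realType) (H : innerProductType R) (E : resolution H) (T : R).
Hypotheses (Eneg : forall l x, l < 0 -> E l x = 0) (T0 : 0 < T).
Local Notation mu := (@lebesgue_measure R).
Implicit Types (u v : R -> H) (psi : H).

Lemma simple_fun_measurable_ip v psi : simple_fun (`]0, T[ : set (measurableTypeR R)) v ->
  measurable_fun (`]0, T[ : set (measurableTypeR R)) (fun t => ip (v t) psi : R).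
Proof.
move=> [vfin vm] mD Y mY.
set D := (X in X `&` _).
have -> : D `&` (fun t => ip (v t) psi : R) @^-1` Y =
    \bigcup_(y in (v @` D) `&` [set y | Y (ip y psi)]) (D `&` v @^-1` [set y]).
  apply/seteqP; split => [t [Dt Yt]|t [y [_ /= Yy] [Dt vt]]].
    by exists (v t) => //; split => //; exists t.
  by split => //=; rewrite vt.
apply: fin_bigcup_measurable; first exact: finite_setIl.
by move=> y _; exact: vm.
Qed.

Lemma strongly_measurable_ip (s : R) u psi : 0 <= s -> strongly_measurable E T s u ->
  measurable_fun (`]0, T[ : set (measurableTypeR R)) (fun t => ip (u t) psi : R).
Proof.
move=> s0 [v_ [v_simple v_u]].
apply: (@measurable_fun_cvg _ _ _ _ (fun k t => ip (v_ k t) psi)).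
  by move=> k; apply: simple_fun_measurable_ip; exact: (v_simple k).1.
move=> t Dt; have [us cvu] := v_u t Dt.
apply/cvgrPdist_le => e e0.
have p1 : 0 < hnorm psi + 1 by rewrite ltr_wpDl// hnorm_ge0.
have /cvgrPdist_le /(_ _ (divr_gt0 e0 p1)) := cvu.
apply: filterS => k; rewrite sub0r normrN -sobnE ger0_norm ?sobn_ge0// => h.
have vs := (v_simple k).2 t Dt.
rewrite distrC -ipBl; apply: le_trans (ip_le_hnorm _ _) _.
have h2 := hnorm_le_sobn Eneg s0 (SobB Eneg vs us).
rewrite -[leRHS](divfK (lt0r_neq0 p1)).
by apply: ler_pM; rewrite ?hnorm_ge0// ?lerDl//; exact: le_trans h2 h.
Qed.

Lemma continuous_Sob_ip (s : R) v psi : 0 <= s -> continuous_Sob E T s v ->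
  {within `[0, T]%classic, continuous (fun t => ip (v t) psi : R)}.
Proof.
move=> s0 cv; apply/subspace_continuousP => t tT.
have [vt cvt] := cv t tT.
apply/cvgrPdist_le => e e0.
have p1 : 0 < hnorm psi + 1 by rewrite ltr_wpDl// hnorm_ge0.
have /cvgrPdist_le /(_ _ (divr_gt0 e0 p1)) := cvt.
rewrite !near_withinE; apply: filterS => r hr rT.
have := hr rT; rewrite sub0r normrN -sobnE ger0_norm ?sobn_ge0// => h.
have [vr _] := cv r rT.
rewrite distrC -ipBl; apply: le_trans (ip_le_hnorm _ _) _.
have h2 := hnorm_le_sobn Eneg s0 (SobB Eneg vr vt).
rewrite -[leRHS](divfK (lt0r_neq0 p1)).
by apply: ler_pM; rewrite ?hnorm_ge0// ?lerDl//; exact: le_trans h2 h.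
Qed.

Lemma continuous_dual_app (s : R) (P : R -> H -> R) psi : continuous_dual E T s P ->
  Sob E s psi -> {within `[0, T]%classic, continuous (fun t => P t psi)}.
Proof.
move=> cP psis; apply/subspace_continuousP => t tT.
have [Pt cPt] := cP t tT.
apply/cvgrPdist_le => e e0.
have p1 : 0 < sobn E s psi + 1 by rewrite ltr_wpDl// sobn_ge0.
have /cvgrPdist_le /(_ _ (divr_gt0 e0 p1)) := cPt.
rewrite !near_withinE; apply: filterS => r hr rT.
have [Pr _] := cP r rT; have PB := Sob_dualB Pr Pt.
have := hr rT; rewrite sub0r normrN ger0_norm ?(dual_norm_ge0 Eneg PB)// => h.
rewrite distrC; apply: le_trans (le_dual_norm Eneg PB psis) _.
rewrite -[leRHS](divfK (lt0r_neq0 p1)).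
by apply: ler_pM; rewrite ?sobn_ge0 ?(dual_norm_ge0 Eneg PB)// lerDl.
Qed.

(** In the weak formulation the continuous representative [v] may replace [u];
    the measurability of the pairing with [u] has to be known beforehand, since
    the Borel sigma-algebra is not complete. *)
Lemma Rintegral_ae_ip u v psi theta :
  measurable_fun (`]0, T[ : set (measurableTypeR R)) (fun t => ip (u t) psi : R) ->
  {within `[0, T]%classic, continuous (fun t => ip (v t) psi : R)} ->
  {within `[0, T]%classic, continuous theta} ->
  {ae mu, forall t, t \in `]0, T[ -> v t = u t} ->
  \int[mu]_(t in `]0, T[) (ip (u t) psi * theta t) =
  cint T (fun t => ip (v t) psi * theta t).
Proof.
move=> mu_ cv cth vu; rewrite -(cint_oo (contM cv cth)).
have sub : `]0, T[ `<=` `[0, T]%classic by exact: subset_itv_oo_cc.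
have mcont (h : R -> R) : {within `[0, T]%classic, continuous h} ->
    measurable_fun (`]0, T[ : set (measurableTypeR R)) h.
  move=> ch; have /cont_integrable /integrableP[mh _] := ch.
  by apply: (measurable_funS _ sub) => //; exact/measurable_EFinP.
congr fine; apply: ae_eq_integral => //.
- by apply/measurable_EFinP/measurable_funM => //; exact: mcont.
- by apply/measurable_EFinP; exact: mcont (contM cv cth).
- have [N [mN N0 vuN]] := vu; exists N; split => //.
  by apply: subset_trans vuN; apply: subsetC => t /= vut Dt; rewrite vut.
Qed.

(** Pairing the equation with an eigenvector gives the scalar equation
    [c'' = lam^2 c]. *)
Lemma trace_dt_eigen u f g v P lam psi :
  Ve E T u -> continuous_Sob E T 2^-1 v ->
  {ae mu, forall t, t \in `]0, T[ -> v t = u t} -> v 0 = f ->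
  continuous_dual E T 2^-1 P -> is_dt E T u P ->
  (forall psi, Sob E 2^-1 psi -> P 0 psi = g psi) ->
  sp_eigen E lam psi ->
  P T psi = g psi * cosh (lam * T) + lam * ip f psi * sinh (lam * T).
Proof.
move=> [[um _] ell] cv vu <- cP dP P0 psilam.
have h0 : 0 <= 2^-1 :> R by rewrite invr_ge0.
have psis s : Sob E s psi by exact: (Sob_eigen Eneg s psilam).
have cc := continuous_Sob_ip (psi := psi) h0 cv.
have cp := continuous_dual_app cP (psis 2^-1).
have mu1 : measurable_fun (`]0, T[ : set (measurableTypeR R)) (fun t => ip (u t) psi : R).
  by apply: strongly_measurable_ip um; exact: ler01.
rewrite -(P0 _ (psis _)).
apply: (scalar_elliptic_ode T0 cc cp) => [theta theta' tth dth|theta theta' theta'' tth dth dth'].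
  have tth' := test_function_derive dth tth.
  have cth : {within `[0, T]%classic, continuous theta}.
    by apply: cont_derivable => t; exact: (tth.1 0%N).
  have cth' : {within `[0, T]%classic, continuous theta'}.
    by apply: cont_derivable => t; exact: (tth'.1 0%N).
  have := dP theta psi tth (psis _).
  rewrite (derive1nE1 dth) (Rintegral_ae_ip mu1 cc cth' vu).
  by rewrite (cint_oo (contM cp cth)).
have tth' := test_function_derive dth tth.
have tth'' := test_function_derive dth' tth'.
have cth : {within `[0, T]%classic, continuous theta}.
  by apply: cont_derivable => t; exact: (tth.1 0%N).
have cth'' : {within `[0, T]%classic, continuous theta''}.
  by apply: cont_derivable => t; exact: (tth''.1 0%N).
have := ell theta psi tth (psis _).
rewrite derive1Sn -derive1n1 (derive1nE1 dth) (derive1nE1 dth').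
rewrite (Rintegral_ae_ip mu1 cc cth'' vu) => ->.
transitivity (\int[mu]_(t in `]0, T[) (ip (u t) psi * (lam ^+ 2 * theta t))).
  apply: eq_Rintegral => t; rewrite inE => Dt; rewrite /fext.
  have [v_ [_ /(_ t Dt)[/(SobE Eneg) us _]]] := um.
  have us2 : sp_integrable E (fun l => l ^+ 2) (u t).
    apply: sp_integrable_dominated us; first exact: measurable_funX.
    by move=> l; rewrite /sob_weight powRr1 ?addr_ge0 ?sqr_ge0// ger0_norm ?sqr_ge0// lerDr.
  by rewrite (sp_int_eigen psilam us2) mulrAC mulrC.
rewrite (Rintegral_ae_ip mu1 cc (contZ (c := lam ^+ 2) cth) vu).
rewrite (eq_cint _ (g := fun t => lam ^+ 2 * (ip (v t) psi * theta t))).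
  by rewrite cintZ//; exact: contM.
by move=> t; rewrite mulrCA.
Qed.

End traces.

(** * The iteration *)

Section iteration.
Context (R : realType) (H : innerProductType R) (Hc : hilbert H).
Variables (E : resolution H) (s : R).
Hypothesis Eneg : forall l x, l < 0 -> E l x = 0.
Implicit Types (x y psi : H) (l : H -> R) (h : measurableTypeR R -> R).

Lemma Sob_dualD l1 l2 : Sob_dual E s l1 -> Sob_dual E s l2 -> Sob_dual E s (l1 + l2).
Proof.
move=> d1 d2; have d0 : Sob_dual E s (0 : H -> R).
  split=> [a x y _ _|]; first by rewrite mulr0 addr0.
  by exists 0 => x _; rewrite normr0 mul0r.
have := Sob_dualB d1 (Sob_dualB d0 d2).
by rewrite sub0r opprK.
Qed.

Lemma Sob_spfun h (M : R) x : measurable_fun setT h -> (forall r, `|h r| <= M) ->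
  Sob E s x -> Sob E s (spfun E h x).
Proof.
move=> mh hM /(SobE Eneg) xs; apply/(SobE Eneg).
exact: (spfun_bounded_energy Hc mh hM (sob_weight_ge0 s) xs).1.
Qed.

Lemma sobn_spfun_le h (M : R) x : measurable_fun setT h -> (forall r, `|h r| <= M) ->
  Sob E s x -> sobn E s (spfun E h x) <= M * sobn E s x.
Proof.
move=> mh hM /(SobE Eneg) xs; apply: (sobn_le Eneg).
  by apply: le_trans (hM 0).
exact: (spfun_bounded_energy Hc mh hM (sob_weight_ge0 s) xs).2.
Qed.

Lemma sobn_spfun_band_le h (M C a b : R) x : a <= b -> measurable_fun setT h ->
  (forall r, `|h r| <= M) -> 0 <= C -> (forall r, a < r <= b -> `|h r| <= C) ->
  bandlimited E a b x -> Sob E s x -> sobn E s (spfun E h x) <= C * sobn E s x.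
Proof.
move=> ab mh hM C0 hC xab /(SobE Eneg) xs; apply: (sobn_le Eneg) => //.
exact: (spfun_band_energy Hc ab mh hM C0 hC xab (sob_weight_ge0 s) xs).
Qed.

Lemma Sob_dual_spfun h (M : R) l : measurable_fun setT h -> (forall r, `|h r| <= M) ->
  Sob_dual E s l -> Sob_dual E s (fun x => l (spfun E h x)).
Proof.
move=> mh hM ld; have M0 : 0 <= M by apply: le_trans (hM 0).
split.
  move=> a x y xs ys; rewrite (spfun_lin E Hc mh hM).
  have hx := Sob_spfun mh hM xs; have hy := Sob_spfun mh hM ys.
  rewrite (Sob_dual_addr ld (SobZ Eneg a hx) hy).
  by rewrite (Sob_dualZ Eneg a ld hx).
exists (dual_norm E s l * M) => x xs; have hx := Sob_spfun mh hM xs.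
apply: le_trans (le_dual_norm Eneg ld hx) _; rewrite -sobnE -mulrA.
by apply: ler_wpM2l (sobn_spfun_le mh hM xs); exact: (dual_norm_ge0 Eneg ld).
Qed.

Lemma Sob_dual_iter_spfun h (M : R) l k : measurable_fun setT h ->
  (forall r, `|h r| <= M) -> Sob_dual E s l ->
  Sob_dual E s (fun x => l (iter k (spfun E h) x)).
Proof.
move=> mh hM; elim: k l => [//|k ih] l ld.
by apply: ih (fun x => l (spfun E h x)) _; exact: Sob_dual_spfun ld.
Qed.

(** The powers of a contraction [h(A)] with [|h| < 1] on every bounded set tend to
    [0] in the dual norm on each functional: the part of the functional beyond
    the range of [E N] is uniformly small, and on that range the powers decay
    geometrically. *)
Lemma cvg_dual_iter_spfun h l : measurable_fun setT h -> (forall r, `|h r| <= 1) ->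
  (forall N : nat, exists2 q, 0 <= q < 1 & forall r, -1 < r <= N%:R -> `|h r| <= q) ->
  Sob_dual E s l ->
  dual_norm E s (fun x => l (iter k (spfun E h) x)) @[k --> \oo] --> 0.
Proof.
move=> mh h1 hN ld; apply/cvgrPdist_le => e e0.
have e2 : 0 < e / 2 by rewrite divr_gt0.
have [N tail] := Sob_dual_tail Eneg ld e2.
have [q /andP[q0 q1] hq] := hN N.
pose D := dual_norm E s l; have D0 : 0 <= D by exact: (dual_norm_ge0 Eneg ld).
have qcvg : D * q ^+ k @[k --> \oo] --> (0 : R).
  rewrite -[X in _ --> X](mulr0 D); apply: cvgM; first exact: cvg_cst.
  by apply: cvg_expr; rewrite ger0_norm.
have /cvgrPdist_le /(_ _ e2) := qcvg; apply: filterS => k.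
rewrite !sub0r !normrN (ger0_norm (mulr_ge0 D0 (exprn_ge0 k q0))) => Dq.
have dk := Sob_dual_iter_spfun k mh h1 ld.
rewrite (ger0_norm (dual_norm_ge0 Eneg dk)).
apply: (dual_norm_le Eneg (ltW e0)) => x xs.
pose Mk := iter k (spfun E h).
have Mk_le y : Sob E s y -> Sob E s (Mk y) /\ sobn E s (Mk y) <= sobn E s y.
  move=> ys; rewrite /Mk; elim: k {dk Dq Mk} => [|k [ih1 ih2]]; first by split.
  split; first exact: (Sob_spfun mh h1 ih1).
  by apply: le_trans (sobn_spfun_le mh h1 ih1) _; rewrite mul1r.
have N1 : -1 <= N%:R :> R by apply: (@le_trans _ _ 0) => //; rewrite lerN10.
have Mk_res y : E N%:R (Mk y) = Mk (E N%:R y).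
  rewrite /Mk; elim: k {dk Dq Mk Mk_le} => [//|k ih].
  by rewrite !iterS (res_spfun E Hc mh h1) ih.
have Mk_band y : Sob E s y -> bandlimited E (-1) N%:R y ->
    sobn E s (Mk y) <= q ^+ k * sobn E s y.
  move=> ys yN; rewrite /Mk.
  suff : [/\ Sob E s (iter k (spfun E h) y), bandlimited E (-1) N%:R (iter k (spfun E h) y)
    & sobn E s (iter k (spfun E h) y) <= q ^+ k * sobn E s y] by case.
  elim: k {dk Dq Mk Mk_le Mk_res} => [|k [ih1 ih2 ih3]]; first by split; rewrite ?expr0 ?mul1r.
  rewrite !iterS; split; first exact: (Sob_spfun mh h1 ih1).
    exact: (bandlimited_spfun Hc mh h1 ih2).
  apply: le_trans (sobn_spfun_band_le N1 mh h1 q0 hq ih2 ih1) _.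
  by rewrite exprS -mulrA ler_wpM2l.
have [Mxs Mx] := Mk_le x xs.
have ENs := Sob_res Eneg N%:R Mxs.
rewrite -/(Mk x) -[Mk x](subrK (E N%:R (Mk x))).
rewrite (Sob_dual_addr ld (SobB Eneg Mxs ENs) ENs).
apply: le_trans (ler_normD _ _) _.
rewrite [e](splitr e) mulrDl; apply: lerD.
  by apply: le_trans (tail _ Mxs) _; rewrite ler_wpM2l// ltW.
apply: le_trans (le_dual_norm Eneg ld ENs) _; rewrite Mk_res -/D.
have bN : bandlimited E (-1) N%:R (E N%:R x).
  split; last by rewrite res_mul minxx.
  by rewrite Eneg// ltrN10.
have h2 := Mk_band _ (Sob_res Eneg N%:R xs) bN.
apply: le_trans (ler_wpM2l D0 h2) _; rewrite mulrA.
apply: ler_pM => //; first exact: mulr_ge0 D0 (exprn_ge0 k q0).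
  exact: sobn_ge0.
exact: (sobn_res_le Eneg).
Qed.

End iteration.

Section kozlov_mazya_iteration.
Context (R : realType) (H : innerProductType R) (Hc : hilbert H).
Variables (E : resolution H) (T : R).
Hypothesis (Eneg : forall l x, l < 0 -> E l x = 0) (T0 : 0 < T).
(* The resolution is purely atomic, as for an operator with discrete spectrum. *)
Hypothesis Eatomic : forall b x, exists u : seq (R * H),
  (forall p, p \in u -> sp_eigen E p.1 p.2) /\ E b x = \sum_(p <- u) p.2.
Implicit Types (x y psi : H) (l phi g : H -> R).

Let m r : R := tanh (r * T) ^+ 2.
Let hf r : R := sinh (r * T) / cosh (r * T) ^+ 2.
Let hg r : R := (cosh (r * T))^-1.

Let mm : measurable_fun setT (m : measurableTypeR R -> R).
Proof. exact: measurable_tanh_sqr. Qed.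
Let m1 r : `|m r| <= 1. Proof. exact: normr_tanh_sqr_le1. Qed.
Let mhf : measurable_fun setT (hf : measurableTypeR R -> R).
Proof. exact: measurable_sinh_sech_sqr. Qed.
Let hf1 r : `|hf r| <= 1. Proof. exact: normr_sinh_sech_sqr_le1. Qed.
Let mhg : measurable_fun setT (hg : measurableTypeR R -> R).
Proof. exact: measurable_sech. Qed.
Let hg1 r : `|hg r| <= 1. Proof. exact: normr_sech_le1. Qed.

Lemma TeE f g phi psi : Te E T f g phi psi =
  phi (spfun E m psi) + sp_int E id f (spfun E hf psi) + g (spfun E hg psi).
Proof. by rewrite !spfun.unlock. Qed.

(** The identity is dominated by the weight [(1 + l ^+ 2) `^ 2^-1]. *)
Lemma sob_half_integrable_id f : Sob E 2^-1 f -> sp_integrable E id f.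
Proof.
move=> /(SobE Eneg) fs; apply: (sp_integrable_dominated _ _ fs); first exact: measurable_id.
exact: normr_le_sob_weight.
Qed.

Lemma Sob_dual_form f : Sob E 2^-1 f -> Sob_dual E 2^-1 (sp_int E id f).
Proof.
move=> fs; have fi := sob_half_integrable_id fs; split.
  move=> a x y xs ys.
  exact: sp_int_linr fi (sob_half_integrable_id xs) (sob_half_integrable_id ys).
exists (sobn E 2^-1 f) => x xs; rewrite -sobnE.
rewrite -(ler_pXn2r (ltn0Sn 1)) ?nnegrE ?mulr_ge0 ?sobn_ge0//.
rewrite real_normK ?num_real// [leRHS]exprMn !(sqr_sobn Eneg).
apply: sp_int_sqr_le => //; first exact: normr_le_sob_weight.
  exact/(SobE Eneg).
exact/(SobE Eneg).
Qed.

Lemma Te_Sob_dual f g phi : Sob E 2^-1 f -> Sob_dual E 2^-1 g -> Sob_dual E 2^-1 phi ->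
  Sob_dual E 2^-1 (Te E T f g phi).
Proof.
move=> fs gd phid.
have d := Sob_dualD (Sob_dualD (Sob_dual_spfun Hc Eneg mm m1 phid)
  (Sob_dual_spfun Hc Eneg mhf hf1 (Sob_dual_form fs)))
  (Sob_dual_spfun Hc Eneg mhg hg1 gd).
by apply: (eq_Sob_dual Eneg _ d) => x _; rewrite TeE.
Qed.

(** The vectors [E N x] are finite sums of eigenvectors and tend to [x]. *)
Lemma Sob_dual_eigen_eq0 (s : R) l : Sob_dual E s l ->
  (forall lam psi, sp_eigen E lam psi -> l psi = 0) -> forall x, Sob E s x -> l x = 0.
Proof.
move=> ld l0 x xs.
have lres (b : R) : l (E b x) = 0.
  have [u [ue ->]] := Eatomic b x.
  elim: u ue => [|p u ih] ue; first by rewrite big_nil (Sob_dual0 Eneg ld).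
  have pu : forall p', p' \in u -> sp_eigen E p'.1 p'.2.
    by move=> p' p'u; apply: ue; rewrite inE p'u orbT.
  have us : Sob E s (\sum_(p <- u) p.2).
    elim: u pu {ih ue} => [|p' u ih] pu; first by rewrite big_nil; exact: Sob0.
    rewrite big_cons; apply: (SobD Eneg).
      by apply: (Sob_eigen Eneg); apply: pu; rewrite mem_head.
    by apply: ih => p'' p''u; apply: pu; rewrite inE p''u orbT.
  have pe := ue p (mem_head _ _).
  rewrite big_cons (Sob_dual_addr ld (Sob_eigen Eneg s pe) us).
  by rewrite (l0 _ _ pe) (ih pu) addr0.
have lx k : `|l x| <= dual_norm E s l * sobn E s (x - E k%:R x).
  have xks := Sob_res Eneg k%:R xs.
  have := le_dual_norm Eneg ld (SobB Eneg xs xks).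
  by rewrite (Sob_dual_subr Eneg ld xs xks) lres subr0.
apply/eqP; rewrite -normr_le0.
have c0 : dual_norm E s l * sobn E s (x - E k%:R x) @[k --> \oo] --> (0 : R).
  rewrite -[X in _ --> X](mulr0 (dual_norm E s l)).
  by apply: cvgM; [exact: cvg_cst|exact: cvg_res_sob].
have <- := cvg_lim (@Rhausdorff R) c0.
apply: limr_ge; first by apply/cvg_ex; exists 0.
by near=> k; exact: lx.
Unshelve. all: by end_near.
Qed.

Lemma sp_eigen_scale lam c psi : sp_eigen E lam psi -> sp_eigen E lam (c *: psi).
Proof. by move=> h l; rewrite resZ h; case: ifP => _ //; rewrite scaler0. Qed.

Section fixed_point.
Variables (f : H) (g p : H -> R).
Hypotheses (fs : Sob E 2^-1 f) (gd : Sob_dual E 2^-1 g) (pd : Sob_dual E 2^-1 p).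
Hypothesis p_eigen : forall lam psi, sp_eigen E lam psi ->
  p psi = g psi * cosh (lam * T) + lam * ip f psi * sinh (lam * T).

(** On an eigenvector, [1 - tanh ^+ 2 = cosh ^- 2] turns the formula for [p] into
    the equation of a fixed point. *)
Lemma Te_fixed_point psi : Sob E 2^-1 psi -> Te E T f g p psi = p psi.
Proof.
move=> psis; apply/eqP; rewrite -subr_eq0; apply/eqP.
have dd : Sob_dual E 2^-1 (Te E T f g p - p).
  exact: Sob_dualB (Te_Sob_dual fs gd pd) pd.
apply: (Sob_dual_eigen_eq0 dd _ psis) => lam x xlam.
have xs := Sob_eigen Eneg 2^-1 xlam.
rewrite -[LHS]/(Te E T f g p x - p x) TeE.
rewrite (spfun_sp_eigen Hc mm m1 xlam) (spfun_sp_eigen Hc mhf hf1 xlam).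
rewrite (spfun_sp_eigen Hc mhg hg1 xlam).
rewrite (Sob_dualZ Eneg _ pd xs) (Sob_dualZ Eneg _ gd xs).
have hxlam := sp_eigen_scale (hf lam) xlam.
rewrite (sp_int_eigen hxlam (sob_half_integrable_id fs)) ipZr (p_eigen xlam).
rewrite /m /hf /hg tanh_sqr; have c0 := lt0r_neq0 (cosh_gt0 (lam * T)).
by field.
Qed.

(** [Te] is affine with linear part the transpose of [tanh(AT) ^+ 2], and [p] is a
    fixed point. *)
Lemma iter_Te phi0 k psi : Sob_dual E 2^-1 phi0 -> Sob E 2^-1 psi ->
  iter k (Te E T f g) phi0 psi = p psi + (phi0 - p) (iter k (spfun E m) psi).
Proof.
move=> d0; elim: k psi => [|k ih] psi psis.
  by rewrite /= -[(phi0 - p) psi]/(phi0 psi - p psi) addrC subrK.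
have Mpsi := Sob_spfun Hc Eneg mm m1 psis.
rewrite iterS TeE (ih _ Mpsi) iterSr -(Te_fixed_point psis) TeE.
move: (p (spfun E m psi)) ((phi0 - p) (iter k (spfun E m) (spfun E m psi))).
by move: (sp_int _ _ _ _) (g _) => r1 r2 r3 r4; ring.
Qed.

Lemma cvg_dual_iter_Te phi0 : Sob_dual E 2^-1 phi0 ->
  cvg_dual E 2^-1 (fun k => iter k (Te E T f g) phi0) p.
Proof.
move=> d0; have dd := Sob_dualB d0 pd.
have ddk k := Sob_dual_iter_spfun Hc Eneg k mm m1 dd.
split => [k|//|].
  apply: (eq_Sob_dual Eneg _ (Sob_dualD pd (ddk k))) => x xs.
  by rewrite (iter_Te k d0 xs).
have eq_norm k : dual_norm E 2^-1 (iter k (Te E T f g) phi0 - p) =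
    dual_norm E 2^-1 (fun x => (phi0 - p) (iter k (spfun E m) x)).
  congr sup; apply: eq_imagel => x [xs _]; congr (`| _ |).
  rewrite -[LHS]/(iter k (Te E T f g) phi0 x - p x) (iter_Te k d0 xs).
  by rewrite addrC addKr.
rewrite (eq_cvg _ _ eq_norm).
apply: (cvg_dual_iter_spfun Hc Eneg mm m1 _ dd) => N.
(* On the band [cosh (r T) <= K], hence [tanh (r T) ^+ 2 <= 1 - K ^- 2]. *)
pose K := expR ((N%:R + 1) * T); have K1 : 1 <= K.
  by rewrite -expR0 ler_expR mulr_ge0 ?addr_ge0// ltW.
have K0 : 0 < K ^+ 2 by rewrite exprn_gt0// (lt_le_trans ltr01).
exists (1 - (K ^+ 2)^-1).
  rewrite ltrBlDr ltrDl invr_gt0 K0 andbT subr_ge0 invf_le1// expr_ge1//.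
  exact: le_trans ler01 K1.
move=> r /andP[r1 rN]; rewrite ger0_norm ?sqr_ge0// /m tanh_sqr lerB// lef_pV2 ?posrE//.
  rewrite ler_pXn2r ?nnegrE ?(ltW (cosh_gt0 _)) ?expR_ge0//.
  apply: cosh_le_expR; rewrite normrM (gtr0_norm T0) ler_wpM2r ?(ltW T0)//.
  have := ler0n R N; rewrite ler_norml => N0; apply/andP; split; lra.
by rewrite exprn_gt0// cosh_gt0.
Qed.

End fixed_point.
End kozlov_mazya_iteration.

Theorem theorem4 (R : realType) (n : nat)
  (Omega : set 'rV[R]_n) (Omega_open : open Omega)
  (Omega_bounded : bounded_set Omega) (Omega_smooth : smooth_boundary Omega)
  (A : operator (L2 (lebesgue_on Omega_open)))
  (A_sa : self_adjoint A) (A_pos : positive_op A) (A_unbounded : unbounded A)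
  (A_discrete : discrete_spectrum A)
  (E : resolution (L2 (lebesgue_on Omega_open))) (EA : resolution_of E A)
  (T : R) (T_gt0 : 0 < T)
  (f : L2 (lebesgue_on Omega_open)) (g phi0 : L2 (lebesgue_on Omega_open) -> R)
  (Hf : Sob E 2^-1 f) (Hg : Sob_dual E 2^-1 g) (Hphi0 : Sob_dual E 2^-1 phi0)
  (u : R -> L2 (lebesgue_on Omega_open)) (Hu : Ve E T u)
  (u0 : trace E T u 0 f) (dtu0 : trace_dt E T u 0 g) :
  exists dtuT : L2 (lebesgue_on Omega_open) -> R,
    trace_dt E T u T dtuT /\
    cvg_dual E 2^-1 (fun k => iter k (Te E T f g) phi0) dtuT.
Proof.
have Hc : hilbert (L2 (lebesgue_on Omega_open)) by exact: L2_hilbert.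
have Eneg := res_negative Hc EA A_pos.
have Eatomic := res_eigenvectors Hc EA A_pos A_discrete.
have [v [v_cont vu v0]] := u0.
have [P [P_cont P_dt P0]] := dtu0.
exists (P T); split; first by exists P.
have [|pd _] := P_cont T; first by rewrite in_itv/= lexx ltW.
apply: (cvg_dual_iter_Te Hc Eneg T_gt0 Eatomic Hf Hg pd _ Hphi0) => lam psi psilam.
exact: (trace_dt_eigen Eneg T_gt0 Hu v_cont vu v0 P_cont P_dt P0 psilam).
Qed.
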